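(* Let $M$ be a closed connected oriented four-dimensional piecewise-linear manifold with a simplicial triangulation, equipped with the Euclidean geometric data described in the context. Let $\mathcal C$ (a set of edges) and $\mathcal D$ (a set of two-dimensional faces) be such that the submatrix $\mathcal B$ of $(\partial\omega_i/\partial L_a)$ with rows $i\in\mathcal D$ and columns $a\in\mathcal C$ is a largest square submatrix with nonzero determinant, and let $\overline{\mathcal C},\overline{\mathcal D}$ be the complementary sets of edges and of two-dimensional faces. Then the value $$ \frac{\displaystyle\prod_{\text{all 2-dim. faces}} S\;\cdot\;\bigwedge_{i\in\overline{\mathcal D}} dS_i\;\cdot\;\bigwedge_{a\in\overline{\mathcal C}} dL_a}{\displaystyle\det\mathcal B\;\cdot\prod_{\text{all 4-simplices}} V}, $$ taken up to sign, does not depend on the choice of the sets $\mathcal C$ and $\mathcal D$, and it is an invariant of moves $3\to3$. (The sense in which the products of differentials are understood, and in which values before and after a move are compared, is fixed in the context.)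
   Context: **Geometric data.** $M$ is a closed connected oriented PL 4-manifold represented as a finite simplicial complex; its 4-simplices are consistently oriented. Let $\varphi:\pi_1(M)\to E_4$ be a fixed homomorphism to the group of motions of Euclidean $\mathbb R^4$. Consider the universal cover of the triangulation, and a map $f$ from its vertices to $\mathbb R^4$ constructed as follows: one vertex in each class (fiber over a vertex of $M$) is sent to an arbitrary point, and $f(g(A))=\varphi(g)f(A)$ for all $g\in\pi_1(M)$ and all vertices $A$. The image of a cell is the convex hull of the images of its vertices; it is required that the images of all 4-simplices be nondegenerate (nonzero volume). Fix an orientation of $\mathbb R^4$. Each edge $a$ of $M$ gets a squared length $L_a$ (squared distance between the images of the ends of any lift), and each 4-simplex gets a sign $+$ or $-$ according to whether its orientation is preserved or changed under the map to $\mathbb R^4$. (Lengths and signs are the same for all lifts of a given cell.) $V$ denotes the oriented volume of a 4-simplex (the volume with that sign), and $S_i$ the area of the two-dimensional face $i$. **Deficit angles.** In each 4-simplex, the inner dihedral angle $\vartheta$ at a two-dimensional face is taken with the sign of the 4-simplex. For a two-dimensional face $i$, $\omega_i=-\sum_k\vartheta_k \pmod{2\pi}$, the sum over the 4-simplices containing $i$. At the initial data all $\omega_i$ are zero (flat case); all derivatives are taken there. **Matrix $(\partial\omega_i/\partial L_a)$.** The squared lengths of all edges of the complex are varied independently near the initial values; each 4-simplex remains Euclidean and keeps its sign, and its dihedral angles are computed from its own ten edge lengths. **Matrix $(\partial\omega_i/\partial S_j)$.** The areas of all two-dimensional faces of the complex are varied independently near the initial values. In each 4-simplex, the variations of its edge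 lengths and dihedral angles are computed from the variations of its own ten face areas (it is assumed that for each 4-simplex the $10\times10$ Jacobian of areas with respect to squared edge lengths is invertible), ignoring the fact that the length variations of one edge computed from different 4-simplices may disagree. **Edge deficit angles.** For an edge $a$, in each 4-simplex containing $a$ put $\Theta_a=\sum_i\frac{\partial S_i}{\partial L_a}\vartheta_i$ (sum over its two-dimensional faces), and $\Omega_a=-\sum_k(\Theta_a)_k$ over the 4-simplices containing $a$, so that $\Omega_a=\sum_j\frac{\partial S_j}{\partial L_a}\omega_j$. The derivatives are taken at $\omega_j=0$, so $\frac{\partial\Omega_a}{\partial S_i}=\sum_j\frac{\partial S_j}{\partial L_a}\frac{\partial\omega_j}{\partial S_i}$. **Differential forms.** $\bigwedge_{a\in\overline{\mathcal C}}dL_a$ is regarded as an exterior product of linear forms on the linear space of infinitesimal length deformations $(dL_a)_a$ with $d\omega_i=\sum_a\frac{\partial\omega_i}{\partial L_a}dL_a=0$ for all $i$. $\bigwedge_{i\in\overline{\mathcal D}}dS_i$ is regarded as an exterior product of linear forms on the linear space of infinitesimal area deformations $(dS_i)_i$ with $d\Omega_a=\sum_i\frac{\partial\Omega_a}{\partial S_i}dS_i=0$ for all $a$. Their product is the product of these two top-degree forms on the two spaces (an element of the tensor product of the two one-dimensional spaces of top forms). **Moves $3\to3$.** Let $ABC$ be a two-dimensional face belonging to exactly three 4-simplices, whose vertex sets are $ABCDE$, $ABCEF$, $ABCFD$. The move replaces these by the three 4-simplices with vertex sets $BCDEF$, $ACDEF$, $ABDEF$, which share the face $DEF$ (which is not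 in the original complex) and have the same boundary; they are oriented consistently with the rest of $M$. The set of edges and the map $f$ on vertices do not change, the face $ABC$ is removed and the face $DEF$ added; the new 4-simplices are required to have nondegenerate images (and, for each of them, the $10\times10$ Jacobian of its face areas with respect to its squared edge lengths is required to be invertible). **Comparison before and after a move.** When $ABC\in\mathcal D$ before the move, one takes after the move the same $\mathcal C$ and the set $\mathcal D$ with $ABC$ replaced by $DEF$, so that $\overline{\mathcal C}$ and $\overline{\mathcal D}$ are unchanged. Invariance means that the coefficient of $\bigwedge_{\overline{\mathcal D}}dS\cdot\bigwedge_{\overline{\mathcal C}}dL$ (with these same $\overline{\mathcal D}$, $\overline{\mathcal C}$) in the displayed value is the same, up to sign, before and after the move. *)

(* Defs.v *)
From HB Require Import structures.
From mathcomp Require Export all_boot all_order all_algebra perm ring.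
From mathcomp Require Export all_classical all_reals all_analysis.

Set Implicit Arguments.
Unset Strict Implicit.
Unset Printing Implicit Defensive.

Export Order.TTheory GRing.Theory Num.Theory.
Export numFieldNormedType.Exports.

Local Open Scope set_scope.
Local Open Scope ring_scope.

(* A finite abstract simplicial complex is the set [K] of its nonempty simplices,
each given by its set of vertices in the finite type [V].  Edges,
two-dimensional faces and 4-simplices are thus elements of [{set V}] with 2, 3
and 5 elements. *)

Definition is_complex (V : finType) (K : {set {set V}}) : Prop :=
  (finset.set0 \notin K) /\
  (forall s t : {set V}, s \in K -> t \subset s -> t != finset.set0 -> t \in K).

Definition ksubsets (V : finType) (k : nat) (s : {set V}) : {set {set V}} :=
  [set t : {set V} | (t \subset s) && (#|t| == k)].

Definition edges (V : finType) (K : {set {set V}}) : {set {set V}} :=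
  [set s in K | #|s| == 2%N].
Definition faces (V : finType) (K : {set {set V}}) : {set {set V}} :=
  [set s in K | #|s| == 3%N].
Definition simplices4 (V : finType) (K : {set {set V}}) : {set {set V}} :=
  [set s in K | #|s| == 5%N].

(* [edge_rel K u u] holds for a vertex [u] of [K]: constant steps are allowed
   in edge paths. *)
Definition edge_rel (V : finType) (K : {set {set V}}) : rel V :=
  fun u v => [set u; v] \in K.

Definition connected_complex (V : finType) (K : {set {set V}}) : Prop :=
  forall u v : V, [set u] \in K -> [set v] \in K -> connect (edge_rel K) u v.

Definition link (V : finType) (K : {set {set V}}) (v : V) : {set {set V}} :=
  [set s in K | (v \notin s) && (v |: s \in K)].

(* Points of the geometric realization, in barycentric coordinates. *)
Definition realization (R : realType) (V : finType) (K : {set {set V}}) :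
    set {ffun V -> R} :=
  [set x | [/\ forall v, 0 <= x v, \sum_v x v = 1
             & [set v | x v != 0]%SET \in K]]%classic.

Definition conv_hull (R : realType) (V : finType) (s : seq {ffun V -> R}) :
    set {ffun V -> R} :=
  [set x | exists w : 'I_(size s) -> R,
     [/\ forall k, 0 <= w k, \sum_k w k = 1 & x = \sum_k w k *: s`_k]]%classic.

Definition affine_on (R : realType) (V U : finType)
    (P : set {ffun V -> R}) (h : {ffun V -> R} -> {ffun U -> R}) : Prop :=
  forall x y (t : R), P x -> P y -> 0 <= t <= 1 ->
    h (t *: x + (1 - t) *: y) = t *: h x + (1 - t) *: h y.

(* A PL homeomorphism is a bijection of polyhedra which is affine on each of
   finitely many compact convex polytopes covering its source.  Continuity, and
   the same property for the inverse map, follow. *)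
Definition PL_homeomorphic (R : realType) (V U : finType)
    (K : {set {set V}}) (L : {set {set U}}) : Prop :=
  exists h : {ffun V -> R} -> {ffun U -> R},
    set_bij (realization K) (realization L) h /\
    exists cover : seq (seq {ffun V -> R}),
      [/\ forall s, s \in cover -> (conv_hull s `<=` realization K)%classic,
          forall x, realization K x -> exists2 s, s \in cover & conv_hull s x
        & forall s, s \in cover -> affine_on (conv_hull s) h].

Definition simplex4_boundary : {set {set 'I_5}} :=
  [set s : {set 'I_5} | (s != finset.set0) && (s != [set: 'I_5])].

(* A complex triangulating a closed PL 4-manifold: all vertex links are PL
   3-spheres. *)
Definition closed_PL4_manifold (R : realType) (V : finType)
    (K : {set {set V}}) : Prop :=
  is_complex K /\
  (forall v : V, [set v] \in K ->
     PL_homeomorphic R (link K v) simplex4_boundary).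

(* [orn t] tells whether the ordering [t] of the vertices of a 4-simplex is a
   positive one.  The second clause is the consistency of orientations of two
   4-simplices with a common three-dimensional face [w]. *)
Definition orientation (V : finType) (K : {set {set V}})
    (orn : seq V -> bool) : Prop :=
  (forall (t : 5.-tuple V) (s : 'S_5), uniq t -> [set x in t] \in K ->
     orn [tuple tnth t (s i) | i < 5] = orn t (+) odd_perm s) /\
  (forall (p q : V) (w : 4.-tuple V), p != q ->
     uniq (p :: w) -> [set x in p :: w] \in K ->
     uniq (q :: w) -> [set x in q :: w] \in K ->
     orn (p :: w) != orn (q :: w)).

(* An edge path from the base vertex [b] is represented by the sequence [p] of its
vertices other than the initial one, so that its vertices are [b :: p].  The
vertices of the universal cover are the homotopy classes of edge paths from
[b], and the fundamental group consists of the classes of closed paths, with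
product [g ++ h] and acting on the vertices of the universal cover by
[p |-> g ++ p].  A function on the universal cover (or on the fundamental
group) is a function of [p] which is constant on homotopy classes. *)

Inductive homotopic (V : finType) (K : {set {set V}}) :
    seq V -> seq V -> Prop :=
| homotopic_refl p : homotopic K p p
| homotopic_sym p q : homotopic K p q -> homotopic K q p
| homotopic_trans p q r :
    homotopic K p q -> homotopic K q r -> homotopic K p r
| homotopic_stutter p u q :
    homotopic K (p ++ u :: u :: q) (p ++ u :: q)
| homotopic_triangle p u v w q :
    [set u; v; w] \in K ->
    homotopic K (p ++ u :: v :: w :: q) (p ++ u :: w :: q).

Definition epath (V : finType) (K : {set {set V}}) (b : V) (p : seq V) : Prop :=
  path (edge_rel K) b p.

Definition eloop (V : finType) (K : {set {set V}}) (b : V) (p : seq V) : Prop :=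
  epath K b p /\ last b p = b.

(* Proper motions: the sign of a 4-simplex is the same for all its lifts only
   if the motions preserve the orientation. *)
Definition motion (R : realType) (m : 'rV[R]_4 -> 'rV[R]_4) : Prop :=
  exists (Q : 'M[R]_4) (t : 'rV[R]_4),
    [/\ Q *m Q^T = 1%:M, \det Q = 1 & forall x, m x = x *m Q + t].

Definition pi1_hom (R : realType) (V : finType) (K : {set {set V}}) (b : V)
    (phi : seq V -> 'rV[R]_4 -> 'rV[R]_4) : Prop :=
  [/\ forall g, eloop K b g -> motion (phi g),
      forall g h, eloop K b g -> eloop K b h ->
        homotopic K (b :: g) (b :: h) -> phi g =1 phi h
    & forall g h, eloop K b g -> eloop K b h ->
        phi (g ++ h) =1 phi g \o phi h].

Definition equivariant_map (R : realType) (V : finType) (K : {set {set V}})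
    (b : V) (phi : seq V -> 'rV[R]_4 -> 'rV[R]_4) (f : seq V -> 'rV[R]_4) :
    Prop :=
  (forall p q, epath K b p -> epath K b q ->
     homotopic K (b :: p) (b :: q) -> f p = f q) /\
  (forall g p, eloop K b g -> epath K b p -> f (g ++ p) = phi g (f p)).

Definition dot (R : realType) (x y : 'rV[R]_4) : R := (x *m y^T) 0 0.

(* An edge path from [b] to some vertex of [s].  It selects a lift of [s] to the
   universal cover, with vertices the classes of [rcons p v], [v \in s].  By
   equivariance the lengths and oriented volumes below do not depend on it. *)
Definition path_to (V : finType) (K : {set {set V}}) (b : V) (s : {set V}) :
    seq V :=
  xget [::] [set p | epath K b p /\ last b p \in s]%classic.

Definition vertex_image (R : realType) (V : finType) (K : {set {set V}}) (b : V)
    (f : seq V -> 'rV[R]_4) (s : {set V}) (v : V) : 'rV[R]_4 :=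
  f (rcons (path_to K b s) v).

Definition len2 (R : realType) (V : finType) (K : {set {set V}}) (b : V)
    (f : seq V -> 'rV[R]_4) (a : {set V}) : R :=
  if enum a is [:: u; v] then
    let d := vertex_image K b f a u - vertex_image K b f a v in dot d d
  else 0.

(* Oriented volume of a 4-simplex [s].  The space R^4 has its standard
   orientation; the other choice amounts to replacing [orn] by its negation. *)
Definition ovol (R : realType) (V : finType) (K : {set {set V}}) (b : V)
    (orn : seq V -> bool) (f : seq V -> 'rV[R]_4) (s : {set V}) : R :=
  if enum s is o :: t then
    (-1) ^+ (~~ orn (enum s)) *
    \det (\matrix_(i < 4)
            (vertex_image K b f s (nth o t i) - vertex_image K b f s o)) / 24%:R
  else 0.

Definition nondegenerate (R : realType) (V : finType) (K : {set {set V}})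
    (b : V) (orn : seq V -> bool) (f : seq V -> 'rV[R]_4) : Prop :=
  forall s, s \in simplices4 K -> ovol K b orn f s != 0.

(* [L : {set V} -> R] assigns squared lengths to edges; its values on other sets
are irrelevant.  A Euclidean simplex with these edges carries on its tangent
space the inner product given by polarization, which is [gram] below:
[gram L o u v] is the inner product of the vectors [ou] and [ov]. *)

Definition dist2 (R : realType) (V : finType) (L : {set V} -> R) (u v : V) : R :=
  if u == v then 0 else L [set u; v].

Definition gram (R : realType) (V : finType) (L : {set V} -> R) (o u v : V) : R :=
  (dist2 L o u + dist2 L o v - dist2 L u v) / 2%:R.

Definition area (R : realType) (V : finType) (L : {set V} -> R) (i : {set V}) : R :=
  if enum i is [:: a; b; c] then
    Num.sqrt (gram L a b b * gram L a c c - gram L a b c ^+ 2) / 2%:R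
  else 0.

(* Inner product of the components of the vectors [ap] and [aq] orthogonal to
   the plane of the triangle [abc] (see [perp_dot_points]). *)
Definition perp_dot (R : realType) (V : finType) (L : {set V} -> R)
    (a b c p q : V) : R :=
  let e (k : 'I_2) := if k == 0 then b else c in
  let G : 'M[R]_2 := \matrix_(k, l) gram L a (e k) (e l) in
  let gp : 'rV[R]_2 := \row_k gram L a p (e k) in
  let gq : 'cV[R]_2 := \col_k gram L a (e k) q in
  gram L a p q - (gp *m invmx G *m gq) 0 0.

(* Unsigned inner dihedral angle of the 4-simplex [s] at its face [i]. *)
Definition dihedral (R : realType) (V : finType) (L : {set V} -> R)
    (s i : {set V}) : R :=
  match enum i, enum (s :\: i) with
  | [:: a; b; c], [:: p; q] =>
      acos (perp_dot L a b c p q /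
            Num.sqrt (perp_dot L a b c p p * perp_dot L a b c q q))
  | _, _ => 0
  end.

Lemma gram_points (R : realType) (V : finType) (L : {set V} -> R)
    (x : V -> 'rV[R]_4) :
  (forall u v, u != v -> L [set u; v] = dot (x u - x v) (x u - x v)) ->
  forall o u v, gram L o u v = dot (x u - x o) (x v - x o).
Proof.
move=> HL o u v.
have HD s t : dist2 L s t = dot (x s - x t) (x s - x t).
  rewrite /dist2; case: eqP => [->|/eqP/HL->//].
  by rewrite subrr /dot mul0mx mxE.
rewrite /gram !HD /dot !mxE -big_split -sumrB mulr_suml /=.
by apply: eq_bigr => k _; rewrite !mxE; field.
Qed.

(* For points [x] of R^4: if [mp] and [mq] are the components of [ap] and [aq]
   orthogonal to the nondegenerate triangle [abc], then [perp_dot] is their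
   inner product. *)
Lemma perp_dot_points (R : realType) (V : finType) (L : {set V} -> R)
    (x : V -> 'rV[R]_4) (a b c p q : V) (mp mq : 'rV[R]_4) (wp wq : 'rV[R]_2) :
  (forall u v, u != v -> L [set u; v] = dot (x u - x v) (x u - x v)) ->
  let B : 'M[R]_(2, 4) :=
    \matrix_(k < 2) ((if k == 0 then x b else x c) - x a) in
  B *m B^T \in unitmx ->
  x p - x a = mp + wp *m B -> mp *m B^T = 0 ->
  x q - x a = mq + wq *m B -> mq *m B^T = 0 ->
  perp_dot L a b c p q = dot mp mq.
Proof.
move=> HL B uB Ep op Eq oq; have g := gram_points HL.
pose e (k : 'I_2) := if k == 0 then b else c.
pose G : 'M[R]_2 := \matrix_(k, l) gram L a (e k) (e l).
pose gp : 'rV[R]_2 := \row_k gram L a p (e k).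
pose gq : 'cV[R]_2 := \col_k gram L a (e k) q.
rewrite -[LHS]/(gram L a p q - (gp *m invmx G *m gq) 0 0).
have Bk k : row k B = x (e k) - x a.
  by rewrite rowK /e; case: (k == 0).
have EG : G = B *m B^T.
  apply/matrixP=> k l; rewrite mxE g -!Bk /dot !mxE.
  by apply: eq_bigr => m _; rewrite !mxE.
have Egp : gp = wp *m (B *m B^T).
  have -> : gp = (x p - x a) *m B^T.
    apply/rowP=> k; rewrite mxE g -Bk /dot !mxE.
    by apply: eq_bigr => m _; rewrite !mxE.
  by rewrite Ep mulmxDl op add0r mulmxA.
have oq' : B *m mq^T = 0 by rewrite -[LHS]trmxK trmx_mul trmxK oq trmx0.
have Egq : gq = B *m B^T *m wq^T.
  have -> : gq = B *m (x q - x a)^T.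
    apply/colP=> k; rewrite mxE g -Bk /dot !mxE.
    by apply: eq_bigr => m _; rewrite !mxE.
  by rewrite Eq linearD /= mulmxDr oq' add0r trmx_mul mulmxA.
rewrite Egp Egq EG mulmxK // g Ep Eq /dot linearD /= trmx_mul.
rewrite mulmxDl !mulmxDr !mulmxA op mul0mx addr0.
by rewrite -(mulmxA wp B mq^T) oq' mulmx0 add0r !mxE addrK.
Qed.

(* In what follows [vol] gives the oriented volumes of 4-simplices at the initial data; the
sign of a 4-simplex is the sign of [vol].  Real representatives of the angles
modulo 2 pi are used. *)

Definition omega (R : realType) (V : finType) (K : {set {set V}})
    (vol : {set V} -> R) (L : {set V} -> R) (i : {set V}) : R :=
  - \sum_(s in simplices4 K | i \subset s) Num.sg (vol s) * dihedral L s i.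

Definition dlen (R : realType) (V : finType) (F : ({set V} -> R) -> R)
    (L : {set V} -> R) (a : {set V}) : R :=
  derive1 (fun t : R => F (fun s => if s == a then L s + t else L s)) 0.

Definition domega_dL (R : realType) (V : finType) (K : {set {set V}})
    (vol L : {set V} -> R) (i a : {set V}) : R :=
  dlen (fun L' => omega K vol L' i) L a.

Definition dS_dL (R : realType) (V : finType) (L : {set V} -> R)
    (i a : {set V}) : R :=
  dlen (fun L' => area L' i) L a.

(* The Jacobian of the ten face areas of the 4-simplex [s] (rows) with respect
   to its ten squared edge lengths (columns). *)
Definition area_jacobian (R : realType) (V : finType) (L : {set V} -> R)
    (s : {set V}) : 'M[R]_10 :=
  \matrix_(k, l) dS_dL L (nth finset.set0 (enum (ksubsets 3 s)) k)
                         (nth finset.set0 (enum (ksubsets 2 s)) l).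

Definition regular_areas (R : realType) (V : finType) (K : {set {set V}})
    (L : {set V} -> R) : Prop :=
  forall s, s \in simplices4 K -> area_jacobian L s \in unitmx.

(* For faces [i] and [j] of the 4-simplex [s]: the derivative of the dihedral
   angle at [i] with respect to the area of [j] inside [s]. *)
Definition ddihedral_dS (R : realType) (V : finType) (L : {set V} -> R)
    (s i j : {set V}) : R :=
  let dtheta : 'rV[R]_10 :=
    \row_l dlen (fun L' => dihedral L' s i) L
                (nth finset.set0 (enum (ksubsets 2 s)) l) in
  (dtheta *m invmx (area_jacobian L s)) 0
    (inord (index j (enum (ksubsets 3 s)))).

Definition domega_dS (R : realType) (V : finType) (K : {set {set V}})
    (vol L : {set V} -> R) (i j : {set V}) : R :=
  - \sum_(s in simplices4 K | (i \subset s) && (j \subset s))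
      Num.sg (vol s) * ddihedral_dS L s i j.

(* The derivative of the edge deficit angle Omega_a = sum_j (dS_j/dL_a) omega_j
   at omega = 0. *)
Definition dOmega_dS (R : realType) (V : finType) (K : {set {set V}})
    (vol L : {set V} -> R) (a i : {set V}) : R :=
  \sum_(j in faces K) dS_dL L j a * domega_dS K vol L j i.

Definition flat (R : realType) (V : finType) (K : {set {set V}})
    (vol L : {set V} -> R) : Prop :=
  forall i, i \in faces K ->
    exists m : int, omega K vol L i = m%:~R * (2%:R * pi).

Definition square_minor (R : realType) (V : finType) (K : {set {set V}})
    (vol L : {set V} -> R) (C D : {set {set V}}) : R :=
  \det (\matrix_(k < #|C|, l < #|C|)
          domega_dL K vol L (nth finset.set0 (enum D) k) (nth finset.set0 (enum C) l)).

Definition nonzero_minor (R : realType) (V : finType) (K : {set {set V}})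
    (vol L : {set V} -> R) (C D : {set {set V}}) : Prop :=
  [/\ C \subset edges K, D \subset faces K, #|C| = #|D|
    & square_minor K vol L C D != 0].

Definition largest_minor (R : realType) (V : finType) (K : {set {set V}})
    (vol L : {set V} -> R) (C D : {set {set V}}) : Prop :=
  nonzero_minor K vol L C D /\
  (forall C' D', nonzero_minor K vol L C' D' -> (#|C'| <= #|C|)%N).

Definition coefficient (R : realType) (V : finType) (K : {set {set V}})
    (vol L : {set V} -> R) (C D : {set {set V}}) : R :=
  (\prod_(i in faces K) area L i) /
  (square_minor K vol L C D * \prod_(s in simplices4 K) vol s).

(* The spaces of infinitesimal deformations (dL_a) with all d omega_i = 0 and
   (dS_i) with all d Omega_a = 0; deformations are extended by zero from edges
   (resp. faces) to all of [{set V}]. *)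
Definition length_deformations (R : realType) (V : finType)
    (K : {set {set V}}) (vol L : {set V} -> R) : set ({set V} -> R) :=
  [set x | (forall s, s \notin edges K -> x s = 0) /\
     forall i, i \in faces K ->
       \sum_(a in edges K) domega_dL K vol L i a * x a = 0]%classic.

Definition area_deformations (R : realType) (V : finType)
    (K : {set {set V}}) (vol L : {set V} -> R) : set ({set V} -> R) :=
  [set x | (forall s, s \notin faces K -> x s = 0) /\
     forall a, a \in edges K ->
       \sum_(i in faces K) dOmega_dS K vol L a i * x i = 0]%classic.

(* The exterior product of the linear forms [l], of degree [n = size l], as an
   alternating function of the vectors [u 0, ..., u n.-1]. *)
Definition wedge (R : realType) (W : Type) (l : seq (W -> R)) (u : nat -> W) : R :=
  \det (\matrix_(j < size l, k < size l) nth (fun=> 0) l j (u k)).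

Definition coord_forms (R : realType) (V : finType) (A : {set {set V}}) :
    seq (({set V} -> R) -> R) :=
  [seq (fun x : {set V} -> R => x s) | s <- enum A].

(* The displayed value.  The product of a form on area deformations with a form
   on length deformations is their tensor product, i.e. the product of their
   values on the independent arguments [u] and [w]. *)
Definition value (R : realType) (V : finType) (K : {set {set V}})
    (vol L : {set V} -> R) (C D : {set {set V}})
    (u w : nat -> {set V} -> R) : R :=
  coefficient K vol L C D *
  wedge (coord_forms R (faces K :\: D)) u *
  wedge (coord_forms R (edges K :\: C)) w.

(* All simplices containing the face [T] are removed; the simplices of
   [T :|: U] containing the face [U] but not [T] are added. *)
Definition move33 (V : finType) (K : {set {set V}}) (T U : {set V}) :
    {set {set V}} :=
  [set s in K | ~~ (T \subset s)] :|:
  [set s : {set V} | [&& U \subset s, s \subset T :|: U & ~~ (T \subset s)]].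

(* The face [abc] belongs to exactly the three 4-simplices abcde, abcef, abcfd,
   and [def] is not in [K]. *)
Definition move33_applicable (V : finType) (K : {set {set V}})
    (a b c d e f : V) : Prop :=
  [/\ uniq [:: a; b; c; d; e; f],
      [set a; b; c] \in faces K,
      [set s in simplices4 K | [set a; b; c] \subset s] =
        [set [set a; b; c; d; e]; [set a; b; c; e; f]; [set a; b; c; f; d]]
    & [set d; e; f] \notin K].

(* Main.v *)
(** The sum of area times differential of the dihedral angle over the faces of a
    4-simplex vanishes (Schlaefli), so the derivatives of its angles with respect
    to its areas form a symmetric matrix, and the matrix of the derivatives of the
    [Omega_a] with respect to the [S_i] is the transpose of that of the [omega_i]
    with respect to the [L_a].  The space of area deformations is thus the
    annihilator of the image of the map from length deformations to deficit
    angles, and the independence of the choice of the two sets is the duality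
    between complementary minors of a matrix and of its kernel.

    The images of the six vertices of a move satisfy one affine relation, and its
    coefficients [al v] can be normalized to be the volumes of the three old
    4-simplices and minus those of the three new ones; the signs agree because no
    tetrahedron of a PL manifold lies in a single 4-simplex.  The signed sum, over
    all six 4-simplices, of the differentials of the angles at a face [i] is then
    [c i] times a linear form that is the same for all faces, where [c i] is the
    area of [i] divided by the product of the [al v] over the vertices [v] not
    in [i].  Hence the row of the new face is, up to the factor
    [- c U / c T], that of the removed one, and the other rows change by multiples
    of it. *)

Require Import Defs.
From mathcomp Require Import lra fintype finset.

Set Implicit Arguments.
Unset Strict Implicit.
Unset Printing Implicit Defensive.

Local Open Scope ring_scope.

(** * Tetrahedra of PL 4-manifolds *)

(** The sign of the new volumes is the delicate point. After the move the orientation is only known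
    to be consistent and to agree with the old one on common 4-simplices, so a new and an old
    4-simplex sharing a tetrahedron are compared through a third one on it that survives the move.
    It exists because, in the link of a vertex, a triangle cannot lie in a single tetrahedron. A PL
    homeomorphism being a bijection affine on the pieces of a cover, this is proved without
    homology: segments in the boundary of a 4-simplex are pulled back through the map.

    All derivatives are computed with the gradients [n u] of the barycentric coordinates. A
    variation of the lengths of a 4-simplex is a quadratic form, and the variations of the angle and
    of the logarithm of the area of a face need only its trace and its values on the normals [n p],
    [n q] to that face. Sums over faces become sums over pairs of vertices, and the symmetry reduces
    to vanishing row sums.

    The linear form common to all faces in a move is, up to a constant, the variation of the squared
    length of the vector [sum al v x v], a vector that is zero initially. *)

Definition conv_pts (R : realType) (V : finType) (n : nat)
    (p : 'I_n -> {ffun V -> R}) : set {ffun V -> R} :=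
  [set x | exists w : 'I_n -> R,
     [/\ forall k, 0 <= w k, \sum_k w k = 1 & x = \sum_k w k *: p k]]%classic.

Lemma continuous_sum (R : realType) (T : topologicalType) (I : finType)
    (F : I -> T -> R) :
  (forall i, continuous (F i)) -> continuous (fun w => \sum_i F i w).
Proof.
by move=> cF; apply: continuous_big => //; move=> x; apply: (@cvgD _ R^o); [exact: cvg_fst|exact: cvg_snd].
Qed.

(** The image of [W] is compact, hence closed, and 0 is adherent to it. *)
Lemma compact_zero (R : realType) (T : topologicalType) (W : set T)
    (G : T -> R) :
  compact W -> continuous G ->
  (forall e, 0 < e -> exists2 w, W w & `|G w| < e) ->
  exists2 w, W w & G w = 0.
Proof.
move=> cW cG small.
have cGW : closed (G @` W)%classic.
  apply: compact_closed; first exact: Rhausdorff.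
  by apply: continuous_compact => //; apply: continuous_subspaceT.
have [w Ww Gw0] : (G @` W)%classic 0.
  apply: cGW => U /nbhs_ballP [e /= e0 eU].
  have [w Ww Gw] := small _ e0.
  exists (G w); split; first by exists w.
  by apply: eU; rewrite /ball /= sub0r normrN.
by exists w.
Qed.

(** The weights range over a compact simplex [W], and the l1 distance [G] from a combination to [x]
    takes arbitrarily small values there, hence the value 0. *)
Lemma conv_pts_closed (R : realType) (V : finType) (n : nat)
    (p : 'I_n -> {ffun V -> R}) (x y : {ffun V -> R}) :
  (forall e, 0 < e ->
     exists2 t, 0 < t < e & conv_pts p ((1 - t) *: x + t *: y)) ->
  conv_pts p x.
Proof.
move=> near_x.
pose W : set 'rV[R]_n :=
  ([set w | forall k, `[0, 1]%classic (w ord0 k)] `&` [set w | \sum_k w ord0 k = 1])%classic.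
pose G (w : 'rV[R]_n) : R := \sum_v `| \sum_k w ord0 k * p k v - x v |.
have coordc (k : 'I_n) : continuous (fun w : 'rV[R]_n => w ord0 k).
  by move=> w; exact: coord_continuous.
have cW : compact W.
  apply: (@subclosed_compact _ _ [set w : 'rV[R]_n | forall k, `[0, 1]%classic (w ord0 k)]).
  - apply: closedI.
      rewrite [X in closed X](_ : _ = \bigcap_(k in [set: 'I_n])
        ((fun w : 'rV[R]_n => w ord0 k) @^-1` `[0, 1]%classic))%classic; last first.
        by apply/seteqP; split=> w /= H k; [move=> _; exact: (H k)|exact: (H k I)].
      apply: closed_bigI => k _; apply: preimage_closed => //.
      exact: interval_closed.
    rewrite [X in closed X](_ : _ = (fun w : 'rV[R]_n => \sum_k w ord0 k) @^-1` [set 1])%classic //.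
    apply: preimage_closed; last exact: closed_eq.
    by move=> w _; exact: continuous_sum.
  - by apply: (@rV_compact R^o n (fun=> `[0, 1]%classic)) => k; apply: segment_compact.
  - by move=> w [].
have cG : continuous G.
  apply: continuous_sum => v w.
  have cF : continuous (fun w : 'rV[R]_n => \sum_k w ord0 k * p k v).
    apply: continuous_sum => k {}w.
    exact: (cvgM (coordc k w) (cvg_cst (p k v))).
  exact: (@cvg_norm _ R^o _ _ _ _ _ (cvgB (cF w) (cvg_cst (x v : R^o)))).
have [e e0|w [w01 w1] Gw] := compact_zero cW cG.
  (* Moving from [x] towards [y] by [t] costs [t] times their l1 distance; [N] bounds that distance,
     and the added 1 keeps it positive. *)
  pose N := 1 + \sum_v `|y v - x v|.
  have N0 : 0 < N by rewrite ltr_wpDr // sumr_ge0.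
  have [t /andP[t0 te] [w [w0 w1 Ew]]] := near_x (e / N) (divr_gt0 e0 N0).
  exists (\row_k w k).
    split=> [k|/=].
      rewrite /= mxE in_itv /= w0 -w1 (bigD1 k) //= lerDl.
      by apply: sumr_ge0.
    by under eq_bigr do rewrite mxE.
  have -> : G (\row_k w k) = \sum_v t * `|y v - x v|.
    apply: eq_bigr => v _; rewrite -[t in RHS]ger0_norm ?(ltW t0) // -normrM.
    congr `|_|; have := congr1 (fun h : {ffun V -> R} => h v) Ew.
    rewrite sum_ffunE !ffunE => Ev.
    under eq_bigr do rewrite mxE.
    transitivity ((1 - t) * x v + t * y v - x v); last by ring.
    congr (_ - _); rewrite Ev; apply: eq_bigr => k _; by rewrite !ffunE.
  rewrite -mulr_sumr ger0_norm ?mulr_ge0 ?(ltW t0) ?sumr_ge0 //.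
  apply: le_lt_trans (_ : t * N < e); last by rewrite -ltr_pdivlMr.
  by rewrite ler_pM2l // /N lerDr.
exists (w ord0); split=> [k|//|].
  by have := w01 k; rewrite /= in_itv => /andP[].
apply/ffunP=> v; rewrite sum_ffunE.
have /eqP : `| \sum_k w ord0 k * p k v - x v | = 0.
  by apply/(psumr_eq0P (fun v _ => normr_ge0 _) Gw).
rewrite normr_eq0 subr_eq0 => /eqP <-.
by apply: eq_bigr => k _; rewrite !ffunE.
Qed.

Lemma infinite_pigeonhole (T : eqType) (l : seq T) (Q : T -> nat -> Prop) :
  (forall n, exists2 s, s \in l & Q s n) ->
  exists2 s, s \in l & forall N, exists2 n, (N <= n)%N & Q s n.
Proof.
(* The induction on [l] needs the hypothesis for large [n] only: discarding an element that occurs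
   finitely often costs an initial range. *)
move=> H; have {H} : exists N0, forall n, (N0 <= n)%N -> exists2 s, s \in l & Q s n.
  by exists 0%N => n _; apply: H.
elim: l => [|a l IHl] [N0 H].
  by have [] := H N0 (leqnn _).
have [Ha|/existsNP[N1 Ha]] := pselect (forall N, exists2 n, (N <= n)%N & Q a n).
  by exists a => //; rewrite mem_head.
have [|s sl Hs] := IHl; last by exists s => //; rewrite in_cons sl orbT.
exists (maxn N0 N1) => n; rewrite geq_max => /andP[n0 n1].
have [s] := H n n0; rewrite in_cons => /predU1P[-> Qan|sl Qs]; last by exists s.
by case: Ha; exists n.
Qed.

Lemma conv_pts_convex (R : realType) (V : finType) (n : nat)
    (p : 'I_n -> {ffun V -> R}) (x y : {ffun V -> R}) (t : R) :
  conv_pts p x -> conv_pts p y -> 0 <= t <= 1 ->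
  conv_pts p (t *: x + (1 - t) *: y).
Proof.
move=> [w [w0 w1 ->]] [w' [w0' w1' ->]] /andP[t0 t1].
exists (fun k => t * w k + (1 - t) * w' k); split=> [k||].
- by rewrite addr_ge0 // mulr_ge0 // subr_ge0.
- by rewrite big_split /= -!mulr_sumr w1 w1' !mulr1 addrC subrK.
- rewrite !scaler_sumr -big_split /=.
  by apply: eq_bigr => k _; rewrite !scalerA scalerDl.
Qed.

(** The first point is split off and the other weights are renormalized to sum 1; the case where
    their sum [W] is 0 is treated apart. *)
Lemma affine_on_sum (R : realType) (V U : finType) (P : set {ffun V -> R})
    (h : {ffun V -> R} -> {ffun U -> R}) (n : nat)
    (w : 'I_n -> R) (p : 'I_n -> {ffun V -> R}) :
  (forall x y (t : R), P x -> P y -> 0 <= t <= 1 -> P (t *: x + (1 - t) *: y)) ->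
  affine_on P h -> (forall k, P (p k)) ->
  (forall k, 0 <= w k) -> \sum_k w k = 1 ->
  P (\sum_k w k *: p k) /\ h (\sum_k w k *: p k) = \sum_k w k *: h (p k).
Proof.
move=> cP aff; elim: n w p => [|n IHn] w p Pp w0 w1.
  by move: w1; rewrite big_ord0 => /eqP; rewrite eq_sym oner_eq0.
rewrite !big_ord_recl /=; rewrite big_ord_recl in w1.
set W := \sum_(i < n) w (lift ord0 i) in w1.
have W0 : 0 <= W by apply: sumr_ge0.
have [Wz|Wn] := eqVneq W 0.
  have wz (k : 'I_n) : w (lift ord0 k) = 0.
    exact: (psumr_eq0P (fun i _ => w0 (lift ord0 i)) Wz).
  have z0 (A : finType) (q : 'I_n -> {ffun A -> R}) :
      \sum_(i < n) w (lift ord0 i) *: q i = 0.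
    by apply: big1 => k _; rewrite wz scale0r.
  by move: w1; rewrite !z0 Wz !addr0 => ->; rewrite !scale1r.
have Wp : 0 < W by rewrite lt_neqAle eq_sym Wn.
have [||Ps hs] := IHn (fun k => w (lift ord0 k) / W) (fun k => p (lift ord0 k)) (fun k => Pp _).
- by move=> k; rewrite divr_ge0.
- by rewrite -mulr_suml divff.
have EW (A : finType) (q : 'I_n -> {ffun A -> R}) :
   \sum_(i < n) w (lift ord0 i) *: q i = (1 - w ord0) *: \sum_(i < n) (w (lift ord0 i) / W) *: q i.
  rewrite -w1 addrC addKr scaler_sumr; apply: eq_bigr => i _.
  by rewrite scalerA mulrCA divff // mulr1.
have w01 : 0 <= w ord0 <= 1 by rewrite w0 -w1 lerDl.
by rewrite !EW; split; [apply: cP | rewrite aff // hs].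
Qed.

(** One of the finitely many hulls contains the points of parameter [1 / (n + 1)] for infinitely
    many [n]; being closed, it also contains the endpoint [x]. *)
Lemma segment_in_piece (R : realType) (V : finType) (T : eqType) (l : seq T)
    (m : T -> nat) (p : forall s, 'I_(m s) -> {ffun V -> R})
    (x y : {ffun V -> R}) :
  (forall t, 0 < t <= 1 ->
     exists2 s, s \in l & conv_pts (@p s) ((1 - t) *: x + t *: y)) ->
  exists2 s, s \in l & conv_pts (@p s) x /\
    exists2 t, 0 < t <= 1 & conv_pts (@p s) ((1 - t) *: x + t *: y).
Proof.
move=> H; pose t n : R := n.+1%:R^-1.
have t01 n : 0 < t n <= 1 by rewrite invr_gt0 ltr0n /= invf_le1 ?ltr0n ?ler1n.
have [s sl Hs] := infinite_pigeonhole (fun n => H _ (t01 n)).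
exists s => //; split; last by have [n _ Hn] := Hs 0%N; exists (t n).
apply: (@conv_pts_closed _ _ _ _ _ y) => e e0.
have [n nN Hn] := Hs (Num.bound e^-1).
exists (t n) => //; have /andP[-> _] /= := t01 n.
rewrite invf_plt ?posrE ?ltr0n //; apply: lt_le_trans (archi_boundP _) _.
  by rewrite invr_ge0 ltW.
by rewrite ler_nat; apply: leqW.
Qed.

(** The segment leaves [h x] inside the image of a single piece, and injectivity puts [x] in that
    piece. As [h] is affine there, an initial part of the segment is the image of a segment from [x]
    to [y]. The midpoint is recorded because its support is the union of those of [x] and [y], which
    places both in one simplex. *)
Lemma pullback_segment (R : realType) (V U : finType)
    (K : {set {set V}}) (L : {set {set U}})
    (h : {ffun V -> R} -> {ffun U -> R}) (cover : seq (seq {ffun V -> R}))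
    (x : {ffun V -> R}) (z : {ffun U -> R}) :
  set_bij (realization K) (realization L) h ->
  (forall s, s \in cover -> (conv_hull s `<=` realization K)%classic) ->
  (forall y, realization K y -> exists2 s, s \in cover & conv_hull s y) ->
  (forall s, s \in cover -> affine_on (conv_hull s) h) ->
  realization K x ->
  (forall t, 0 < t <= 1 -> realization L ((1 - t) *: h x + t *: z)) ->
  exists y, [/\ realization K y, realization K (2^-1 *: x + (1 - 2^-1) *: y) & forall e, 0 < e <= 1 ->
    exists2 t, 0 < t <= 1 & h (e *: y + (1 - e) *: x) = (1 - t) *: h x + t *: z].
Proof.
move=> [hfun hinj hsurj] sub cov aff Kx seg.
have hull s (w : 'I_(size s) -> R) : s \in cover -> (forall k, 0 <= w k) -> \sum_k w k = 1 ->
    h (\sum_k w k *: s`_k) = \sum_k w k *: h s`_k.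
  move=> sc w0 w1.
  apply: (proj2 (affine_on_sum _ (aff s sc) _ w0 w1)) => [a b t|k].
    exact: conv_pts_convex.
  exists (fun j => (j == k)%:R); split=> [//||].
    by rewrite (bigD1 k) //= eqxx big1 ?addr0 // => j /negPf ->.
  by rewrite (bigD1 k) //= eqxx scale1r big1 ?addr0 // => j /negPf ->; rewrite scale0r.
have [|s sc [[w [w0 w1 Ew]] [t t01 [v [v0 v1 Ev]]]]] :=
  @segment_in_piece R U _ cover (fun s => size s) (fun s k => h s`_k) (h x) z.
  move=> t t01; have [y Ky hy] := hsurj _ (seg t t01).
  have [s sc [w [w0 w1 Ew]]] := cov y Ky.
  by exists s => //; exists w; split=> //; rewrite -hy Ew hull.
have sx : conv_hull s x.
  exists w; split=> //; apply: hinj; [exact: mem_set| |by rewrite hull].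
  by apply/mem_set/(sub s sc); exists w.
set y := \sum_k v k *: s`_k.
have sy : conv_hull s y by exists v.
have hy : h y = (1 - t) *: h x + t *: z by rewrite Ev hull.
exists y; split; first exact: (sub s sc).
  by apply: (sub s sc); apply: conv_pts_convex => //; lra.
move=> e e01; exists (e * t); first by nra.
rewrite (aff s sc) //; last by lra.
rewrite hy; apply/ffunP=> u; rewrite !ffunE /GRing.scale /=; ring.
Qed.

Lemma realization_sub (R : realType) (V : finType) (K : {set {set V}})
    (x : {ffun V -> R}) (s : {set V}) :
  is_complex K -> s \in K -> (forall v, 0 <= x v) -> \sum_v x v = 1 ->
  (forall v, v \notin s -> x v = 0) -> realization K x.
Proof.
move=> [K0 Kd] sK x0 x1 xs; split=> //; apply: (Kd s) => //.
  apply/fintype.subsetP=> v; rewrite inE; apply: contraR => /xs ->; exact: eqxx.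
apply/eqP=> E; move: x1; rewrite big1 => [/eqP|v _].
  by rewrite eq_sym oner_eq0.
apply/eqP; have := finset.in_set0 v; rewrite -E inE.
by move/negbT; rewrite negbK.
Qed.

Lemma complex_simplex4_boundary : is_complex simplex4_boundary.
Proof.
split=> [|s t]; first by rewrite inE eqxx.
rewrite !inE => /andP[_ sT] ts t0; rewrite t0 /=.
apply: contra sT => /eqP tT; rewrite eqEsubset subsetT /=.
by rewrite -tT.
Qed.

Lemma realization_boundaryP (R : realType) (z : {ffun 'I_5 -> R}) (j : 'I_5) :
  (forall i, 0 <= z i) -> \sum_i z i = 1 -> z j = 0 ->
  realization simplex4_boundary z.
Proof.
move=> z0 z1 zj.
apply: (@realization_sub _ _ _ _ [set~ j]%SET complex_simplex4_boundary) => //.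
  rewrite inE -card_gt0 cardsC1 card_ord /=.
  apply/eqP=> E; have := in_setT j; rewrite -E !inE eqxx //.
by move=> i; rewrite !inE negbK => /eqP ->.
Qed.

(** Lagrange interpolation: the inverse of a Vandermonde matrix, written out. *)
Lemma moment_curve_basis (R : realFieldType) (s1 s2 s3 r0 r1 r2 : R) :
  s1 != s2 -> s1 != s3 -> s2 != s3 ->
  exists x1 x2 x3, [/\ r0 = x1 + x2 + x3, r1 = x1 * s1 + x2 * s2 + x3 * s3
    & r2 = x1 * s1 ^+ 2 + x2 * s2 ^+ 2 + x3 * s3 ^+ 2].
Proof.
rewrite -subr_eq0 -(subr_eq0 s1 s3) -(subr_eq0 s2) => h12 h13 h23.
exists ((r2 - (s2 + s3) * r1 + s2 * s3 * r0) / ((s1 - s2) * (s1 - s3))).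
exists (- (r2 - (s1 + s3) * r1 + s1 * s3 * r0) / ((s1 - s2) * (s2 - s3))).
exists ((r2 - (s1 + s2) * r1 + s1 * s2 * r0) / ((s1 - s3) * (s2 - s3))).
by split; field; rewrite h12 h13 h23.
Qed.

Definition tetra_point (R : realType) (V : finType) (x0 x1 x2 x3 : {ffun V -> R})
    (w0 w1 w2 w3 : R) : {ffun V -> R} :=
  w0 *: x0 + w1 *: x1 + w2 *: x2 + w3 *: x3.

Lemma affine_on_tetra (R : realType) (V U : finType) (s : seq {ffun V -> R})
    (h : {ffun V -> R} -> {ffun U -> R}) (x0 x1 x2 x3 : {ffun V -> R})
    (w0 w1 w2 w3 : R) :
  affine_on (conv_hull s) h ->
  conv_hull s x0 -> conv_hull s x1 -> conv_hull s x2 -> conv_hull s x3 ->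
  0 <= w0 -> 0 <= w1 -> 0 <= w2 -> 0 <= w3 -> w0 + w1 + w2 + w3 = 1 ->
  conv_hull s (tetra_point x0 x1 x2 x3 w0 w1 w2 w3) /\
  h (tetra_point x0 x1 x2 x3 w0 w1 w2 w3) =
    tetra_point (h x0) (h x1) (h x2) (h x3) w0 w1 w2 w3.
Proof.
move=> aff c0 c1 c2 c3 p0 p1 p2 p3 p.
pose w (k : 'I_4) := tnth [tuple w0; w1; w2; w3] k.
pose q (k : 'I_4) := tnth [tuple x0; x1; x2; x3] k.
have [|k|k||] := @affine_on_sum _ _ _ (conv_hull s) h _ w q _ aff.
- by move=> x y t; apply: conv_pts_convex.
- by rewrite /q; case: k => -[|[|[|[|//]]]] lt; rewrite (tnth_nth 0).
- by rewrite /w; case: k => -[|[|[|[|//]]]] lt; rewrite (tnth_nth 0).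
- by rewrite !big_ord_recl big_ord0 /w !(tnth_nth 0) /= addr0 !addrA.
by rewrite !big_ord_recl !big_ord0 /w /q !(tnth_nth 0) /= !addr0 !addrA.
Qed.

Lemma convex_half (R : realFieldType) (a b : R) : 0 <= a -> 0 <= b ->
  0 <= 2^-1 * a + (1 - 2^-1) * b ?= iff ((a == 0) && (b == 0)).
Proof.
move=> a0 b0; have h : (1 - 2^-1 : R) = 2^-1 by lra.
have h0 : (2^-1 : R) != 0 by lra.
split; first by lra.
by rewrite h eq_sym paddr_eq0 ?mulr_ge0 ?invr_ge0 // !mulf_eq0 (negPf h0).
Qed.

Lemma sum4_eq0 (R : realFieldType) (k a b c d : R) : 0 < k ->
  0 <= a -> 0 <= b -> 0 <= c -> 0 <= d ->
  k * a + k * b + k * c + k * d = 0 -> [/\ a = 0, b = 0, c = 0 & d = 0].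
Proof.
move=> k0 a0 b0 c0 d0; rewrite -!mulrDr => /eqP.
by rewrite mulf_eq0 gt_eqF //= => /eqP H; split; lra.
Qed.

(** The choice of [e] makes [(1 - e) / 3] equal to [e * S], which compensates any coefficient [l]
    bounded by [S]. *)
Lemma third_weight (R : realFieldType) (e S l : R) :
  0 < e -> e * (1 + 3 * S) = 1 -> `|l| <= S -> 0 <= e * l + (1 - e) / 3.
Proof.
move=> e0 eS; rewrite ler_norml => /andP[lS _].
have -> : e * l + (1 - e) / 3 = e * (l + S) by rewrite -{1}eS; field.
by apply: mulr_ge0; [exact: ltW|lra].
Qed.

Lemma weights (R : realFieldType) : [/\ 0 < 4^-1 :> R,
  4^-1 + 4^-1 + 4^-1 + 4^-1 = 1 :> R, 0 < 3^-1 :> R & 3^-1 + 3^-1 + 3^-1 + 0 = 1 :> R].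
Proof. by split; lra. Qed.

(** Otherwise the polyhedron near an interior point [x0] of the triangle lies on one side of it,
    inside the tetrahedron. A smaller tetrahedron on which [h] is affine, with three corners in the
    triangle, is mapped into one facet of the boundary of the 4-simplex, and every segment issued
    from [h x0] begins in its image. Hence [h x0] is interior to that facet, and the direction
    opposite to the image of an inward one lifts to a direction leaving the polyhedron. *)
Lemma no_free_triangle (R : realType) (V : finType) (K : {set {set V}})
    (b0 b1 b2 p : V) :
  is_complex K -> PL_homeomorphic R K simplex4_boundary ->
  uniq [:: b0; b1; b2; p] -> [set b0; b1; b2; p] \in K ->
  exists q, [/\ q != p, q \notin [set b0; b1; b2] & q |: [set b0; b1; b2] \in K].
Proof.
move=> cK [h [hbij [cover [sub cov aff]]]] Hu TK.
have [hfun hinj hsurj] := hbij.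
have [q0 q1 th0 _] := weights R.
apply: contrapT => none.
have T_max s : s \in K -> [set b0; b1; b2] \subset s -> s \subset [set b0; b1; b2; p].
  move=> sK bs; apply/subsetP=> q qs; apply/negPn/negP=> qT; apply: none.
  exists q; move: qT; rewrite inE negb_or => /andP[qb qp]; split=> //.
    by move: qp; rewrite inE.
  have [_ Kd] := cK; apply: (Kd s) => //.
    by rewrite subUset sub1set qs.
  by apply/set0Pn; exists q; rewrite !inE eqxx.
have notT v : v \notin [set b0; b1; b2; p] -> v \notin [set b0; b1; b2] /\ v != p.
  by rewrite !inE negb_or => /andP[].
have sum_supp (x : {ffun V -> R}) :
    (forall v, v \notin [set b0; b1; b2; p] -> x v = 0) ->
    \sum_v x v = x b0 + x b1 + x b2 + x p.
  move=> sx; rewrite (bigID (fun v => v \in [set b0; b1; b2; p])) /= [X in _ + X]big1 // addr0.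
  rewrite (eq_bigl (mem [:: b0; b1; b2; p])) => [|v]; last by rewrite !inE !orbA.
  by rewrite -big_uniq // !big_cons big_nil /= addr0 !addrA.
have lcE (a b : R) (x z : {ffun V -> R}) v : (a *: x + b *: z) v = a * x v + b * z v.
  by rewrite !ffunE.
have lcE5 (a b : R) (x z : {ffun 'I_5 -> R}) v : (a *: x + b *: z) v = a * x v + b * z v.
  by rewrite !ffunE.
have ext (x z : {ffun V -> R}) :
    (forall v, v \notin [set b0; b1; b2; p] -> x v = 0) ->
    (forall v, v \notin [set b0; b1; b2; p] -> z v = 0) ->
    x b0 = z b0 -> x b1 = z b1 -> x b2 = z b2 -> x p = z p -> x = z.
  move=> sx sz e0 e1 e2 ep; apply/ffunP=> v.
  have [|vT] := boolP (v \in [set b0; b1; b2; p]); last by rewrite sx ?sz.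
  by rewrite !inE => /orP[/orP[/orP[]|]|] /eqP ->.
(* The points [y n] have barycentric coordinates proportional to [1, s, s ^+ 2] with [s = n + 1].
   Any three of them are independent, so whichever three the pigeonhole returns will do. *)
pose N (n : nat) : R := 1 + n.+1%:R + n.+1%:R ^+ 2.
have N0 n : 0 < N n by rewrite /N -addrA ltr_wpDr // addr_ge0 // ?exprn_ge0.
have [y [yb0 yb1 yb2 yp ysupp]] : exists y : nat -> {ffun V -> R},
   [/\ forall n, y n b0 = (N n)^-1, forall n, y n b1 = n.+1%:R / N n,
     forall n, y n b2 = n.+1%:R ^+ 2 / N n, forall n, y n p = 0
   & forall n v, v \notin [set b0; b1; b2] -> y n v = 0].
  move: Hu; rewrite /= !inE !negb_or => /andP[/and3P[n01 n02 n0p] /andP[/andP[n12 n1p] /andP[n2p _]]].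
  exists (fun n => [ffun v =>
    if v == b0 then (N n)^-1 else if v == b1 then n.+1%:R / N n else
    if v == b2 then n.+1%:R ^+ 2 / N n else 0]).
  split=> n; rewrite ?ffunE ?eqxx ?(eq_sym b1) ?(eq_sym b2) ?(eq_sym p)
    ?(negPf n01) ?(negPf n02) ?(negPf n12) ?(negPf n0p) ?(negPf n1p) ?(negPf n2p) //.
  by move=> v; rewrite !inE !negb_or ffunE => /andP[/andP[/negPf-> /negPf->] /negPf->].
have [ep epE] : exists ep : {ffun V -> R}, forall v, ep v = (v == p)%:R.
  by exists [ffun v => (v == p)%:R] => v; rewrite ffunE.
have [epb0 epb1 epb2 epp] : [/\ ep b0 = 0, ep b1 = 0, ep b2 = 0 & ep p = 1].
  move: Hu; rewrite /= !inE !negb_or => /andP[/and3P[_ _ n0p] /andP[/andP[_ n1p] /andP[n2p _]]].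
  by rewrite !epE eqxx (negPf n0p) (negPf n1p) (negPf n2p).
have ep_supp v : v \notin [set b0; b1; b2; p] -> ep v = 0.
  by move=> /notT[_ /negPf vp]; rewrite epE vp.
have y_supp n v : v \notin [set b0; b1; b2; p] -> y n v = 0.
  by move=> /notT[vb _]; rewrite ysupp.
have y_ge0 n v : 0 <= y n v.
  have [|vT] := boolP (v \in [set b0; b1; b2; p]); last by rewrite y_supp.
  rewrite !inE => /orP[/orP[/orP[]|]|] /eqP ->; rewrite ?yb0 ?yb1 ?yb2 ?yp //.
  - by rewrite invr_ge0 ltW.
  - by rewrite divr_ge0 // ltW.
  - by rewrite divr_ge0 ?exprn_ge0 // ltW.
have y_sum n : y n b0 + y n b1 + y n b2 = 1.
  by rewrite yb0 yb1 yb2 -[X in X + _ + _]mul1r -!mulrDl divff // lt0r_neq0.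
have Ky n : realization K (y n).
  apply: (realization_sub cK TK); [exact: y_ge0| |exact: y_supp].
  by rewrite (sum_supp _ (@y_supp n)) yp addr0 y_sum.
have Kep : realization K ep.
  apply: (realization_sub cK TK); [by move=> v; rewrite epE ler0n| |exact: ep_supp].
  by rewrite (sum_supp _ ep_supp) epb0 epb1 epb2 epp; ring.
have Kseg n t : 0 < t <= 1 -> realization K ((1 - t) *: y n + t *: ep).
  move=> /andP[t0 t1]; apply: (realization_sub cK TK) => [v||v vT].
  - by rewrite lcE epE addr_ge0 // mulr_ge0 ?ler0n // ?subr_ge0 // ltW.
  - rewrite sum_supp => [|v vT]; last by rewrite lcE y_supp // ep_supp // !mulr0 addr0.
    rewrite !lcE epb0 epb1 epb2 epp yp.
    by transitivity ((1 - t) * (y n b0 + y n b1 + y n b2) + t); [ring|rewrite y_sum; ring].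
  - by rewrite lcE y_supp // ep_supp // !mulr0 addr0.
(* Each segment from [y n] to the vertex [p] begins in some piece, and one piece serves infinitely
   many [n]. It contains three corners [y n1], [y n2], [y n3] in the triangle, and the point [c]
   further along the first segment is a corner off the triangle. *)
have pieces n : exists2 s, s \in cover &
    conv_hull s (y n) /\ exists2 t, 0 < t <= 1 & conv_hull s ((1 - t) *: y n + t *: ep).
  apply: (@segment_in_piece R V _ cover (fun s => size s) (fun s k => s`_k)).
  by move=> t t01; apply: cov; apply: Kseg.
have [s sc Hs] := infinite_pigeonhole pieces.
have [n1 _ [sy1 [t t01 sc1]]] := Hs 0%N.
have [n2 n12 [sy2 _]] := Hs n1.+1.
have [n3 n23 [sy3 _]] := Hs n2.+1.
move: sc1; set c := (X in conv_hull s X) => sc1.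
have c_supp v : v \notin [set b0; b1; b2; p] -> c v = 0.
  by move=> vT; rewrite /c lcE y_supp // ep_supp // !mulr0 addr0.
have cp : c p = t by rewrite /c lcE yp epp mulr0 add0r mulr1.
have Kc : realization K c by apply: sub sc1.
have [c0 c1 _] := Kc; rewrite (sum_supp _ c_supp) cp in c1.
have aff4 := affine_on_tetra (aff s sc) sy1 sy2 sy3 sc1.
have tpE (x0 x1 x2 x3 : {ffun V -> R}) (w0 w1 w2 w3 : R) v :
    tetra_point x0 x1 x2 x3 w0 w1 w2 w3 v = w0 * x0 v + w1 * x1 v + w2 * x2 v + w3 * x3 v.
  by rewrite !ffunE.
have tpE' (x0 x1 x2 x3 : {ffun 'I_5 -> R}) (w0 w1 w2 w3 : R) v :
    tetra_point x0 x1 x2 x3 w0 w1 w2 w3 v = w0 * x0 v + w1 * x1 v + w2 * x2 v + w3 * x3 v.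
  by rewrite !ffunE.
have Kh x : realization K x -> realization simplex4_boundary (h x) by move=> Kx; apply: hfun.
have hge0 x i : realization K x -> 0 <= h x i by move=> /Kh[].
(* The image of a nondegenerate tetrahedron is convex, hence in one facet. *)
have [j [hy1 hy2 hy3 hc]] : exists j, [/\ h (y n1) j = 0, h (y n2) j = 0, h (y n3) j = 0 & h c j = 0].
  have [|||||sm hm] := aff4 (4^-1) (4^-1) (4^-1) (4^-1); rewrite ?(ltW q0) //.
  have Km := sub s sc _ sm; have [_ _] := Kh _ Km.
  rewrite inE => /andP[_ /eqP HT].
  have [j hj] : exists j, h (tetra_point (y n1) (y n2) (y n3) c 4^-1 4^-1 4^-1 4^-1) j = 0.
    apply: contrapT => /forallNP Hj; apply: HT; apply/setP=> j.
    by rewrite !inE; apply/eqP/Hj.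
  exists j; move: hj; rewrite hm tpE'.
  by apply: sum4_eq0 => //; apply: hge0.
(* The centroid of the three corners in the triangle: the weight of [c] is 0. *)
pose x0 := tetra_point (y n1) (y n2) (y n3) c (3^-1) (3^-1) (3^-1) 0.
have [|||||sx0 hx0] := aff4 (3^-1) (3^-1) (3^-1) 0; rewrite ?(ltW th0) //; try by case: (weights R).
rewrite -/x0 in sx0 hx0.
have Kx0 := sub s sc _ sx0.
have hx0j : h x0 j = 0 by rewrite hx0 tpE' hy1 hy2 hy3 hc; ring.
have x0p : x0 p = 0 by rewrite tpE !yp; ring.
have x0pos v : v \in [set b0; b1; b2] -> 0 < x0 v.
  move=> vb; rewrite tpE mul0r addr0 -!mulrDr mulr_gt0 //.
  have yv n : 0 < y n v.
    move: vb; rewrite !inE => /orP[/orP[]|] /eqP ->.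
    - by rewrite yb0 invr_gt0.
    - by rewrite yb1 divr_gt0.
    - by rewrite yb2 divr_gt0 // exprn_gt0.
  by rewrite !addr_gt0.
(* A segment of the boundary starting at [h x0] has an initial part in the
   image of the tetrahedron. *)
have pull z : (forall t, 0 < t <= 1 -> realization simplex4_boundary ((1 - t) *: h x0 + t *: z)) ->
    exists u e, [/\ 0 < e <= 1, conv_hull s u, h u j = 0 & h u = (1 - e) *: h x0 + e *: z].
  move=> /(pullback_segment hbij sub cov aff Kx0)[x [Kx Kmid Hx]].
  have [xge0 xsum _] := Kx; have [_ _ midK] := Kmid.
  (* The midpoint of [x0] and [x] has all of [b0], [b1], [b2] in its support, so by [T_max] this
     support, and with it that of [x], stays in the tetrahedron. *)
  have x_supp v : v \notin [set b0; b1; b2; p] -> x v = 0.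
    move=> vT; set m := (X in realization K X) in Kmid midK.
    have mE v' : m v' = 2^-1 * x0 v' + (1 - 2^-1) * x v' by exact: lcE.
    have /subsetP/(_ v) : [set v | m v != 0] \subset [set b0; b1; b2; p].
      apply: T_max => //; apply/subsetP=> v' /x0pos x0v'.
      by rewrite inE mE eq_sym (convex_half (ltW x0v') (xge0 v')).2 gt_eqF.
    have [x0ge0 _ _] := Kx0.
    rewrite (negPf vT) inE mE eq_sym (convex_half (x0ge0 v) (xge0 v)).2.
    by have [->//|_] := eqVneq (x v) 0; rewrite andbF => /(_ isT).
  have sN n m : (n < m)%N -> n.+1%:R != m.+1%:R :> R.
    by move=> nm; rewrite eqr_nat eqSS neq_ltn nm.
  (* Coordinates of [x] on the four corners: the one at [c] is forced by the coordinate at [p], the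
     other three by interpolation. The one at [c] is nonnegative because [x] is on the same side of
     the triangle as [c]; the others may be negative, and a short step from the centroid repairs
     this. *)
  have [|k1 [k2 [k3 [E0 E1 E2]]]] := moment_curve_basis (x b0 - x p / t * c b0)
    (x b1 - x p / t * c b1) (x b2 - x p / t * c b2) (sN _ _ n12) _ (sN _ _ n23).
    by apply: sN; apply: ltn_trans n12 n23.
  have t0 : 0 < t by case/andP: t01.
  have Nn n : N n != 0 by rewrite lt0r_neq0.
  pose l1 := k1 * N n1; pose l2 := k2 * N n2; pose l3 := k3 * N n3.
  pose l4 := x p / t.
  have Ex : x = tetra_point (y n1) (y n2) (y n3) c l1 l2 l3 l4.
    apply: ext => // [v vT||||]; rewrite tpE.
    - by rewrite !y_supp // c_supp // !mulr0 !addr0.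
    - by rewrite !yb0 -(subrK (l4 * c b0) (x b0)) E0 /l1 /l2 /l3; field; rewrite !Nn.
    - by rewrite !yb1 -(subrK (l4 * c b1) (x b1)) E1 /l1 /l2 /l3; field; rewrite !Nn.
    - by rewrite !yb2 -(subrK (l4 * c b2) (x b2)) E2 /l1 /l2 /l3; field; rewrite !Nn.
    - by rewrite !yp cp /l4; field; exact: lt0r_neq0.
  have l40 : 0 <= l4 by rewrite divr_ge0 // ltW.
  have lsum : l1 + l2 + l3 + l4 = 1.
    have Ev v : x v = l1 * y n1 v + l2 * y n2 v + l3 * y n3 v + l4 * c v.
      by rewrite {1}Ex tpE.
    transitivity (l1 * (y n1 b0 + y n1 b1 + y n1 b2) + l2 * (y n2 b0 + y n2 b1 + y n2 b2) +
      l3 * (y n3 b0 + y n3 b1 + y n3 b2) + l4 * (c b0 + c b1 + c b2 + c p)).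
      by rewrite !y_sum cp c1 !mulr1.
    by rewrite -xsum (sum_supp _ x_supp) (Ev b0) (Ev b1) (Ev b2) (Ev p) !yp; ring.
  pose M := 1 + 3 * (`|l1| + `|l2| + `|l3|).
  have M1 : 1 <= M by rewrite lerDl mulr_ge0 // !addr_ge0.
  have M0 : 0 < M by apply: lt_le_trans M1.
  pose e := M^-1.
  have eM : e * M = 1 by rewrite mulVf // lt0r_neq0.
  have e0 : 0 < e by rewrite invr_gt0.
  have e1 : e <= 1 by rewrite invf_le1.
  have [||||| su hu] := aff4 (e * l1 + (1 - e) / 3) (e * l2 + (1 - e) / 3)
    (e * l3 + (1 - e) / 3) (e * l4).
  - by apply: (third_weight e0 eM); rewrite -addrA lerDl addr_ge0.
  - by apply: (third_weight e0 eM); rewrite addrAC lerDr addr_ge0.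
  - by apply: (third_weight e0 eM); rewrite lerDr addr_ge0.
  - by rewrite mulr_ge0 // ltW.
  - transitivity (e * (l1 + l2 + l3 + l4) + (1 - e)); last by rewrite lsum; ring.
    by field.
  have [|t' t'01 ht'] := Hx e; first by rewrite e0.
  move: su hu; have -> : tetra_point (y n1) (y n2) (y n3) c (e * l1 + (1 - e) / 3)
      (e * l2 + (1 - e) / 3) (e * l3 + (1 - e) / 3) (e * l4) = e *: x + (1 - e) *: x0.
    by apply/ffunP=> v; rewrite lcE Ex !tpE; field.
  move=> su hu; exists (e *: x + (1 - e) *: x0), t'; split=> //.
  by rewrite hu tpE' hy1 hy2 hy3 hc !mulr0 !addr0.
(* If another coordinate [i] vanished at [h x0], the segment towards the vertex [j] would stay in
   the facet opposite to [i] and could be pulled back; but the image of the tetrahedron has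
   coordinate [j] equal to 0. *)
have hx0i i : i != j -> 0 < h x0 i.
  move=> ij; rewrite lt_neqAle hge0 // andbT eq_sym; apply/eqP=> hi.
  have [ej ejE] : exists ej : {ffun 'I_5 -> R}, forall k, ej k = (k == j)%:R.
    by exists [ffun k => (k == j)%:R] => k; rewrite ffunE.
  have [|u [e [/andP[e0 e1] _ hu Eu]]] := pull ej.
    move=> r /andP[r0 r1]; apply: (@realization_boundaryP _ _ i).
    - by move=> k; rewrite lcE5 ejE addr_ge0 // mulr_ge0 ?hge0 ?ler0n ?subr_ge0 // ltW.
    - have [_ h1 _] := Kh _ Kx0.
      under eq_bigr do rewrite lcE5 ejE.
      by rewrite big_split /= -!mulr_sumr h1 (bigD1 j) //= eqxx big1 ?addr0 ?mulr1 ?subrK // => k /negPf->.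
    - by rewrite lcE5 ejE hi (negPf ij) !mulr0 addr0.
  move: hu; rewrite Eu lcE5 ejE hx0j eqxx mulr0 add0r mulr1 => e00.
  by move: e0; rewrite e00 ltxx.
(* A product of numbers between 0 and 1 is a lower bound for each factor, so a backward step of
   relative size [d] keeps all coordinates nonnegative. *)
pose d : R := \prod_(i | i != j) h x0 i.
have d0 : 0 < d by apply: prodr_gt0.
have hle1 x i : realization K x -> h x i <= 1.
  move=> /Kh[g0 <- _]; rewrite (bigD1 i) //= lerDl; exact: sumr_ge0.
have dle i : i != j -> d <= h x0 i.
  move=> ij; rewrite /d (bigD1 i) //= -[leRHS]mulr1 ler_wpM2l ?hge0 //.
  by apply: prodr_ile1 => k _; rewrite hge0 // hle1.
have [|u [e [/andP[e0 e1] su hu Eu]]] := pull ((1 + d) *: h x0 + (- d) *: h c).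
  move=> r /andP[r0 r1]; apply: (@realization_boundaryP _ _ j).
  - move=> k; rewrite !lcE5.
    apply: addr_ge0; apply: mulr_ge0; rewrite ?hge0 ?subr_ge0 ?(ltW r0) //.
    have [->|kj] := eqVneq k j; first by rewrite hx0j hc !mulr0 addr0.
    rewrite mulNr subr_ge0 (le_trans (_ : _ <= d)) //.
      by rewrite -[leRHS]mulr1 ler_wpM2l ?hle1 // ltW.
    by apply: (le_trans (dle _ kj)); rewrite mulrDl mul1r lerDl mulr_ge0 ?hge0 // ltW.
  - have [_ h1 _] := Kh _ Kx0; have [_ h1' _] := Kh _ Kc.
    under eq_bigr do rewrite !lcE5.
    rewrite big_split /= -!mulr_sumr h1 big_split /= -!mulr_sumr h1 h1'; ring.
  - by rewrite !lcE5 hx0j hc !mulr0 addr0 mulr0 addr0.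
have Ku := sub s sc _ su; have [u0 _ _] := Ku.
(* This is the weight for which [x0] is the combination of [u] and [c]. The coordinate at [p]
   vanishes at [x0], is nonnegative at [u] and positive at [c]: a contradiction. *)
pose q := (1 + e * d)^-1.
have ed0 : 0 < e * d by rewrite mulr_gt0.
have /andP[qgt0 qlt1] : 0 < q < 1.
  by rewrite invr_gt0 invf_lt1 ?ltrDl ?ed0 ?andbT // addr_gt0.
have Eq : q *: u + (1 - q) *: c = x0.
  apply: hinj; [|exact: mem_set|].
    by apply/mem_set/(sub s sc); apply: conv_pts_convex; rewrite // !ltW.
  rewrite (aff s sc) ?ltW // Eu; apply/ffunP=> k; rewrite !lcE5 /q.
  by field; rewrite gt_eqF // addr_gt0.
have := congr1 (fun x : {ffun V -> R} => x p) Eq; rewrite lcE x0p cp.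
have t0 : 0 < t by case/andP: t01.
suff /[swap]-> : 0 < q * u p + (1 - q) * t by rewrite ltxx.
by rewrite ltr_wpDl ?mulr_gt0 ?subr_gt0 // mulr_ge0 // ltW.
Qed.

Lemma link_complex (V : finType) (K : {set {set V}}) (v : V) :
  is_complex K -> is_complex (link K v).
Proof.
move=> [K0 Kd]; split=> [|s t]; first by rewrite inE (negPf K0).
rewrite !inE => /and3P[sK vs vsK] ts t0; apply/and3P; split.
- exact: Kd ts t0.
- by apply: contra vs; apply/subsetP.
- by apply: Kd vsK _ _; [exact: setUS|apply/set0Pn; exists v; rewrite setU11].
Qed.

(** In the link of [v], a PL 3-sphere, the other three vertices of the tetrahedron form a triangle,
    which is not free. *)
Lemma no_free_tetrahedron (R : realType) (V : finType) (K : {set {set V}})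
    (v b0 b1 b2 p : V) :
  closed_PL4_manifold R K -> uniq [:: v; b0; b1; b2; p] ->
  [set v; b0; b1; b2; p] \in K ->
  exists q, [/\ q != p, q \notin [set v; b0; b1; b2] & q |: [set v; b0; b1; b2] \in K].
Proof.
move=> [cK PL] Hu SK; have [_ Kd] := cK.
have vK : [set v] \in K.
  by apply: Kd SK _ _; [rewrite sub1set !inE eqxx|apply/set0Pn; exists v; rewrite inE].
have vn : v \notin [set b0; b1; b2; p].
  by move: Hu => /andP[]; rewrite !inE !orbA.
have TK : [set b0; b1; b2; p] \in link K v.
  have E : v |: [set b0; b1; b2; p] = [set v; b0; b1; b2; p] by rewrite !setUA.
  rewrite inE vn E SK /= andbT; apply: (Kd _ _ SK); first by rewrite -E subsetUr.
  by apply/set0Pn; exists b0; rewrite !inE eqxx.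
have [|q [qp qb]] := no_free_triangle (link_complex v cK) (PL v vK) _ TK.
  by case/andP: Hu.
rewrite inE => /and3P[_ vq qK]; exists q; split=> //.
  move: vq; rewrite !inE !negb_or -!andbA => /andP[vq _].
  by rewrite eq_sym vq; move: qb; rewrite !inE !negb_or -!andbA.
by rewrite -!setUA setUCA !setUA in qK *.
Qed.

(** * Complementary minors *)

(** Rows and columns are sequences, so that a row is added by consing and a change of enumeration
    costs only a sign. *)
Definition minor (R : comPzRingType) (T T' : Type) (x0 : T) (y0 : T') (n : nat)
    (A : T -> T' -> R) (d : seq T) (c : seq T') : R :=
  \det (\matrix_(i < n, j < n) A (nth x0 d i) (nth y0 c j)).

Lemma perm_eq_nth (T : eqType) (x0 : T) (n : nat) (s t : seq T) :
  size t = n -> perm_eq s t ->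
  exists p : 'S_n, forall i : 'I_n, nth x0 s i = nth x0 t (p i).
Proof.
move=> tn; have /eqP tn' := tn; move=> st.
have [p Ep] := @tuple_permP _ _ s (Tuple tn') st.
exists p => i; rewrite Ep (nth_map i) ?size_enum_ord //.
by rewrite (tnth_nth x0) nth_ord_enum.
Qed.

Lemma minor_perm_rows (R : comPzRingType) (T : eqType) (T' : Type)
    (x0 : T) (y0 : T') (n : nat) (d d' : seq T) :
  size d' = n -> perm_eq d d' ->
  exists eps : bool, forall (A : T -> T' -> R) c,
    minor x0 y0 n A d c = (-1) ^+ eps * minor x0 y0 n A d' c.
Proof.
move=> sn /(perm_eq_nth x0 sn)[p Ep]; exists (odd_perm p) => A c.
rewrite /minor -det_perm -det_mulmx; congr (\det _).
by rewrite -row_permE; apply/matrixP=> i j; rewrite !mxE Ep.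
Qed.

Lemma minor_tr (R : comPzRingType) (T T' : Type) (x0 : T) (y0 : T') (n : nat)
    (A : T -> T' -> R) d c :
  minor x0 y0 n A d c = minor y0 x0 n (fun a i => A i a) c d.
Proof. by rewrite /minor -det_tr; congr (\det _); apply/matrixP=> i j; rewrite !mxE. Qed.

Lemma minor_perm (R : comPzRingType) (T T' : eqType)
    (x0 : T) (y0 : T') (n : nat) (d d' : seq T) (c c' : seq T') :
  size d' = n -> size c' = n -> perm_eq d d' -> perm_eq c c' ->
  exists eps : bool, forall (A : T -> T' -> R),
    minor x0 y0 n A d c = (-1) ^+ eps * minor x0 y0 n A d' c'.
Proof.
move=> dn cn pd pc.
have [e1 E1] := @minor_perm_rows R T T' x0 y0 n d d' dn pd.
have [e2 E2] := @minor_perm_rows R T' T y0 x0 n c c' cn pc.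
exists (e1 (+) e2) => A; rewrite E1 minor_tr E2 minor_tr mulrA; congr (_ * _).
by rewrite signr_addb.
Qed.

(* Laplace-type duality between the minors of a matrix and the complementary
   minors of its left kernel. *)
Lemma complementary_minors (R : comPzRingType) (T : eqType) (x0 : T) (r m : nat)
    (d e d' e' : seq T) :
  size d = r -> size e = m -> size d' = r -> size e' = m ->
  perm_eq (d ++ e) (d' ++ e') ->
  exists eps : bool, forall (X : T -> 'I_r -> R) (U : 'I_m -> T -> R),
    (forall k l, \sum_(x <- d ++ e) U k x * X x l = 0) ->
    \det (\matrix_(i < r, j < r) X (nth x0 d i) j) *
      \det (\matrix_(j < m, k < m) U k (nth x0 e' j)) =
    (-1) ^+ eps * (\det (\matrix_(i < r, j < r) X (nth x0 d' i) j) *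
      \det (\matrix_(j < m, k < m) U k (nth x0 e j))).
Proof.
move=> sd se sd' se' pe.
have spe : size (d' ++ e') = (r + m)%N by rewrite size_cat sd' se'.
have spd : size (d ++ e) = (r + m)%N by rewrite size_cat sd se.
have [p Ep] := perm_eq_nth x0 spe pe.
exists (odd_perm p) => X U UX0.
pose Xm (s : seq T) n : 'M[R]_(n, r) := \matrix_(i, j) X (nth x0 s i) j.
pose Um (s : seq T) n : 'M[R]_(m, n) := \matrix_(k, j) U k (nth x0 s j).
have catX (a b : seq T) : size a = r -> size b = m ->
    Xm (a ++ b) (r + m)%N = col_mx (Xm a r) (Xm b m).
  move=> sa sb; apply/matrixP=> i j; rewrite !mxE; case: splitP => k ->; rewrite !mxE nth_cat sa.
    by rewrite ltn_ord.
  by rewrite ltnNge leq_addr /= addKn.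
have catU (a b : seq T) : size a = r -> size b = m ->
    Um (a ++ b) (r + m)%N = row_mx (Um a r) (Um b m).
  move=> sa sb; apply/matrixP=> i j; rewrite !mxE; case: splitP => k ->; rewrite !mxE nth_cat sa.
    by rewrite ltn_ord.
  by rewrite ltnNge leq_addr /= addKn.
have EX : Xm (d ++ e) (r + m)%N = perm_mx p *m Xm (d' ++ e') (r + m)%N.
  by rewrite -row_permE; apply/matrixP=> i j; rewrite !mxE Ep.
have EU : Um (d' ++ e') (r + m)%N *m perm_mx p^-1 = Um (d ++ e) (r + m)%N.
  by rewrite -col_permE; apply/matrixP=> i j; rewrite !mxE Ep.
have UX : Um (d ++ e) (r + m)%N *m Xm (d ++ e) (r + m)%N = 0.
  apply/matrixP=> k l; rewrite !mxE -[RHS](UX0 k l) (big_nth x0) spd big_mkord.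
  by apply: eq_bigr => i _; rewrite !mxE.
pose G : 'M[R]_(r + m) := perm_mx p^-1.
have GX : G *m Xm (d ++ e) (r + m)%N = Xm (d' ++ e') (r + m)%N.
  by rewrite EX mulmxA -perm_mxM mulVg perm_mx1 mul1mx.
(* Since [U] annihilates [X], the product of [M1], [G] and [M2] is block upper triangular, with
   diagonal blocks [X] on [d'] and [U] on [e], whereas [M1] and [M2] have the determinants of [U] on
   [e'] and of [X] on [d]. *)
pose M1 : 'M[R]_(r + m) := col_mx (row_mx 1%:M 0) (Um (d' ++ e') (r + m)%N).
pose M2 : 'M[R]_(r + m) := row_mx (Xm (d ++ e) (r + m)%N) (col_mx 0 1%:M).
have dM1 : \det M1 = \det (Um e' m).
  by rewrite /M1 catU // -[col_mx _ _]/(block_mx _ _ _ _) det_lblock det1 mul1r.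
have dM2 : \det M2 = \det (Xm d r).
  by rewrite /M2 catX // -block_mxEh det_lblock det1 mulr1.
have : \det (M1 *m G *m M2) = \det (Xm d' r) * \det (Um e m).
  rewrite /M1 mul_col_mx EU /M2 mul_mx_row !mul_col_mx UX.
  rewrite -(mulmxA _ G) GX catX // mul_row_col mul1mx mul0mx addr0.
  rewrite (catU d e) // mul_row_col mulmx0 mulmx1 add0r.
  by rewrite -block_mxEh det_ublock.
rewrite !det_mulmx dM1 dM2 det_perm odd_permV => E.
have trE (s : seq T) : \det (\matrix_(j < m, k < m) U k (nth x0 s j)) = \det (Um s m).
  by rewrite -det_tr; congr (\det _); apply/matrixP=> i j; rewrite !mxE.
have sq : (-1) ^+ p * (-1) ^+ p = 1 :> R by rewrite -signr_addb addbb.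
rewrite !trE -E -[LHS]mul1r -[X in X * _ = _]sq -!mulrA.
by rewrite [X in _ * (_ * X) = _]mulrC [X in _ * X = _]mulrCA.
Qed.

(** Elimination of [u] by the invertible block [M]; the scalar factor is the Schur complement. *)
Lemma det_bordered (R : fieldType) (n : nat) (M : 'M[R]_n) (a : 'M[R]_1)
    (u : 'rV_n) (v : 'cV_n) :
  M \in unitmx ->
  \det (block_mx a u v M) = (a - u *m invmx M *m v) 0 0 * \det M.
Proof.
move=> uM.
have -> : block_mx a u v M =
    block_mx 1%:M (u *m invmx M) 0 1%:M *m block_mx (a - u *m invmx M *m v) 0 v M.
  rewrite mulmx_block !mul1mx !mul0mx !add0r mulmxKV //.
  by rewrite subrK.
by rewrite det_mulmx det_ublock !det1 mul1r mul1r det_lblock [in LHS]det_mx11.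
Qed.

(** The bordered minor is the nonzero minor times the difference of the two sides. The coefficients
    [X i] are computed from row [i] on the columns [c] alone, hence serve every column [a]. *)
Lemma minor_factor (R : fieldType) (T T' : eqType) (x0 : T) (y0 : T') (r : nat)
    (A : T -> T' -> R) (d : seq T) (c : seq T') :
  minor x0 y0 r A d c != 0 ->
  exists X : T -> 'I_r -> R, forall i a,
    minor x0 y0 r.+1 A (i :: d) (a :: c) = 0 ->
    A i a = \sum_k X i k * A (nth x0 d k) a.
Proof.
rewrite /minor; set M := (X in \det X) => dM.
have uM : M \in unitmx by rewrite unitmxE unitfE.
exists (fun i k => (\row_j A i (nth y0 c j) *m invmx M) 0 k) => i a.
set u := \row_j _; pose v : 'cV[R]_r := \col_k A (nth x0 d k) a.
have -> : \matrix_(i0 < r.+1, j < r.+1) A (nth x0 (i :: d) i0) (nth y0 (a :: c) j) =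
   block_mx (A i a)%:M u v M.
  rewrite -[r.+1]/(1 + r)%N; apply/matrixP=> k l; rewrite !mxE.
  case: splitP => k' Ek; rewrite !mxE; case: splitP => l' El; rewrite !mxE;
    by rewrite ?Ek ?El ?ord1 //= mulr1n.
rewrite det_bordered // => /eqP; rewrite mulf_eq0 (negPf dM) orbF !mxE eqxx mulr1n subr_eq0.
by move/eqP=> ->; apply: eq_bigr => k _; rewrite [v _ _]mxE.
Qed.

Lemma minor_rank_le (R : fieldType) (T T' : Type) (x0 : T) (y0 : T') (n r : nat)
    (A : T -> T' -> R) (d : seq T) (c : seq T') (X : T -> 'I_r -> R) (Y : 'I_r -> T' -> R) :
  (forall i j : 'I_n, A (nth x0 d i) (nth y0 c j) =
     \sum_k X (nth x0 d i) k * Y k (nth y0 c j)) ->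
  minor x0 y0 n A d c != 0 -> (n <= r)%N.
Proof.
rewrite /minor => E; set M := (X in \det X) => dM.
have uM : M \in unitmx by rewrite unitmxE unitfE.
have <- : \rank M = n by rewrite mxrank_unit.
have -> : M = \matrix_(i < n, k < r) X (nth x0 d i) k *m \matrix_(k < r, j < n) Y k (nth y0 c j).
  by apply/matrixP=> i j; rewrite !mxE E; apply: eq_bigr => k _; rewrite !mxE.
exact: mulmx_max_rank.
Qed.

Lemma minor_mul (R : comPzRingType) (T T' : Type) (x0 : T) (y0 : T') (r : nat)
    (A : T -> T' -> R) (d : seq T) (c : seq T') (X : T -> 'I_r -> R) (Y : 'I_r -> T' -> R) :
  (forall i j : 'I_r, A (nth x0 d i) (nth y0 c j) =
     \sum_k X (nth x0 d i) k * Y k (nth y0 c j)) ->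
  minor x0 y0 r A d c = \det (\matrix_(i < r, k < r) X (nth x0 d i) k) *
    \det (\matrix_(k < r, j < r) Y k (nth y0 c j)).
Proof.
move=> E; rewrite -det_mulmx; congr (\det _).
by apply/matrixP=> i j; rewrite !mxE E; apply: eq_bigr => k _; rewrite !mxE.
Qed.

(** * Derivatives of areas and angles *)

Definition has_der (R : realType) (f : R -> R) (v : R) : Prop :=
  is_derive (0 : R) (1 : R) f v.

Lemma has_derM (R : realType) (f g : R -> R) (a b : R) :
  has_der f a -> has_der g b -> has_der (fun t => f t * g t) (a * g 0 + f 0 * b).
Proof.
move=> fa gb; apply: (is_derive_eq (is_deriveM fa gb)).
by rewrite /GRing.scale /= addrC (mulrC (g 0)).
Qed.

Lemma has_derD (R : realType) (f g : R -> R) (a b : R) :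
  has_der f a -> has_der g b -> has_der (fun t => f t + g t) (a + b).
Proof. by move=> fa gb; exact: (is_deriveD fa gb). Qed.

Lemma has_derB (R : realType) (f g : R -> R) (a b : R) :
  has_der f a -> has_der g b -> has_der (fun t => f t - g t) (a - b).
Proof. by move=> fa gb; exact: (is_deriveB fa gb). Qed.

Lemma has_der_sqrt (R : realType) (f : R -> R) (a : R) :
  has_der f a -> 0 < f 0 ->
  has_der (fun t => Num.sqrt (f t)) (a / (2 * Num.sqrt (f 0))).
Proof.
move=> fa f0; apply: (is_derive_eq (is_derive1_comp (is_derive1_sqrt f0) fa)).
by rewrite mulrC.
Qed.

Lemma has_der_acos (R : realType) (f : R -> R) (a : R) :
  has_der f a -> -1 < f 0 < 1 ->
  has_der (fun t => acos (f t)) (- a / Num.sqrt (1 - f 0 ^+ 2)).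
Proof.
move=> fa f0; apply: (is_derive_eq (is_derive1_comp (is_derive1_acos f0) fa)).
by rewrite mulrC mulrN mulNr.
Qed.

Lemma has_derV (R : realType) (f : R -> R) (a : R) :
  has_der f a -> f 0 != 0 -> has_der (fun t => (f t)^-1) (- a / f 0 ^+ 2).
Proof.
move=> fa f0; apply: (is_derive_eq (is_deriveV f0 fa)).
by rewrite /GRing.scale /= mulrC mulrN mulNr.
Qed.

Lemma has_der_val (R : realType) (f : R -> R) (a : R) :
  has_der f a -> derive1 f 0 = a.
Proof. by move=> fa; rewrite derive1E; exact: (@derive_val _ _ _ _ _ _ _ fa). Qed.

Lemma has_der_near_neq0 (R : realType) (f : R -> R) (a : R) :
  has_der f a -> f 0 != 0 -> \forall t \near (0 : R), f t != 0.
Proof.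
move=> [fa _] f0; have /derivable1_diffP/differentiable_continuous cf := fa.
exact: (cvgr_neq0 _ cf f0).
Qed.

Lemma has_der_affine (R : realType) (a b : R) : has_der (fun t : R => a + t * b) b.
Proof.
have dc (c : R) : has_der (fun=> c) 0 by exact: is_derive_cst.
have di : has_der (fun t : R => t) 1 by exact: is_derive_id.
have := has_derD (dc a) (has_derM di (dc b)).
by rewrite /= mulr0 addr0 add0r mul1r.
Qed.

Definition along (R : realType) (V : finType) (L d : {set V} -> R) (t : R) :
    {set V} -> R := fun s => L s + t * d s.

Lemma dlenE (R : realType) (V : finType) (F : ({set V} -> R) -> R) L a :
  dlen F L a = derive1 (fun t => F (along L (fun s => (s == a)%:R) t)) 0.
Proof.
rewrite /dlen; congr (derive1 _ 0); apply/funext=> t; congr F.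
apply/funext=> s; rewrite /along; case: (s == a); first by rewrite mulr1.
by rewrite mulr0 addr0.
Qed.

Lemma along0 (R : realType) (V : finType) (L d : {set V} -> R) : along L d 0 = L.
Proof. by apply/funext=> s; rewrite /along mul0r addr0. Qed.

Lemma dist2_along (R : realType) (V : finType) (L d : {set V} -> R) t u v :
  dist2 (along L d t) u v = dist2 L u v + t * dist2 d u v.
Proof. by rewrite /dist2; case: eqP => //; rewrite mulr0 addr0. Qed.

Lemma gram_along (R : realType) (V : finType) (L d : {set V} -> R) t o u v :
  gram (along L d t) o u v = gram L o u v + t * gram d o u v.
Proof. by rewrite /gram !dist2_along; field. Qed.

Lemma dist2C (R : realType) (V : finType) (L : {set V} -> R) u v :
  dist2 L u v = dist2 L v u.
Proof. by rewrite /dist2 eq_sym setUC. Qed.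

Lemma gramC (R : realType) (V : finType) (L : {set V} -> R) o u v :
  gram L o u v = gram L o v u.
Proof. by rewrite /gram (dist2C _ u) (addrC (dist2 L o u)). Qed.

(** The Gram determinant of the triangle, that is, four times its squared area. *)
Definition gram2 (R : realType) (V : finType) (L : {set V} -> R) (a b c : V) : R :=
  gram L a b b * gram L a c c - gram L a b c ^+ 2.

Lemma det_mx2 (R : comNzRingType) (M : 'M[R]_2) :
  \det M = M 0 0 * M 1 1 - M 0 1 * M 1 0.
Proof.
rewrite (expand_det_row M 0) big_ord_recl big_ord1 /cofactor !det_mx11 !mxE /=.
have l0 : lift ord0 ord0 = 1 :> 'I_2 by apply: val_inj.
have l1 : lift 1 0 = 0 :> 'I_2 by apply: val_inj.
rewrite !l0 l1.
by rewrite expr0 expr1 mul1r mulN1r mulrN.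
Qed.

(** Cramer's rule for the 2 by 2 Gram matrix; it gives a rational expression that can be
    differentiated. *)
Lemma perp_dotE (R : realType) (V : finType) (L : {set V} -> R) (a b c p q : V) :
  gram2 L a b c != 0 ->
  perp_dot L a b c p q = gram L a p q -
    ((gram L a p b * gram L a c c - gram L a p c * gram L a b c) * gram L a b q +
     (gram L a p c * gram L a b b - gram L a p b * gram L a b c) * gram L a c q)
    / gram2 L a b c.
Proof.
move=> D0; pose e (k : 'I_2) := if k == 0 then b else c.
pose G : 'M[R]_2 := \matrix_(k, l) gram L a (e k) (e l).
pose gp : 'rV[R]_2 := \row_k gram L a p (e k).
pose gq : 'cV[R]_2 := \col_k gram L a (e k) q.
rewrite -[LHS]/(gram L a p q - (gp *m invmx G *m gq) 0 0).
have e0 : e 0 = b by []. have e1 : e 1 = c by [].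
have uG : G \in unitmx.
  by rewrite unitmxE unitfE det_mx2 !mxE e0 e1 (gramC _ _ c b) -expr2.
pose al : 'rV[R]_2 := \row_k (if k == 0
  then (gram L a p b * gram L a c c - gram L a p c * gram L a b c) / gram2 L a b c
  else (gram L a p c * gram L a b b - gram L a p b * gram L a b c) / gram2 L a b c).
have -> : gp = al *m G.
  apply/rowP=> k; rewrite !mxE big_ord_recl big_ord1 !mxE /=.
  have -> : lift ord0 ord0 = 1 :> 'I_2 by apply: val_inj.
  rewrite e0 e1; case: (eqVneq k 0) => [->|k0].
    rewrite e0 (gramC _ _ c b) /gram2 in D0 *; field => //.
  have -> : k = 1 by case: k k0 => -[|[|//]] i //= _; apply: val_inj.
  rewrite e1 /gram2 in D0 *; field => //.
rewrite mulmxK // !mxE big_ord_recl big_ord1 !mxE /=.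
have -> : lift ord0 ord0 = 1 :> 'I_2 by apply: val_inj.
by rewrite e0 e1 [in RHS](mulrDl _ _ (gram2 L a b c)^-1); congr (_ - (_ + _)); rewrite mulrAC.
Qed.

(* The variation of the foot of the perpendicular does not contribute. *)
Lemma perp_dot_variation (R : realFieldType) (gbb gbc gcc gpb gpc gbq gcq
    dpq dbb dbc dcc dpb dpc dbq dcq xb xc yb yc D : R) :
  D = gbb * gcc - gbc ^+ 2 ->
  gpb = xb * gbb + xc * gbc -> gpc = xb * gbc + xc * gcc ->
  gbq = yb * gbb + yc * gbc -> gcq = yb * gbc + yc * gcc ->
  D != 0 ->
  dpq - ((((dpb * gcc + gpb * dcc - (dpc * gbc + gpc * dbc)) * gbq +
     (gpb * gcc - gpc * gbc) * dbq +
     ((dpc * gbb + gpc * dbb - (dpb * gbc + gpb * dbc)) * gcq +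
     (gpc * gbb - gpb * gbc) * dcq)) * D^-1 +
    ((gpb * gcc - gpc * gbc) * gbq + (gpc * gbb - gpb * gbc) * gcq) *
    (- (dbb * gcc + gbb * dcc - (dbc * gbc + gbc * dbc)) / D ^+ 2)))
  = dpq - (xb * dbq + xc * dcq) - (yb * dpb + yc * dpc) +
    (xb * yb * dbb + (xb * yc + xc * yb) * dbc + xc * yc * dcc).
Proof. by move=> -> -> -> -> -> D0; field. Qed.

Lemma has_der_gram (R : realType) (V : finType) (L d : {set V} -> R) o u v :
  has_der (fun t => gram (along L d t) o u v) (gram d o u v).
Proof.
have -> : (fun t => gram (along L d t) o u v) = fun t => gram L o u v + t * gram d o u v.
  by apply/funext=> t; rewrite gram_along.
exact: has_der_affine.
Qed.

Lemma has_der_gram2 (R : realType) (V : finType) (L d : {set V} -> R) a b c :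
  has_der (fun t => gram2 (along L d t) a b c)
    (gram d a b b * gram L a c c + gram L a b b * gram d a c c -
      (gram d a b c * gram L a b c + gram L a b c * gram d a b c)).
Proof.
have g := has_der_gram L d.
have := has_derB (has_derM (g a b b) (g a c c)) (has_derM (g a b c) (g a b c)).
rewrite !along0; have -> // : (fun t => gram2 (along L d t) a b c) =
  fun t => gram (along L d t) a b b * gram (along L d t) a c c -
    gram (along L d t) a b c * gram (along L d t) a b c.
by apply/funext=> t; rewrite /gram2 expr2.
Qed.

Lemma has_der_eq (R : realType) (f : R -> R) (a b : R) :
  has_der f a -> a = b -> has_der f b.
Proof. by move=> H <-. Qed.

Lemma has_der_near (R : realType) (f g : R -> R) (a : R) :
  (\forall t \near (0 : R), f t = g t) -> has_der f a -> has_der g a.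
Proof. exact: near_eq_is_derive. Qed.

(** The polar form of the varied lengths [d], evaluated on the vectors from the feet of the
    perpendiculars to [p] and [q]. *)
Definition dperp (R : realType) (V : finType) (d : {set V} -> R) (a b c p q : V)
    (xb xc yb yc : R) : R :=
  gram d a p q - (xb * gram d a b q + xc * gram d a c q) -
    (yb * gram d a p b + yc * gram d a p c) +
    (xb * yb * gram d a b b + (xb * yc + xc * yb) * gram d a b c + xc * yc * gram d a c c).

(* [xb], [xc] are the coordinates of the foot of the perpendicular from [p],
   and [yb], [yc] those of the one from [q]. *)
Lemma has_der_perp_dot (R : realType) (V : finType) (L d : {set V} -> R)
    (a b c p q : V) (xb xc yb yc : R) :
  gram2 L a b c != 0 ->
  gram L a p b = xb * gram L a b b + xc * gram L a b c ->
  gram L a p c = xb * gram L a b c + xc * gram L a c c ->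
  gram L a b q = yb * gram L a b b + yc * gram L a b c ->
  gram L a c q = yb * gram L a b c + yc * gram L a c c ->
  has_der (fun t => perp_dot (along L d t) a b c p q) (dperp d a b c p q xb xc yb yc).
Proof.
move=> D0 pb pc bq cq; have g := has_der_gram L d; have D := has_der_gram2 L d a b c.
have D0' : gram2 (along L d 0) a b c != 0 by rewrite along0.
have nz := has_der_near_neq0 D D0'.
pose N t := let L := along L d t in
  (gram L a p b * gram L a c c - gram L a p c * gram L a b c) * gram L a b q +
     (gram L a p c * gram L a b b - gram L a p b * gram L a b c) * gram L a c q.
apply: (@has_der_near _ (fun t => gram (along L d t) a p q - N t / gram2 (along L d t) a b c)).
  by near do rewrite perp_dotE //.
have dN := has_derD (has_derM (has_derB (has_derM (g a p b) (g a c c)) (has_derM (g a p c) (g a b c))) (g a b q))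
    (has_derM (has_derB (has_derM (g a p c) (g a b b)) (has_derM (g a p b) (g a b c))) (g a c q)).
apply: (has_der_eq (has_derB (g a p q) (has_derM dN (has_derV D D0')))).
rewrite !along0; exact: perp_dot_variation.
Unshelve. all: by end_near.
Qed.

Lemma has_der_area (R : realType) (V : finType) (L d : {set V} -> R)
    (i : {set V}) (a b c : V) :
  enum i = [:: a; b; c] -> 0 < gram2 L a b c ->
  has_der (fun t => area (along L d t) i)
    ((gram d a b b * gram L a c c + gram L a b b * gram d a c c -
      2 * gram L a b c * gram d a b c) / (8 * area L i)).
Proof.
move=> Ei D0; rewrite /area Ei.
have D0' : 0 < gram2 (along L d 0) a b c by rewrite along0.
have dc : has_der (fun=> 2^-1 : R) 0 by exact: is_derive_cst.
apply: (has_der_eq (has_derM (has_der_sqrt (has_der_gram2 L d a b c) D0') dc)).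
rewrite !along0 mulr0 addr0 -/(gram2 L a b c).
have : Num.sqrt (gram2 L a b c) != 0 by rewrite gt_eqF // sqrtr_gt0.
by move: (Num.sqrt _) => s s0; field.
Qed.

(** The left side has the shape that the chain rule gives for the arc cosine of [c]. Writing
    [1 - c ^+ 2] as [(P * Q - g ^+ 2) / (P * Q)] removes the roots of [P * Q], and its positivity
    keeps the cosine strictly between -1 and 1. *)
Lemma dihedral_variation (R : rcfType) (P Q g dP dQ dg : R) :
  0 < P -> 0 < Q -> 0 < P * Q - g ^+ 2 ->
  let c := g / Num.sqrt (P * Q) in
  -1 < c < 1 /\
  - (dg / Num.sqrt (P * Q) + g * (- ((dP * Q + P * dQ) / (2 * Num.sqrt (P * Q))) / Num.sqrt (P * Q) ^+ 2))
     / Num.sqrt (1 - c ^+ 2) =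
  - (dg - g / 2 * (dP / P + dQ / Q)) / Num.sqrt (P * Q - g ^+ 2).
Proof.
move=> P0 Q0 D0 c; have PQ : 0 < P * Q by rewrite mulr_gt0.
have s0 : 0 < Num.sqrt (P * Q) by rewrite sqrtr_gt0.
have s2 : Num.sqrt (P * Q) ^+ 2 = P * Q by rewrite sqr_sqrtr // ltW.
have E : 1 - c ^+ 2 = (P * Q - g ^+ 2) / (P * Q).
  by rewrite /c expr_div_n s2; field; rewrite !gt_eqF.
split.
  have : 0 < 1 - c ^+ 2 by rewrite E divr_gt0.
  by rewrite subr_gt0 => c1; rewrite -ltr_norml -(@ltr_pXn2r _ 2) ?nnegrE // real_normK ?num_real // expr1n.
rewrite E (sqrtrM (P * Q)^-1 (ltW D0)) sqrtrV ?(ltW PQ) // s2.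
have : Num.sqrt (P * Q - g ^+ 2) != 0 by rewrite gt_eqF // sqrtr_gt0.
move: (Num.sqrt (P * Q - _)) => D Dn; move: s0 s2; move: (Num.sqrt _) => s s0 s2.
have -> : (dP * Q + P * dQ) / (2 * s) = (dP / P + dQ / Q) / 2 * s.
  have -> : dP * Q + P * dQ = (dP / P + dQ / Q) * s ^+ 2.
    by rewrite s2; field; rewrite !gt_eqF.
  by field; rewrite !gt_eqF.
rewrite -s2; move: (dP / P + dQ / Q) => k; field.
by rewrite Dn gt_eqF.
Qed.

(** The derivative of the angle between two vectors with squared lengths [P], [Q] and inner product
    [g]. *)
Definition dangle (R : realType) (P Q g dP dQ dg : R) : R :=
  - (dg - g / 2 * (dP / P + dQ / Q)) / Num.sqrt (P * Q - g ^+ 2).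

Lemma has_der_dihedral (R : realType) (V : finType) (L d : {set V} -> R)
    (s i : {set V}) (a b c p q : V) (dP dQ dg : R) :
  enum i = [:: a; b; c] -> enum (s :\: i) = [:: p; q] ->
  let P := perp_dot L a b c p p in let Q := perp_dot L a b c q q in
  let g := perp_dot L a b c p q in
  0 < P -> 0 < Q -> 0 < P * Q - g ^+ 2 ->
  has_der (fun t => perp_dot (along L d t) a b c p p) dP ->
  has_der (fun t => perp_dot (along L d t) a b c q q) dQ ->
  has_der (fun t => perp_dot (along L d t) a b c p q) dg ->
  has_der (fun t => dihedral (along L d t) s i) (dangle P Q g dP dQ dg).
Proof.
move=> Ei Es P Q g P0 Q0 D0 hP hQ hg; rewrite /dihedral Ei Es.
have [c1 E] := dihedral_variation dP dQ dg P0 Q0 D0.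
have PQ0 : 0 < perp_dot (along L d 0) a b c p p * perp_dot (along L d 0) a b c q q.
  by rewrite along0 mulr_gt0.
have hs := has_der_sqrt (has_derM hP hQ) PQ0.
have s0 : Num.sqrt (perp_dot (along L d 0) a b c p p * perp_dot (along L d 0) a b c q q) != 0.
  by rewrite gt_eqF // sqrtr_gt0.
have hc := has_derM hg (has_derV hs s0).
have := has_der_acos hc; rewrite /= !along0 -/P -/Q -/g => /(_ c1) H.
by apply: (has_der_eq H); rewrite E.
Qed.

(** * Geometry of a Euclidean 4-simplex *)

Lemma dotE (R : realType) (x y : 'rV[R]_4) : dot x y = \sum_k x 0 k * y 0 k.
Proof. by rewrite /dot mxE; apply: eq_bigr => k _; rewrite mxE. Qed.

Lemma dotC (R : realType) (x y : 'rV[R]_4) : dot x y = dot y x.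
Proof. by rewrite !dotE; apply: eq_bigr => k _; rewrite mulrC. Qed.

Lemma dotDl (R : realType) (x y z : 'rV[R]_4) : dot (x + y) z = dot x z + dot y z.
Proof. by rewrite /dot mulmxDl mxE. Qed.

Lemma dotZl (R : realType) (a : R) (x z : 'rV[R]_4) : dot (a *: x) z = a * dot x z.
Proof. by rewrite /dot -scalemxAl mxE. Qed.

Lemma dotBl (R : realType) (x y z : 'rV[R]_4) : dot (x - y) z = dot x z - dot y z.
Proof. by rewrite /dot mulmxBl !mxE. Qed.

Lemma dotDr (R : realType) (x y z : 'rV[R]_4) : dot z (x + y) = dot z x + dot z y.
Proof. by rewrite dotC dotDl !(dotC z). Qed.

Lemma dotZr (R : realType) (a : R) (x z : 'rV[R]_4) : dot z (a *: x) = a * dot z x.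
Proof. by rewrite dotC dotZl (dotC z). Qed.

Lemma dotBr (R : realType) (x y z : 'rV[R]_4) : dot z (x - y) = dot z x - dot z y.
Proof. by rewrite dotC dotBl !(dotC z). Qed.

Lemma dot0l (R : realType) (z : 'rV[R]_4) : dot 0 z = 0.
Proof. by rewrite /dot mul0mx mxE. Qed.

Lemma dot_suml (R : realType) (I : finType) (P : pred I) (x : I -> 'rV[R]_4) z :
  dot (\sum_(i | P i) x i) z = \sum_(i | P i) dot (x i) z.
Proof. by rewrite /dot mulmx_suml summxE. Qed.

Lemma dot_ge0 (R : realType) (x : 'rV[R]_4) : 0 <= dot x x.
Proof. by rewrite dotE sumr_ge0 // => k _; rewrite -expr2 sqr_ge0. Qed.

Lemma dot_eq0 (R : realType) (x : 'rV[R]_4) : dot x x = 0 -> x = 0.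
Proof.
rewrite dotE => /psumr_eq0P H; apply/rowP=> k; rewrite mxE.
have := H (fun i _ => sqr_ge0 (x 0 i)) k isT.
by move/eqP; rewrite mulf_eq0 orbb => /eqP.
Qed.

Definition dotl := (dotBl, dotDl, dotZl).
Definition dotr := (dotBr, dotDr, dotZr).

Lemma gram2_gt0 (R : realType) (b1 b2 y1 y2 : 'rV[R]_4) :
  dot b1 y1 = 1 -> dot b2 y1 = 0 -> dot b2 y2 = 1 ->
  0 < dot b1 b1 * dot b2 b2 - dot b1 b2 ^+ 2.
Proof.
move=> h11 h21 h22.
have pos (v y : 'rV[R]_4) : dot v y != 0 -> 0 < dot v v.
  move=> vy; rewrite lt_neqAle eq_sym dot_ge0 andbT.
  by apply: contra vy => /eqP/dot_eq0 ->; rewrite dot0l.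
have b20 : 0 < dot b2 b2 by apply: (pos _ y2); rewrite h22 oner_eq0.
pose v := dot b2 b2 *: b1 - dot b1 b2 *: b2.
have : 0 < dot v v.
  by apply: (pos _ y1); rewrite /v !dotl h11 h21 mulr1 mulr0 subr0 gt_eqF.
have -> : dot v v = dot b2 b2 * (dot b1 b1 * dot b2 b2 - dot b1 b2 ^+ 2).
  by rewrite /v !dotl !dotr (dotC b2 b1); ring.
by rewrite pmulr_rgt0.
Qed.

Definition hrow (R : realType) (v : 'rV[R]_4) : 'rV[R]_5 := row_mx 1%:M v.

(* The volume of the 4-simplex with vertices [x t_0], ..., [x t_4], up to the
   factor 24 and with the orientation given by this ordering. *)
Definition aff_det (R : realType) (V : finType) (x : V -> 'rV[R]_4) (o : V) (t : seq V) : R :=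
  \det (\matrix_(i < 5) hrow (x (nth o t i))).

Lemma aff_det_perm (R : realType) (V : finType) (x : V -> 'rV[R]_4) o
    (t : seq V) (s : 'S_5) :
  aff_det x o [seq nth o t (s i) | i <- enum 'I_5] = (-1) ^+ s * aff_det x o t.
Proof.
rewrite /aff_det -det_perm -det_mulmx -row_permE; congr (\det _).
apply/matrixP=> i j; rewrite [LHS]mxE [RHS]mxE [RHS]mxE; congr (hrow (x _) _ _).
by rewrite (nth_map i) ?size_enum_ord // nth_ord_enum.
Qed.

Lemma aff_det_perm_eq (R : realType) (V : finType) (x : V -> 'rV[R]_4) o (t t' : seq V) :
  size t' = 5%N -> perm_eq t t' -> aff_det x o t ^+ 2 = aff_det x o t' ^+ 2.
Proof.
move=> s5 pt; have [p Ep] := perm_eq_nth o s5 pt.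
have -> : aff_det x o t = (-1) ^+ p * aff_det x o t'.
  rewrite -aff_det_perm; congr (\det _); apply/row_matrixP=> i; rewrite !rowK Ep.
  by rewrite (nth_map i) ?size_enum_ord // nth_ord_enum.
by rewrite exprMn sqrr_sign mul1r.
Qed.

Lemma aff_det_diff (R : realType) (V : finType) (x : V -> 'rV[R]_4) o a (t : seq V) :
  aff_det x o (a :: t) = \det (\matrix_(i < 4) (x (nth o t i) - x a)).
Proof.
rewrite /aff_det; set A := (X in \det X); set B := (X in _ = \det X).
have -> : A = (block_mx 1%:M 0 (const_mx 1) 1%:M : 'M[R]_(1 + 4)) *m block_mx 1%:M (x a) 0 B.
  rewrite mulmx_block !mul1mx !mul0mx !addr0 mulmx1 -[5%N]/(1 + 4)%N.
  apply/row_matrixP=> i; rewrite rowK.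
  have [j ->|j ->] := split_ordP i.
    by rewrite block_mxEv rowKu (ord1 j) row_id.
  rewrite block_mxEv rowKd; apply/rowP=> k; rewrite !mxE.
  case: splitP => l Ekl; rewrite !mxE ?big_ord1 ?mxE ?mul1r /= ?mulr1n.
    by rewrite (ord1 l).
  by rewrite addrC subrK.
apply: (etrans (@det_mulmx _ (1 + 4)%N _ _)).
by rewrite det_lblock !det1 det_ublock det1 !mul1r.
Qed.

(* The vector [n u] is the gradient of the barycentric coordinate of the vertex [u]. *)
Definition frame (R : realType) (V : finType) (x : V -> 'rV[R]_4) (s : {set V})
    (n : V -> 'rV[R]_4) : Prop :=
  [/\ \sum_(u in s) n u = 0,
      forall u v w, u \in s -> v \in s -> w \in s ->
        dot (n u) (x v - x w) = (u == v)%:R - (u == w)%:R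
    & forall y, y = \sum_(u in s) dot (n u) y *: x u].

(** In the inverse [N] of the matrix of homogeneous coordinates, the column of [u] lists the
    coefficients of its barycentric coordinate: the constant term, then the gradient. [N A = 1]
    gives the zero sum and the expansion of vectors, [A N = 1] the duality. *)
Lemma frame_exists (R : realType) (V : finType) (x : V -> 'rV[R]_4) o (t : seq V) :
  uniq t -> size t = 5%N -> aff_det x o t != 0 ->
  exists n, frame x [set u in t] n.
Proof.
move=> Ut s5; rewrite /aff_det; set A := (X in \det X) => dA.
have uA : A \in unitmx by rewrite unitmxE unitfE.
pose N : 'M[R]_(1 + 4, 5) := invmx A.
pose n u : 'rV[R]_4 := \row_k N (rshift 1 k) (inord (index u t)).
have idx u : u \in t -> (index u t < 5)%N by rewrite -s5 index_mem.
have sumt (M : zmodType) (F : V -> M) :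
    \sum_(u in [set u in t]) F u = \sum_(i < 5) F (nth o t i).
  rewrite (eq_bigl (mem t)) => [|u]; last by rewrite inE.
  by rewrite -big_uniq // (big_nth o) s5 big_mkord.
have nE (i : 'I_5) k : n (nth o t i) 0 k = N (rshift 1 k) i.
  by rewrite mxE index_uniq ?s5 // inord_val.
have NA : N *m A = 1%:M :> 'M[R]_(1 + 4) by exact: mulVmx.
have AN : A *m N = 1%:M by exact: mulmxV.
have Ar i k : A i (rshift 1 k) = x (nth o t i) 0 k.
  by rewrite mxE [hrow _ _ _]row_mxEr.
have Al i (k : 'I_1) : A i (lshift 4 k) = 1.
  by rewrite mxE [hrow _ _ _]row_mxEl mxE (ord1 k).
exists n; split=> [|u v w us vs ws|y].
- rewrite sumt; apply/rowP=> k; rewrite summxE mxE.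
  have := congr1 (fun B : 'M[R]_(1 + 4) => B (rshift 1 k) (lshift 4 0)) NA.
  rewrite !mxE -val_eqE /= => E; apply: (etrans _ E); apply: eq_bigr => i _.
  by rewrite nE Al mulr1.
- move: us vs ws; rewrite !inE => us vs ws.
  have d z : z \in t -> dot (n u) (x z) = (z == u)%:R - N (lshift 4 0) (inord (index u t)).
    move=> zt; have := congr1 (fun B : 'M[R]_5 => B (inord (index z t)) (inord (index u t))) AN.
    rewrite !mxE (@big_split_ord _ _ _ 1 4) big_ord1 /= Al mul1r.
    rewrite -val_eqE /= !inordK ?idx // => E.
    have -> : (z == u) = (index z t == index u t).
      by apply/eqP/eqP => [->//|/(congr1 (nth o t))]; rewrite !nth_index.
    apply: (canRL (addrK _)); rewrite -E addrC; congr (_ + _).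
    rewrite dotE; apply: eq_bigr => k _.
    by rewrite Ar inordK ?idx // nth_index // mxE mulrC.
  rewrite dotBr !d // !(eq_sym u); ring.
- rewrite sumt; apply/rowP=> k; rewrite summxE.
  under eq_bigr => i _ do rewrite mxE dotE mulr_suml.
  rewrite exchange_big /=.
  have E l : \sum_(i < 5) n (nth o t i) 0 l * x (nth o t i) 0 k = (l == k)%:R.
    have := congr1 (fun B : 'M[R]_(1 + 4) => B (rshift 1 l) (rshift 1 k)) NA.
    rewrite !mxE (inj_eq (@rshift_inj _ _)) => <-; apply: eq_bigr => i _.
    by rewrite nE Ar.
  under eq_bigr => l _ do
    (under eq_bigr => i _ do rewrite mulrAC; rewrite -mulr_suml E).
  by rewrite (bigD1 k) //= eqxx mul1r big1 ?addr0 // => l /negPf->; rewrite mul0r.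
Qed.

Definition realized (R : realType) (V : finType) (L : {set V} -> R)
    (x : V -> 'rV[R]_4) (s : {set V}) : Prop :=
  forall u v, u \in s -> v \in s -> u != v ->
    L [set u; v] = dot (x u - x v) (x u - x v).

Lemma realizedS (R : realType) (V : finType) (L : {set V} -> R) x (s t : {set V}) :
  t \subset s -> realized L x s -> realized L x t.
Proof. by move=> /subsetP ts H u v /ts us /ts vs; apply: H. Qed.

Lemma gram_realized (R : realType) (V : finType) (L : {set V} -> R) x (s : {set V}) :
  realized L x s -> forall o u v, o \in s -> u \in s -> v \in s ->
  gram L o u v = dot (x u - x o) (x v - x o).
Proof.
move=> HL o u v os us vs.
have HD a b : a \in s -> b \in s -> dist2 L a b = dot (x a - x b) (x a - x b).
  move=> sa sb; rewrite /dist2; case: eqP => [->|/eqP ab]; last exact: HL.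
  by rewrite subrr dot0l.
rewrite /gram !HD // !dotl !dotr (dotC (x o) (x u)) (dotC (x o) (x v)) (dotC (x v) (x u)).
by field.
Qed.

Lemma sum_delta (R : pzRingType) (V : finType) (s : {set V}) (F : V -> R) u :
  u \in s -> \sum_(a in s) F a * (a == u)%:R = F u.
Proof.
move=> us; rewrite (bigD1 u) //= eqxx mulr1 big1 ?addr0 // => a /andP[_ /negPf->].
by rewrite mulr0.
Qed.

(* The quadratic form whose values on the edge vectors of [s] are [d]. *)
Definition dform (R : realType) (V : finType) (n : V -> 'rV[R]_4) (s : {set V})
    (d : {set V} -> R) (y z : 'rV[R]_4) : R :=
  - (\sum_(u in s) \sum_(v in s) dist2 d u v * (dot (n u) y * dot (n v) z)) / 2.

Section DForm.
Context {R : realType} {V : finType} {n : V -> 'rV[R]_4} {s : {set V}} {d : {set V} -> R}.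

Lemma dformC y z : dform n s d y z = dform n s d z y.
Proof.
rewrite /dform exchange_big /=; congr (- _ / _); apply: eq_bigr => u _.
by apply: eq_bigr => v _; rewrite dist2C (mulrC (dot (n v) y)).
Qed.

Lemma dformDl x y z : dform n s d (x + y) z = dform n s d x z + dform n s d y z.
Proof.
rewrite /dform -mulrDl -opprD -big_split /=; congr (- _ / _); apply: eq_bigr => u _.
by rewrite -big_split /=; apply: eq_bigr => v _; rewrite dotDr mulrDl mulrDr.
Qed.

Lemma dformZl a x z : dform n s d (a *: x) z = a * dform n s d x z.
Proof.
rewrite /dform mulrA mulrN mulr_sumr; congr (- _ / _); apply: eq_bigr => u _.
by rewrite mulr_sumr; apply: eq_bigr => v _; rewrite dotZr -mulrA mulrCA.
Qed.

Lemma dformBl x y z : dform n s d (x - y) z = dform n s d x z - dform n s d y z.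
Proof. by rewrite dformDl -scaleN1r dformZl mulN1r. Qed.

Lemma dformDr x y z : dform n s d z (x + y) = dform n s d z x + dform n s d z y.
Proof. by rewrite dformC dformDl !(dformC z). Qed.

Lemma dformZr a x z : dform n s d z (a *: x) = a * dform n s d z x.
Proof. by rewrite dformC dformZl (dformC z). Qed.

Lemma dformBr x y z : dform n s d z (x - y) = dform n s d z x - dform n s d z y.
Proof. by rewrite dformC dformBl !(dformC z). Qed.

Lemma dform0l z : dform n s d 0 z = 0.
Proof. by rewrite -(scale0r 0) dformZl mul0r. Qed.

Lemma dform_suml (I : finType) (P : pred I) (x : I -> 'rV[R]_4) z :
  dform n s d (\sum_(i | P i) x i) z = \sum_(i | P i) dform n s d (x i) z.
Proof.
apply: (big_morph (fun y => dform n s d y z)) => [x' y|]; first exact: dformDl.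
exact: dform0l.
Qed.

End DForm.

Lemma gram_dform (R : realType) (V : finType) (x n : V -> 'rV[R]_4) (s : {set V})
    (d : {set V} -> R) o u v :
  frame x s n -> o \in s -> u \in s -> v \in s ->
  gram d o u v = dform n s d (x u - x o) (x v - x o).
Proof.
move=> [_ dual _] os us vs; rewrite /dform.
have E a b : a \in s -> b \in s -> dist2 d a b * (dot (n a) (x u - x o) * dot (n b) (x v - x o)) =
    ((dist2 d a b * (b == v)%:R) * (a == u)%:R - (dist2 d a b * (b == o)%:R) * (a == u)%:R) -
    ((dist2 d a b * (b == v)%:R) * (a == o)%:R - (dist2 d a b * (b == o)%:R) * (a == o)%:R).
  by move=> sa sb; rewrite !dual //; ring.
under eq_bigr => a sa do under eq_bigr => b sb do rewrite E //.
under eq_bigr => a sa do rewrite !sumrB -!mulr_suml !sum_delta //.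
have oo : dist2 d o o = 0 by rewrite /dist2 eqxx.
by rewrite !sumrB !sum_delta // /gram oo (dist2C _ u o); field.
Qed.

Lemma gram_matrix2 (R : realType) (y1 y2 : 'rV[R]_4) :
  let M : 'M[R]_(2, 4) := \matrix_(i < 2) nth 0 [:: y1; y2] i in
  \det (M *m M^T) = dot y1 y1 * dot y2 y2 - dot y1 y2 ^+ 2.
Proof.
move=> M; have E i j : (M *m M^T) i j = dot (nth 0 [:: y1; y2] i) (nth 0 [:: y1; y2] j).
  by rewrite mxE dotE; apply: eq_bigr => k _; rewrite !mxE.
by rewrite det_mx2 !E /= (dotC y2 y1) expr2.
Qed.

(** A shear replaces [y1], [y2] by their components [m1], [m2] orthogonal to [B1], [B2]; the Gram
    matrix of the four vectors is then block diagonal. *)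
Lemma det_orthogonal (R : realType) (B1 B2 y1 y2 m1 m2 : 'rV[R]_4) (x1 x2 z1 z2 : R) :
  y1 = m1 + (x1 *: B1 + x2 *: B2) -> y2 = m2 + (z1 *: B1 + z2 *: B2) ->
  dot m1 B1 = 0 -> dot m1 B2 = 0 -> dot m2 B1 = 0 -> dot m2 B2 = 0 ->
  \det (\matrix_(i < 4) nth 0 [:: B1; B2; y1; y2] i) ^+ 2 =
  (dot B1 B1 * dot B2 B2 - dot B1 B2 ^+ 2) * (dot m1 m1 * dot m2 m2 - dot m1 m2 ^+ 2).
Proof.
move=> Ey1 Ey2 o11 o12 o21 o22.
pose B : 'M[R]_(2, 4) := \matrix_(i < 2) nth 0 [:: B1; B2] i.
pose M : 'M[R]_(2, 4) := \matrix_(i < 2) nth 0 [:: m1; m2] i.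
pose F : 'M[R]_2 := \matrix_(i < 2) nth 0 [:: \row_(j < 2) nth 0 [:: x1; x2] j;
                                           \row_(j < 2) nth 0 [:: z1; z2] j] i.
have FB i : row i F *m B = F i 0 *: B1 + F i 1 *: B2.
  have Bb0 : row ord0 B = B1 by rewrite rowK.
  have Bb1 : row (lift ord0 ord0) B = B2 by rewrite rowK.
  rewrite mulmx_sum_row big_ord_recl big_ord1 Bb0 Bb1; congr (_ *: _ + _ *: _).
    by rewrite mxE.
  by rewrite mxE; congr (F i _); apply: val_inj.
have -> : \matrix_(i < 4) nth 0 [:: B1; B2; y1; y2] i = col_mx B (F *m B + M) :> 'M[R]_4.
  apply/row_matrixP=> i; rewrite rowK.
  have [j ->|j ->] := @split_ordP 2 2 i.
    apply: (etrans _ (esym (rowKu j B _))); rewrite rowK.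
    by case: j => -[|[|//]] lt.
  apply: (etrans _ (esym (rowKd j B _))); rewrite linearD /= row_mul FB rowK.
  by case: j => -[|[|//]] lt /=; rewrite !mxE /= addrC.
have -> : col_mx B (F *m B + M) = (block_mx 1%:M 0 F 1%:M : 'M[R]_(2 + 2)) *m col_mx B M.
  by rewrite mul_block_col !mul1mx mul0mx addr0.
have -> : \det ((block_mx 1%:M 0 F 1%:M : 'M[R]_(2 + 2)) *m col_mx B M) = \det (col_mx B M : 'M[R]_(2 + 2)).
  by rewrite (@det_mulmx _ (2 + 2)%N) det_lblock !det1 !mul1r.
have BM : M *m B^T = 0.
  apply/matrixP=> i j; rewrite mxE [RHS]mxE.
  transitivity (dot (nth 0 [:: m1; m2] i) (nth 0 [:: B1; B2] j)).
    by rewrite dotE; apply: eq_bigr => k _; rewrite !mxE.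
  by case: i => -[|[|//]] lt; case: j => -[|[|//]] lt'.
have MB : B *m M^T = 0 by rewrite -[LHS]trmxK trmx_mul trmxK BM trmx0.
rewrite -!gram_matrix2 expr2 -{2}(@det_tr _ (2 + 2)%N) -(@det_mulmx _ (2 + 2)%N).
by rewrite (@tr_col_mx _ 2 2) mul_col_row BM MB det_ublock.
Qed.

Definition affine_foot (R : realType) (V : finType) (x : V -> 'rV[R]_4)
    (a b c p : V) (xb xc : R) (m : 'rV[R]_4) : Prop :=
  [/\ x p - x a = m + (xb *: (x b - x a) + xc *: (x c - x a)),
      dot m (x b - x a) = 0 & dot m (x c - x a) = 0].

Lemma dot_foot (R : realType) (m B C z : 'rV[R]_4) (k l : R) :
  dot (m + (k *: B + l *: C)) z = dot m z + (k * dot B z + l * dot C z).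
Proof. by rewrite !dotDl !dotZl. Qed.

Lemma perp_dot_foot (R : realType) (V : finType) (L : {set V} -> R)
    (x : V -> 'rV[R]_4) (d : {set V} -> R) (a b c p q : V) (xb xc yb yc : R) mp mq :
  realized L x [set v in [:: a; b; c; p; q]] ->
  gram2 L a b c != 0 ->
  affine_foot x a b c p xb xc mp -> affine_foot x a b c q yb yc mq ->
  perp_dot L a b c p q = dot mp mq /\
  has_der (fun t => perp_dot (along L d t) a b c p q) (dperp d a b c p q xb xc yb yc).
Proof.
move=> HL D0 [Ep pb pc] [Eq qb qc].
have g := gram_realized HL.
have gpb : gram L a p b = xb * gram L a b b + xc * gram L a b c.
  by rewrite !g ?inE ?eqxx ?orbT // Ep dot_foot pb add0r (dotC (x c - x a) (x b - x a)).
have gpc : gram L a p c = xb * gram L a b c + xc * gram L a c c.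
  by rewrite !g ?inE ?eqxx ?orbT // Ep dot_foot pc add0r.
have gbq : gram L a b q = yb * gram L a b b + yc * gram L a b c.
  by rewrite !g ?inE ?eqxx ?orbT // Eq dotC dot_foot qb add0r (dotC (x c - x a) (x b - x a)).
have gcq : gram L a c q = yb * gram L a b c + yc * gram L a c c.
  by rewrite !g ?inE ?eqxx ?orbT // Eq dotC dot_foot qc add0r.
split; last exact: has_der_perp_dot.
rewrite perp_dotE // gpb gpc gbq gcq.
have -> : dot mp mq = gram L a p q - (xb * gram L a b q + xc * gram L a c q).
  rewrite !g ?inE ?eqxx ?orbT // Ep dot_foot addrK Eq [RHS]dotC dot_foot !(dotC _ mp) pb pc.
  by rewrite !mulr0 !addr0.
by rewrite gbq gcq /gram2 in D0 *; field.
Qed.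

(** Dual bases of a plane have inverse Gram matrices and make supplementary angles. Inverting the
    Gram matrix reverses the sign of its variation, the supplement reverses it again, so the formula
    for the angle keeps its form. *)
Lemma dangle_dual (R : realType) (Wp Wq w op oq o : R) :
  let D := Wp * Wq - w ^+ 2 in 0 < Wp -> 0 < Wq -> 0 < D ->
  dangle (Wq / D) (Wp / D) (- w / D)
    ((Wq ^+ 2 * op - 2 * Wq * w * o + w ^+ 2 * oq) / D ^+ 2)
    ((Wp ^+ 2 * oq - 2 * Wp * w * o + w ^+ 2 * op) / D ^+ 2)
    ((Wp * Wq * o - Wq * w * op - Wp * w * oq + w ^+ 2 * o) / D ^+ 2) =
  - (o - w / 2 * (op / Wp + oq / Wq)) / Num.sqrt D.
Proof.
move=> D Wp0 Wq0 D0; rewrite /dangle.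
have -> : Wq / D * (Wp / D) - (- w / D) ^+ 2 = D^-1.
  have : D * D^-1 = 1 by rewrite divff // gt_eqF.
  move=> DV; transitivity ((Wp * Wq - w ^+ 2) * D^-1 * D^-1); first by ring.
  by rewrite -/D DV mul1r.
rewrite sqrtrV ?ltW // invrK.
have s0 : Num.sqrt D != 0 by rewrite gt_eqF // sqrtr_gt0.
have s2 : Num.sqrt D ^+ 2 = D by rewrite sqr_sqrtr // ltW.
set k := (X in - X * _ = _); set l := (X in _ = - X / _).
suff -> : k = l / D by rewrite -{1}s2; move: (Num.sqrt D) s0 => s s0; field.
have Dn : D != 0 by rewrite gt_eqF.
by rewrite /k /l /D in Dn *; field; rewrite Dn !gt_eqF.
Qed.

Section Face.
Context {R : realType} {V : finType} {L d : {set V} -> R}.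
Context {x n : V -> 'rV[R]_4} {s i : {set V}} {a b c p q : V}.
Hypotheses (Hu : uniq [:: a; b; c; p; q]) (Es : s = [set v in [:: a; b; c; p; q]]).
Hypotheses (HL : realized L x s) (Hf : frame x s n).

Let in_s : [/\ a \in s, b \in s, c \in s, p \in s & q \in s].
Proof. by rewrite Es !inE !eqxx !orbT. Qed.

Let neqs : [/\ [/\ (b == a) = false, (c == a) = false, (p == a) = false & (q == a) = false],
  [/\ (c == b) = false, (p == b) = false & (q == b) = false],
  [/\ (p == c) = false & (q == c) = false] & (q == p) = false].
Proof.
have N u v : u != v -> (v == u) = false by rewrite eq_sym => /negPf.
move: Hu; rewrite /= !inE !negb_or -!andbA.
by do 9 case/andP => /N ->; case/andP => /N ->.
Qed.

Lemma face_sum (M : zmodType) (F : V -> M) :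
  \sum_(u in s) F u = F a + F b + F c + F p + F q.
Proof.
rewrite Es (eq_bigl (mem [:: a; b; c; p; q])) => [|u]; last by rewrite inE.
by rewrite -big_uniq // !big_cons big_nil /= addr0 !addrA.
Qed.

Lemma dual_edges :
  [/\ dot (x b - x a) (n b) = 1, dot (x c - x a) (n b) = 0, dot (x b - x a) (n c) = 0
    & dot (x c - x a) (n c) = 1] /\
  [/\ dot (x b - x a) (n p) = 0, dot (x c - x a) (n p) = 0, dot (x b - x a) (n q) = 0
    & dot (x c - x a) (n q) = 0] /\
  [/\ dot (x p - x a) (n p) = 1, dot (x q - x a) (n p) = 0, dot (x p - x a) (n q) = 0
    & dot (x q - x a) (n q) = 1].
Proof.
have [sa sb sc sp sq] := in_s.
have [[ba ca pa qa] [cb pb qb] [pc qc] qp] := neqs.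
case: Hf => _ dual _; rewrite !(dotC (x _ - x _)) !dual // !eqxx.
by rewrite ?(eq_sym b c) ?(eq_sym c p) ?(eq_sym c q) ?(eq_sym b p) ?(eq_sym b q) ?(eq_sym p q)
  ?ba ?ca ?pa ?qa ?cb ?pb ?qb ?pc ?qc ?qp !subr0.
Qed.

(** The expansion of [y] over the vertices loses [p] and [q], and the zero sum of the gradients
    determines the coefficient at [a] from those at [b] and [c]. *)
Lemma face_plane y : dot (n p) y = 0 -> dot (n q) y = 0 ->
  y = dot (n b) y *: (x b - x a) + dot (n c) y *: (x c - x a).
Proof.
move=> py qy; case: Hf => n0 _ exp.
have : dot (\sum_(u in s) n u) y = 0 by rewrite n0 dot0l.
rewrite dot_suml face_sum py qy !addr0 => E.
rewrite {1}(exp y) face_sum py qy !scale0r !addr0.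
have -> : dot (n a) y = - (dot (n b) y + dot (n c) y).
  by apply/eqP; rewrite -addr_eq0 addrA E.
by apply/rowP=> k; rewrite !mxE; ring.
Qed.

Lemma face_gram_gt0 : 0 < gram2 L a b c.
Proof.
have [sa sb sc sp sq] := in_s.
have [[bb cb bc cc] _] := dual_edges.
by rewrite /gram2 !(gram_realized HL) //; apply: gram2_gt0 bb cb cc.
Qed.

Lemma face_angle (xb xc yb yc : R) (mp mq : 'rV[R]_4) :
  enum i = [:: a; b; c] -> enum (s :\: i) = [:: p; q] ->
  affine_foot x a b c p xb xc mp -> affine_foot x a b c q yb yc mq ->
  [/\ 0 < dot mp mp, 0 < dot mq mq, 0 < dot mp mp * dot mq mq - dot mp mq ^+ 2,
    gram2 L a b c * (dot mp mp * dot mq mq - dot mp mq ^+ 2) =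
      aff_det x a [:: a; b; c; p; q] ^+ 2
  & has_der (fun t => dihedral (along L d t) s i)
    (dangle (dot mp mp) (dot mq mq) (dot mp mq) (dperp d a b c p p xb xc xb xc)
       (dperp d a b c q q yb yc yb yc) (dperp d a b c p q xb xc yb yc))].
Proof.
move=> Ei Esi fp fq; have D0 := face_gram_gt0.
have D0' : gram2 L a b c != 0 by rewrite gt_eqF.
have [sa sb sc sp sq] := in_s.
have sub u v : u \in s -> v \in s -> realized L x [set w in [:: a; b; c; u; v]].
  move=> us vs; apply: realizedS HL; apply/subsetP=> w; rewrite inE => Hw.
  by move: Hw; rewrite !inE => /or4P[||| /orP[]] /eqP->.
have [Ppp hpp] := perp_dot_foot d (sub _ _ sp sp) D0' fp fp.
have [Pqq hqq] := perp_dot_foot d (sub _ _ sq sq) D0' fq fq.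
have [Ppq hpq] := perp_dot_foot d (sub _ _ sp sq) D0' fp fq.
have [[bb cb bc cc] [[bp cp bq cq] [pp qp pq qq]]] := dual_edges.
have [Ep mpb mpc] := fp; have [Eq mqb mqc] := fq.
have mpp : dot mp (n p) = 1 by move: pp; rewrite Ep dot_foot bp cp !mulr0 !addr0.
have mqp : dot mq (n p) = 0 by move: qp; rewrite Eq dot_foot bp cp !mulr0 !addr0.
have mpq : dot mp (n q) = 0 by move: pq; rewrite Ep dot_foot bq cq !mulr0 !addr0.
have mqq : dot mq (n q) = 1 by move: qq; rewrite Eq dot_foot bq cq !mulr0 !addr0.
have pos (v y : 'rV[R]_4) : dot v y = 1 -> 0 < dot v v.
  move=> vy; rewrite lt_neqAle eq_sym dot_ge0 andbT.
  by apply/eqP => /dot_eq0 v0; move/eqP: vy; rewrite v0 dot0l eq_sym oner_eq0.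
have P0 := pos _ _ mpp; have Q0 := pos _ _ mqq.
have G0 := gram2_gt0 mpp mqp mqq.
split=> //.
  rewrite aff_det_diff /gram2 !(gram_realized HL) //.
  rewrite -(det_orthogonal Ep Eq mpb mpc mqb mqc); congr (\det _ ^+ 2).
  by apply/row_matrixP=> k; rewrite !rowK; case: k => -[|[|[|[|//]]]] lt.
by rewrite -Ppp -Pqq -Ppq; apply: has_der_dihedral => //; rewrite ?Ppp ?Pqq ?Ppq.
Qed.

Notation W u v := (dot (n u) (n v)).
Notation omg u v := (dform n s d (n u) (n v)).

Lemma dual_gram_gt0 : 0 < W p p * W q q - W p q ^+ 2.
Proof.
have [_ [_ [pp qp pq qq]]] := dual_edges.
by apply: (gram2_gt0 (y1 := x p - x a) (y2 := x q - x a)); rewrite dotC.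
Qed.

(** The basis of the normal plane of the face dual to [n p], [n q]. The edges from [a] to [p] and
    [q] pair with these normals in the same way, so [dual_perp p q] and [dual_perp q p] are their
    components orthogonal to the face. *)
Definition dual_perp (u v : V) : 'rV[R]_4 :=
  (W p p * W q q - W p q ^+ 2)^-1 *: (W v v *: n u - W u v *: n v).

Lemma dot_dual_perp u v z : dot (dual_perp u v) z =
  (W v v * dot (n u) z - W u v * dot (n v) z) / (W p p * W q q - W p q ^+ 2).
Proof. by rewrite /dual_perp dotZl dotBl !dotZl mulrC. Qed.

Lemma affine_foot_dual :
  (exists xb xc, affine_foot x a b c p xb xc (dual_perp p q)) /\
  (exists xb xc, affine_foot x a b c q xb xc (dual_perp q p)).
Proof.
have Dn : W p p * W q q - W p q ^+ 2 != 0 by rewrite gt_eqF // dual_gram_gt0.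
have [_ [[bp cp bq cq] [pp qp pq qq]]] := dual_edges.
have foot r m : dot (x r - x a) (n p) = dot m (n p) -> dot (x r - x a) (n q) = dot m (n q) ->
    dot m (x b - x a) = 0 -> dot m (x c - x a) = 0 ->
    exists xb xc, affine_foot x a b c r xb xc m.
  move=> h1 h2 h3 h4.
  have E : x r - x a - m = dot (n b) (x r - x a - m) *: (x b - x a) +
      dot (n c) (x r - x a - m) *: (x c - x a).
    by apply: face_plane; rewrite dotC dotBl ?h1 ?h2 subrr.
  exists (dot (n b) (x r - x a - m)), (dot (n c) (x r - x a - m)); split=> //.
  by rewrite -E [RHS]addrC subrK.
split; apply: foot; rewrite dot_dual_perp.
all: rewrite ?pp ?pq ?qp ?qq ?(dotC (n p) (x _ - _)) ?(dotC (n q) (x _ - _)) ?bp ?cp ?bq ?cq.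
all: rewrite ?(dotC (n q) (n p)) ?mulr0 ?subr0 ?mul0r // .
all: by field.
Qed.

Lemma dperp_dform u v xb xc yb yc mu mv : u \in s -> v \in s ->
  affine_foot x a b c u xb xc mu -> affine_foot x a b c v yb yc mv ->
  dperp d a b c u v xb xc yb yc = dform n s d mu mv.
Proof.
move=> us vs [Eu _ _] [Ev _ _]; have [sa sb sc sp sq] := in_s.
rewrite /dperp !(gram_dform d Hf) // Eu Ev.
move: (x b - x a) (x c - x a) => B C.
rewrite !(dformDl, dformDr, dformZl, dformZr) (dformC C B) !(dformC mu); ring.
Qed.

Lemma dual_perp_gram :
  let D := W p p * W q q - W p q ^+ 2 in
  [/\ dot (dual_perp p q) (dual_perp p q) = W q q / D,
      dot (dual_perp q p) (dual_perp q p) = W p p / D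
    & dot (dual_perp p q) (dual_perp q p) = - W p q / D].
Proof.
move=> D; have Dn : W p p * W q q - W p q ^+ 2 != 0 by rewrite gt_eqF // dual_gram_gt0.
split; rewrite dot_dual_perp 2!(dotC (n _) (dual_perp _ _)) !dot_dual_perp ?(dotC (n q) (n p));
  by rewrite /D; field.
Qed.

Lemma dual_perp_dform :
  let D := W p p * W q q - W p q ^+ 2 in
  [/\ dform n s d (dual_perp p q) (dual_perp p q) =
        (W q q ^+ 2 * omg p p - 2 * W q q * W p q * omg p q + W p q ^+ 2 * omg q q) / D ^+ 2,
      dform n s d (dual_perp q p) (dual_perp q p) =
        (W p p ^+ 2 * omg q q - 2 * W p p * W p q * omg p q + W p q ^+ 2 * omg p p) / D ^+ 2
    & dform n s d (dual_perp p q) (dual_perp q p) =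
        (W p p * W q q * omg p q - W q q * W p q * omg p p - W p p * W p q * omg q q
          + W p q ^+ 2 * omg p q) / D ^+ 2].
Proof.
move=> D; have Dn : D != 0 by rewrite gt_eqF // dual_gram_gt0.
have swap u v : dform n s d (n u) (n v) = dform n s d (n v) (n u) by rewrite dformC.
split; rewrite /dual_perp -/D !(dformBl, dformBr, dformZl, dformZr) ?(dotC (n q) (n p)) ?(swap q p);
  by field.
Qed.

(** The formula mentions only the two vertices off the face, which lets a sum over faces be taken
    over pairs of vertices. *)
Lemma has_der_dihedral_dual :
  enum i = [:: a; b; c] -> enum (s :\: i) = [:: p; q] ->
  has_der (fun t => dihedral (along L d t) s i)
    (- (omg p q - W p q / 2 * (omg p p / W p p + omg q q / W q q)) /
       Num.sqrt (W p p * W q q - W p q ^+ 2)).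
Proof.
move=> Ei Es'; have [[xb [xc fp]] [yb [yc fq]]] := affine_foot_dual.
have [sa sb sc sp sq] := in_s.
have [P0 Q0 _ _] := face_angle Ei Es' fp fq.
rewrite (dperp_dform sp sp fp fp) (dperp_dform sq sq fq fq) (dperp_dform sp sq fp fq).
have D0 := dual_gram_gt0.
have [EP EQ ->] := dual_perp_gram; have [-> -> ->] := dual_perp_dform.
rewrite EP EQ in P0 Q0 *; rewrite dangle_dual //.
  by move: Q0; rewrite pmulr_lgt0 // invr_gt0.
by move: P0; rewrite pmulr_lgt0 // invr_gt0.
Qed.

(** The volume is the area of the face times that spanned by the two perpendiculars, whose Gram
    determinant is inverse to that of [n p], [n q]. *)
Lemma area_dual : enum i = [:: a; b; c] ->
  area L i = Num.sqrt (aff_det x a [:: a; b; c; p; q] ^+ 2) *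
    Num.sqrt (W p p * W q q - W p q ^+ 2) / 2.
Proof.
move=> Ei; rewrite /area Ei -/(gram2 L a b c) -sqrtrM ?sqr_ge0 //.
have [[xb [xc [Ep pb pc]]] [yb [yc [Eq qb qc]]]] := affine_foot_dual.
have [sa sb sc sp sq] := in_s; have D0 := dual_gram_gt0.
congr (Num.sqrt _ / 2).
rewrite aff_det_diff.
have -> : \matrix_(i < 4) (x (nth a [:: b; c; p; q] i) - x a) =
    \matrix_(i < 4) nth 0 [:: x b - x a; x c - x a; x p - x a; x q - x a] i.
  by apply/row_matrixP=> k; rewrite !rowK; case: k => -[|[|[|[|//]]]] lt.
rewrite (det_orthogonal Ep Eq pb pc qb qc) /gram2 !(gram_realized HL) //.
have [-> -> ->] := dual_perp_gram.
rewrite -[LHS]mulr1 -[RHS]mulrA; congr (_ * _); field.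
by rewrite gt_eqF.
Qed.

(** The trace of the form [dform n s d] with respect to the Euclidean metric. *)
Definition dtrace : R :=
  - (\sum_(u in s) \sum_(v in s) dist2 d u v * W u v) / 2.

(** The plane of the face and the span of [n p], [n q] are orthogonal complements, and in each the
    inner product is given by the inverse Gram matrix. [h] is the vector so reconstructed from [y],
    and [y - h] is orthogonal to itself. *)
Lemma dot_plane_normal y z :
  let B := x b - x a in let C := x c - x a in
  let bb := dot B B in let bc := dot B C in let cc := dot C C in
  dot y z =
   (cc * (dot y B * dot z B) + bb * (dot y C * dot z C)
     - bc * (dot y B * dot z C + dot y C * dot z B)) / (bb * cc - bc ^+ 2) +
   (W q q * (dot y (n p) * dot z (n p)) + W p p * (dot y (n q) * dot z (n q))
     - W p q * (dot y (n p) * dot z (n q) + dot y (n q) * dot z (n p)))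
     / (W p p * W q q - W p q ^+ 2).
Proof.
move=> B C bb bc cc.
have := dual_edges; rewrite -/B -/C => -[[bB cB bC cC] [[bp cp bq cq] _]].
have Dn : W p p * W q q - W p q ^+ 2 != 0 by rewrite gt_eqF // dual_gram_gt0.
have Gn : bb * cc - bc ^+ 2 != 0 by rewrite gt_eqF // (gram2_gt0 bB cB cC).
pose G := bb * cc - bc ^+ 2; pose D := W p p * W q q - W p q ^+ 2.
pose kB := (cc * dot y B - bc * dot y C) / G; pose kC := (bb * dot y C - bc * dot y B) / G.
pose kp := (W q q * dot y (n p) - W p q * dot y (n q)) / D.
pose kq := (W p p * dot y (n q) - W p q * dot y (n p)) / D.
pose h := kB *: B + kC *: C + (kp *: n p + kq *: n q).
have hz w : dot h w = kB * dot B w + kC * dot C w + (kp * dot (n p) w + kq * dot (n q) w).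
  by rewrite /h dotDl (dotDl (kB *: B)) (dotDl (kp *: n p)) !dotZl.
have rp : dot (n p) (y - h) = 0.
  rewrite dotC dotBl hz bp cp (dotC (n q) (n p)) /kp /kq /D; by field.
have rq : dot (n q) (y - h) = 0.
  rewrite dotC dotBl hz bq cq /kp /kq /D; by field.
have rB : dot B (y - h) = 0.
  rewrite dotC dotBl hz -/bb (dotC C B) -/bc !(dotC (n _)) bp bq /kB /kC /G; by field.
have rC : dot C (y - h) = 0.
  rewrite dotC dotBl hz -/bc -/cc !(dotC (n _)) cp cq /kB /kC /G; by field.
have /dot_eq0/subr0_eq Ey : dot (y - h) (y - h) = 0.
  by rewrite {1}(face_plane rp rq) -/B -/C (dotDl (_ *: B)) !dotZl rB rC !mulr0 addr0.
rewrite {1}Ey hz !(dotC _ z) /kB /kC /kp /kq /G /D.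
by field; rewrite Dn.
Qed.

Lemma dtrace_split :
  let B := x b - x a in let C := x c - x a in
  let bb := dot B B in let bc := dot B C in let cc := dot C C in
  dtrace = (cc * dform n s d B B + bb * dform n s d C C - 2 * bc * dform n s d B C)
      / (bb * cc - bc ^+ 2) +
    (W q q * omg p p + W p p * omg q q - 2 * W p q * omg p q)
      / (W p p * W q q - W p q ^+ 2).
Proof.
move=> B C bb bc cc.
pose S y z := \sum_(u in s) \sum_(v in s) dist2 d u v * (dot (n u) y * dot (n v) z).
pose G := bb * cc - bc ^+ 2; pose D := W p p * W q q - W p q ^+ 2.
have ES y z : dform n s d y z = - S y z / 2 by [].
have SC y z : S z y = S y z.
  rewrite /S exchange_big /=; apply: eq_bigr => u _; apply: eq_bigr => v _.
  by rewrite dist2C (mulrC (dot (n v) z)).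
have sumD (F F' : V -> V -> R) : \sum_(u in s) \sum_(v in s) (F u v + F' u v) =
    \sum_(u in s) \sum_(v in s) F u v + \sum_(u in s) \sum_(v in s) F' u v.
  by rewrite -big_split; apply: eq_bigr => u _; rewrite -big_split.
have sumZ k (F : V -> V -> R) : \sum_(u in s) \sum_(v in s) k * F u v =
    k * \sum_(u in s) \sum_(v in s) F u v.
  by rewrite mulr_sumr; apply: eq_bigr => u _; rewrite mulr_sumr.
have -> : dtrace = - (cc / G * S B B + (bb / G * S C C + (- bc / G * S B C + (- bc / G * S C B +
    (W q q / D * S (n p) (n p) + (W p p / D * S (n q) (n q) + (- W p q / D * S (n p) (n q) +
     (- W p q / D) * S (n q) (n p)))))))) / 2.
  rewrite /dtrace /S -!sumZ -!sumD; congr (- _ / _); apply: eq_bigr => u _; apply: eq_bigr => v _.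
  by rewrite dot_plane_normal -/B -/C -/bb -/bc -/cc -/G -/D; ring.
by rewrite !ES -/G -/D (SC B C) (SC (n p) (n q)); ring.
Qed.

(** The logarithmic derivative of an area is half the trace of the variation on its plane. This is
    the full trace minus the one on the normal plane, so that again only [p] and [q] remain. *)
Lemma has_der_area_dual : enum i = [:: a; b; c] ->
  has_der (fun t => area (along L d t) i)
    (area L i / 2 * (dtrace - (W q q * omg p p + W p p * omg q q - 2 * W p q * omg p q)
      / (W p p * W q q - W p q ^+ 2))).
Proof.
move=> Ei; have G0 := face_gram_gt0; have [sa sb sc sp sq] := in_s.
apply: (has_der_eq (has_der_area d Ei G0)).
rewrite dtrace_split addrK.
have : 4 * area L i ^+ 2 = gram2 L a b c.
  by rewrite /area Ei -/(gram2 L a b c) expr_div_n sqr_sqrtr ?ltW //; field.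
have : area L i != 0.
  by rewrite /area Ei -/(gram2 L a b c) mulf_neq0 ?gt_eqF ?sqrtr_gt0 // invr_gt0.
move: (area L i) => S S0; rewrite /gram2 !(gram_dform d Hf) // !(gram_realized HL) // => E.
rewrite -E; field.
by rewrite S0.
Qed.

End Face.

(** * Schlaefli's identity and its antisymmetrized derivative *)

(** The trace of [o] on the plane of [p] and [q], relative to the Gram matrix [w]. *)
Definition dlogplane (R : realType) (V : Type) (w o : V -> V -> R) (p q : V) : R :=
  (w q q * o p p + w p p * o q q - 2 * w p q * o p q) / (w p p * w q q - w p q ^+ 2).

(** The derivative of a dihedral angle up to sign and without its denominator, a square root that
    cancels against the same root in the area. *)
Definition dangle_num (R : realType) (V : Type) (w o : V -> V -> R) (p q : V) : R :=
  o p q - w p q / 2 * (o p p / w p p + o q q / w q q).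

(** Antisymmetrizing removes the Gram determinants from the denominators and leaves [F], a sum of
    terms in which a function of at most one vertex multiplies [w], [o] or [o']. [F] vanishes on the
    diagonal, which may therefore be added to the sum; the vanishing row sums then kill every
    term. *)
Lemma schlafli_symmetry (R : realType) (V : finType) (s : {set V})
    (w o o' : V -> V -> R) (T T' : R) :
  (forall p q, w p q = w q p) -> (forall p q, o p q = o q p) -> (forall p q, o' p q = o' q p) ->
  (forall p, \sum_(q in s) w p q = 0) -> (forall p, \sum_(q in s) o p q = 0) ->
  (forall p, \sum_(q in s) o' p q = 0) ->
  (forall p, p \in s -> w p p != 0) ->
  (forall p q, p \in s -> q \in s -> p != q -> w p p * w q q - w p q ^+ 2 != 0) ->
  \sum_(p in s) \sum_(q in s | q != p)
    ((T - dlogplane w o p q) * dangle_num w o' p q -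
     (T' - dlogplane w o' p q) * dangle_num w o p q) = 0.
Proof.
move=> wC oC oC' w0 o0 o0' wn Dn.
pose a p := o p p / w p p; pose a' p := o' p p / w p p.
pose F p q := T * o' p q + (- (T / 2) * (a' p * w p q) + (- (T / 2) * (a' q * w p q) +
  (- T' * o p q + (T' / 2 * (a p * w p q) + (T' / 2 * (a q * w p q) +
  (-1 * (a p * o' p q) + (-1 * (a q * o' p q) + (1 * (a' p * o p q) + 1 * (a' q * o p q))))))))).
have FE p q : p \in s -> q \in s -> q != p ->
    (T - dlogplane w o p q) * dangle_num w o' p q -
    (T' - dlogplane w o' p q) * dangle_num w o p q = F p q.
  move=> sp sq pq; rewrite /dlogplane /dangle_num /F /a /a'.
  have Dpq := Dn p q sp sq; rewrite eq_sym in Dpq; have {}Dpq := Dpq pq.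
  by field; rewrite Dpq !wn.
have Fpp p : p \in s -> F p p = 0.
  by move=> sp; rewrite /F /a /a'; field; rewrite wn.
rewrite (_ : \sum_(p in s) _ = \sum_(p in s) \sum_(q in s) F p q); last first.
  apply: eq_bigr => p sp; rewrite [in RHS](bigD1 p) //= Fpp // add0r.
  by apply: eq_bigr => q /andP[sq qp]; apply: FE.
have sumD (G G' : V -> V -> R) : \sum_(u in s) \sum_(v in s) (G u v + G' u v) =
    \sum_(u in s) \sum_(v in s) G u v + \sum_(u in s) \sum_(v in s) G' u v.
  by rewrite -big_split; apply: eq_bigr => u _; rewrite -big_split.
have sumZ k (G : V -> V -> R) : \sum_(u in s) \sum_(v in s) k * G u v =
    k * \sum_(u in s) \sum_(v in s) G u v.
  by rewrite mulr_sumr; apply: eq_bigr => u _; rewrite mulr_sumr.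
have row0 (b : V -> R) (v : V -> V -> R) : (forall p, \sum_(q in s) v p q = 0) ->
    \sum_(p in s) \sum_(q in s) b p * v p q = 0.
  by move=> v0; apply: big1 => p _; rewrite -mulr_sumr v0 mulr0.
have col0 (b : V -> R) (v : V -> V -> R) : (forall p q, v p q = v q p) ->
    (forall p, \sum_(q in s) v p q = 0) -> \sum_(p in s) \sum_(q in s) b q * v p q = 0.
  move=> vC v0; rewrite exchange_big /=; apply: big1 => p _; rewrite -mulr_sumr.
  by under eq_bigr do rewrite vC; rewrite v0 mulr0.
have all0 (v : V -> V -> R) : (forall p, \sum_(q in s) v p q = 0) ->
    \sum_(p in s) \sum_(q in s) v p q = 0.
  by move=> v0; apply: big1 => p _.
by rewrite !sumD !sumZ !row0 // !col0 // !all0 // !mulr0 !addr0.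
Qed.

(** A face is the complement of an unordered pair of vertices, which the double sum meets twice. *)
Lemma sum_faces_pairs (R : nmodType) (V : finType) (s : {set V}) (f : V -> V -> R)
    (g : {set V} -> R) :
  #|s| = 5%N ->
  (forall i p q, i \in ksubsets 3 s -> s :\: i = [set p; q] -> p != q -> f p q = g i) ->
  \sum_(p in s) \sum_(q in s | q != p) f p q = (\sum_(i in ksubsets 3 s) g i) *+ 2.
Proof.
move=> s5 fg; rewrite pair_big_dep /=.
pose h (u : V * V) := s :\: [set u.1; u.2].
have hP u : (u.1 \in s) && ((u.2 \in s) && (u.2 != u.1)) ->
    h u \in ksubsets 3 s /\ s :\: h u = [set u.1; u.2].
  case/and3P=> s1 s2 n12.
  have sub : [set u.1; u.2] \subset s by rewrite subUset !sub1set s1 s2.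
  rewrite /h setDDr setDv set0U (setIidPr sub) inE subsetDl /= cardsD (setIidPr sub).
  by rewrite s5 cards2 (eq_sym u.1) n12.
rewrite (partition_big h (fun i => i \in ksubsets 3 s)) /=; last first.
  by move=> u /hP[].
rewrite -sumrMnl; apply: eq_bigr => i iK.
have := iK; rewrite inE => /andP[iS /eqP i3].
have : #|s :\: i| = 2%N by rewrite cardsD (setIidPr iS) s5 i3.
move=> /eqP/cards2P[p [q [pq Epq]]].
have sub : [set p; q] \subset s by rewrite -Epq subsetDl.
have [sp sq] : p \in s /\ q \in s by move: sub; rewrite subUset !sub1set => /andP.
have Ei : i = s :\: [set p; q] by rewrite -Epq setDDr setDv set0U; apply/esym/setIidPr.
rewrite (eq_bigl (fun u => u \in [set (p, q); (q, p)])) => [|[u v]].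
  rewrite big_setU1 ?big_set1 /=; last first.
    by rewrite inE; apply: contra pq => /eqP[-> _].
  by rewrite (fg i p q) // (fg i q p) ?mulr2n // 1?eq_sym // setUC.
rewrite !inE /h /=; apply/idP/idP.
  move=> /andP[H /eqP E]; have [_] := hP (u, v) H; rewrite /h /= E Epq => {}E.
  have : u \in [set p; q] by rewrite E !inE eqxx.
  have : v \in [set p; q] by rewrite E !inE eqxx orbT.
  case/and3P: H => _ _ /=; rewrite !inE !xpair_eqE.
  by move=> vu /orP[]/eqP Ev /orP[]/eqP Eu; move: vu; rewrite Ev Eu ?eqxx ?orbT.
by move=> /orP[]/eqP[-> ->]; rewrite ?sp ?sq /= Ei ?(setUC [set q]) eqxx ?andbT // eq_sym.
Qed.

Lemma enum2P (V : finType) (A : {set V}) : #|A| = 2%N -> exists p q, enum A = [:: p; q].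
Proof. by rewrite cardE; case: (enum A) => [|p [|q []]] // _; exists p, q. Qed.

Lemma enum3P (V : finType) (A : {set V}) : #|A| = 3%N -> exists a b c, enum A = [:: a; b; c].
Proof. by rewrite cardE; case: (enum A) => [|a [|b [|c []]]] // _; exists a, b, c. Qed.

Lemma face_enum (V : finType) (s i : {set V}) a b c p q :
  i \subset s -> enum i = [:: a; b; c] -> enum (s :\: i) = [:: p; q] ->
  uniq [:: a; b; c; p; q] /\ s = [set v in [:: a; b; c; p; q]].
Proof.
move=> iS Ei Es; have E : [:: a; b; c; p; q] = enum i ++ enum (s :\: i) by rewrite Ei Es.
split.
  rewrite E cat_uniq !enum_uniq andbT /=; apply/hasPn=> v.
  by rewrite !mem_enum inE => /andP[].
apply/setP=> v; rewrite inE E mem_cat !mem_enum inE.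
by have := subsetP iS v; case: (v \in i) => // ->.
Qed.

Lemma gram_local (R : realType) (V : finType) (L L' : {set V} -> R) (s : {set V}) :
  (forall e, e \in ksubsets 2 s -> L e = L' e) ->
  forall o u v, o \in s -> u \in s -> v \in s -> gram L o u v = gram L' o u v.
Proof.
move=> LL o u v os us vs.
have D y z : y \in s -> z \in s -> dist2 L y z = dist2 L' y z.
  move=> ys zs; rewrite /dist2; case: eqP => [//|/eqP yz]; apply: LL.
  by rewrite inE subUset !sub1set ys zs cards2 yz.
by rewrite /gram !D.
Qed.

Lemma ksubsetsS (V : finType) k (s t : {set V}) : s \subset t -> ksubsets k s \subset ksubsets k t.
Proof.
move=> st; apply/subsetP=> e; rewrite !inE => /andP[es ->].
by rewrite (subset_trans es).
Qed.

Lemma area_local (R : realType) (V : finType) (L L' : {set V} -> R) (i : {set V}) :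
  (forall e, e \in ksubsets 2 i -> L e = L' e) -> area L i = area L' i.
Proof.
move=> LL; rewrite /area.
have mi v : v \in enum i -> v \in i by rewrite mem_enum.
case E: (enum i) mi => [|a [|b [|c []]]] // mi.
by rewrite !(gram_local LL) // mi // !inE eqxx ?orbT.
Qed.

Lemma dihedral_local (R : realType) (V : finType) (L L' : {set V} -> R) (s i : {set V}) :
  i \subset s -> (forall e, e \in ksubsets 2 s -> L e = L' e) ->
  dihedral L s i = dihedral L' s i.
Proof.
move=> iS LL; rewrite /dihedral.
have mi v : v \in enum i -> v \in s by rewrite mem_enum; apply/subsetP.
have ms v : v \in enum (s :\: i) -> v \in s by rewrite mem_enum inE => /andP[].
case E: (enum i) mi => [|a [|b [|c []]]] // mi.
case E': (enum _) ms => [|p [|q []]] // ms.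
have sa : a \in s by rewrite mi // !inE eqxx.
have sb : b \in s by rewrite mi // !inE eqxx orbT.
have sc : c \in s by rewrite mi // !inE eqxx !orbT.
have P y z : y \in s -> z \in s -> perp_dot L a b c y z = perp_dot L' a b c y z.
  move=> ys zs; rewrite /perp_dot (gram_local LL) //.
  have e (k : 'I_2) : (if k == 0 then b else c) \in s by case: ifP.
  congr (_ - (_ *m invmx _ *m _) _ _); apply/matrixP=> k l; rewrite !mxE;
    by rewrite (gram_local LL).
by rewrite !P ?ms ?inE ?eqxx ?orbT.
Qed.

Lemma aff_det_default (R : realType) (V : finType) (x : V -> 'rV[R]_4) o o' (t : seq V) :
  size t = 5%N -> aff_det x o t = aff_det x o' t.
Proof.
move=> t5; congr (\det _); apply/row_matrixP=> i; rewrite !rowK.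
by rewrite (set_nth_default o') // t5.
Qed.

Definition darea (R : realType) (V : finType) (L : {set V} -> R) (i : {set V})
    (d : {set V} -> R) : R := derive1 (fun t => area (along L d t) i) 0.

Definition ddihedral (R : realType) (V : finType) (L : {set V} -> R) (s i : {set V})
    (d : {set V} -> R) : R := derive1 (fun t => dihedral (along L d t) s i) 0.

Definition realizes (R : realType) (V : finType) (L : {set V} -> R)
    (x : V -> 'rV[R]_4) (s : {set V}) : Prop :=
  [/\ #|s| = 5%N, realized L x s & forall o, aff_det x o (enum s) != 0].

Section Simplex.
Context {R : realType} {V : finType} {L : {set V} -> R} {x : V -> 'rV[R]_4} {s : {set V}}.
Hypothesis Hs : realizes L x s.

Lemma simplex_frame : exists n, frame x s n.
Proof.
have [s5 _ d0] := Hs.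
have [z0 so] : exists v, v \in s by apply/set0Pn; rewrite -card_gt0 s5.
have s5' : size (enum s) = 5%N by rewrite -cardE.
have [n] := frame_exists (enum_uniq s) s5' (d0 z0).
have -> : [set u in enum s] = s by apply/setP=> u; rewrite inE mem_enum.
by exists n.
Qed.

Lemma face_setup i : i \in ksubsets 3 s -> exists a b c p q,
  [/\ enum i = [:: a; b; c], enum (s :\: i) = [:: p; q], uniq [:: a; b; c; p; q]
    & s = [set v in [:: a; b; c; p; q]]].
Proof.
have [s5 _ _] := Hs.
rewrite inE => /andP[iS /eqP i3]; have [a [b [c Ei]]] := enum3P i3.
have : #|s :\: i| = 2%N by rewrite cardsD (setIidPr iS) s5 i3.
move=> /enum2P[p [q Es]]; exists a, b, c, p, q.
by have [? ?] := face_enum iS Ei Es.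
Qed.

Lemma aff_det_sq o t : uniq t -> s = [set v in t] ->
  aff_det x o t ^+ 2 = aff_det x o (enum s) ^+ 2.
Proof.
move=> Ut Et; have [s5 _ _] := Hs.
apply: aff_det_perm_eq; first by rewrite -cardE.
by apply: uniq_perm => // [|v]; rewrite ?enum_uniq // mem_enum Et inE.
Qed.

Lemma simplex_has_der i d : i \in ksubsets 3 s ->
  has_der (fun t => area (along L d t) i) (darea L i d) /\
  has_der (fun t => dihedral (along L d t) s i) (ddihedral L s i d).
Proof.
move=> iK; have [n Hf] := simplex_frame; have [s5 HL _] := Hs.
have [a [b [c [p [q [Ei Es Hu E]]]]]] := face_setup iK.
have H1 := has_der_area_dual (d := d) Hu E HL Hf Ei.
have H2 := has_der_dihedral_dual (d := d) Hu E HL Hf Ei Es.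
by split; [apply: (has_der_eq H1); rewrite -(has_der_val H1)
          |apply: (has_der_eq H2); rewrite -(has_der_val H2)].
Qed.

(** The area contains the root of the Gram determinant of the normals and the angle derivative its
    inverse, so their product is rational up to [k], which is 24 times the unsigned volume and thus
    common to all ten faces. The factor [k / 4] comes from the two halves in the formulas for the
    area and its derivative. *)
Lemma simplex_symmetry d d' :
  \sum_(i in ksubsets 3 s) darea L i d * ddihedral L s i d' =
  \sum_(i in ksubsets 3 s) darea L i d' * ddihedral L s i d.
Proof.
have [n Hf] := simplex_frame; have [s5 HL d0] := Hs; have [n0 _ _] := Hf.
have [z0 so] : exists v, v \in s by apply/set0Pn; rewrite -card_gt0 s5.
pose w u v := dot (n u) (n v).
pose om e u v := dform n s e (n u) (n v).
pose T e := @dtrace _ _ e n s.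
pose k := Num.sqrt (aff_det x z0 (enum s) ^+ 2).
apply/eqP; rewrite -subr_eq0 -sumrB.
set G := \sum_(i in _) _.
have wC u v : w u v = w v u by rewrite /w dotC.
have omC e u v : om e u v = om e v u by rewrite /om dformC.
have w0 u : \sum_(v in s) w u v = 0.
  by rewrite /w; under eq_bigr do rewrite dotC; rewrite -dot_suml n0 dot0l.
have om0 e u : \sum_(v in s) om e u v = 0.
  by rewrite /om; under eq_bigr do rewrite dformC; rewrite -dform_suml n0 dform0l.
pose f p q := (T d - dlogplane w (om d) p q) * dangle_num w (om d') p q -
     (T d' - dlogplane w (om d') p q) * dangle_num w (om d) p q.
have fC p q : f p q = f q p.
  have PC e : dlogplane w (om e) p q = dlogplane w (om e) q p.
    rewrite /dlogplane (wC q p) (omC e q p) [in RHS](addrC (w p p * _)).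
    by rewrite [in RHS](mulrC (w q q) (w p p)).
  have AC e : dangle_num w (om e) p q = dangle_num w (om e) q p.
    by rewrite /dangle_num (wC q p) (omC e q p) [in RHS](addrC (_ / w q q)).
  by rewrite /f !PC !AC.
have main i p q : enum (s :\: i) = [:: p; q] -> i \in ksubsets 3 s ->
    [/\ p \in s, q \in s, 0 < w p p * w q q - w p q ^+ 2
    & - (k / 4) * f p q =
    darea L i d * ddihedral L s i d' - darea L i d' * ddihedral L s i d].
  move=> Es iK; have [a [b [c [p' [q' [Ei Es' Hu E]]]]]] := face_setup iK.
  move: Es'; rewrite Es => -[? ?]; subst p' q'.
  have D0 := dual_gram_gt0 Hu E Hf.
  split=> //; try by rewrite E !inE eqxx !orbT.
  have wd : (w p p != 0) && (w q q != 0).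
    apply: contraTT D0; rewrite negb_and !negbK -mulf_eq0 => /eqP w0'.
    by rewrite -/(w p p) -/(w q q) w0' sub0r oppr_gt0 -leNgt sqr_ge0.
  have H1 e := has_der_val (has_der_area_dual (d := e) Hu E HL Hf Ei).
  have H2 e := has_der_val (has_der_dihedral_dual (d := e) Hu E HL Hf Ei Es).
  rewrite /darea /ddihedral !H1 !H2 (area_dual Hu E HL Hf Ei).
  rewrite (aff_det_default x a z0) // (aff_det_sq z0 Hu E) -/k.
  have : Num.sqrt (w p p * w q q - w p q ^+ 2) != 0 by rewrite gt_eqF // sqrtr_gt0.
  rewrite /f /dlogplane /dangle_num -/(T d) -/(T d').
  rewrite -!/(w _ _) -!/(om _ _ _).
  have Dn : w p p * w q q - w p q ^+ 2 != 0 by rewrite gt_eqF.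
  case/andP: wd => wp wq.
  by move: (Num.sqrt (w p p * _ - _)) => r r0; field; rewrite r0 Dn wp wq.
have mainS i p q : i \in ksubsets 3 s -> s :\: i = [set p; q] -> p != q ->
    [/\ p \in s, q \in s, 0 < w p p * w q q - w p q ^+ 2
    & - (k / 4) * f p q =
    darea L i d * ddihedral L s i d' - darea L i d' * ddihedral L s i d].
  move=> iK Es pq; have : #|s :\: i| = 2%N by rewrite Es cards2 pq.
  move=> /enum2P[p' [q' Es']]; have [sp sq D0 fE] := main i p' q' Es' iK.
  have mE v : (v \in [set p; q]) = (v == p') || (v == q').
    by rewrite -Es -mem_enum Es' !inE.
  have := mE p; have := mE q; rewrite !inE !eqxx orbT /=.
  move=> /esym/orP[]/eqP Eq /esym/orP[]/eqP Ep; rewrite Ep Eq ?eqxx // in pq *.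
  by rewrite fC (wC q') mulrC.
have Dgt0 p q : p \in s -> q \in s -> p != q -> 0 < w p p * w q q - w p q ^+ 2.
  move=> sp sq pq; have sub : [set p; q] \subset s by rewrite subUset !sub1set sp sq.
  have [||//] := mainS (s :\: [set p; q]) p q _ _ pq.
    by rewrite inE subsetDl cardsD (setIidPr sub) s5 cards2 pq.
  by rewrite setDDr setDv set0U; apply/setIidPr.
have wn p : p \in s -> w p p != 0.
  move=> sp; have [q] : exists q, q \in s :\ p.
    by apply/set0Pn; rewrite -card_gt0; move: s5; rewrite (cardsD1 p) sp add1n => -[->].
  rewrite !inE => /andP[qp sq]; have := Dgt0 p q sp sq; rewrite eq_sym => /(_ qp).
  by apply: contraTneq => ->; rewrite mul0r sub0r oppr_gt0 ltNge sqr_ge0.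
have Dn p q : p \in s -> q \in s -> p != q -> w p p * w q q - w p q ^+ 2 != 0.
  by move=> sp sq pq; rewrite gt_eqF // Dgt0.
have fg i p q (iK : i \in ksubsets 3 s) (Es : s :\: i = [set p; q]) (pq : p != q) :
  - (k / 4) * f p q = darea L i d * ddihedral L s i d' - darea L i d' * ddihedral L s i d.
  by have [] := mainS i p q iK Es pq.
have := sum_faces_pairs s5 fg.
under eq_bigr do rewrite -mulr_sumr.
rewrite -mulr_sumr schlafli_symmetry // mulr0.
by move/esym/eqP; rewrite mulrn_eq0.
Qed.
End Simplex.

Definition unit_dir (R : realType) (V : finType) (a : {set V}) : {set V} -> R :=
  fun e => (e == a)%:R.

Lemma dS_dLE (R : realType) (V : finType) (L : {set V} -> R) i a :
  dS_dL L i a = darea L i (unit_dir R a).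
Proof. exact: dlenE. Qed.

Lemma dlen_dihedral (R : realType) (V : finType) (L : {set V} -> R) s i a :
  dlen (fun L' => dihedral L' s i) L a = ddihedral L s i (unit_dir R a).
Proof. exact: dlenE. Qed.

Lemma card_ksubsets (V : finType) k (s : {set V}) : #|ksubsets k s| = 'C(#|s|, k).
Proof.
rewrite -cards_draws; apply: eq_card => t.
by rewrite !inE.
Qed.

Lemma darea_notin (R : realType) (V : finType) (L : {set V} -> R) i a :
  a \notin ksubsets 2 i -> darea L i (unit_dir R a) = 0.
Proof.
move=> ai; rewrite /darea (_ : (fun t => _) = fun=> area L i).
  exact: (has_der_val (is_derive_cst _ _ _)).
apply/funext=> t; apply: area_local => e ei; rewrite /along /unit_dir.
by have [E|_] := eqVneq e a; [rewrite -E ei in ai|rewrite mulr0 addr0].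
Qed.

Lemma ddihedral_notin (R : realType) (V : finType) (L : {set V} -> R) (s i a : {set V}) :
  i \subset s -> a \notin ksubsets 2 s -> ddihedral L s i (unit_dir R a) = 0.
Proof.
move=> iS ai; rewrite /ddihedral (_ : (fun t => _) = fun=> dihedral L s i).
  exact: (has_der_val (is_derive_cst _ _ _)).
apply/funext=> t; apply: dihedral_local => // e ei; rewrite /along /unit_dir.
by have [E|_] := eqVneq e a; [rewrite -E ei in ai|rewrite mulr0 addr0].
Qed.

Lemma sum_enum_nth (M : nmodType) (T : finType) (A : {set T}) (x0 : T) (n : nat) (F : T -> M) :
  #|A| = n -> \sum_(a in A) F a = \sum_(k < n) F (nth x0 (enum A) k).
Proof. by move=> An; rewrite -big_enum (big_nth x0) -cardE An big_mkord. Qed.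

(** With [J] and [Th] the Jacobians of areas and angles, [simplex_symmetry] says that [J^T Th] is
    symmetric; multiplying by the inverse of [J] on the right gives [J^T Th J^-1 = Th^T]. For an
    edge outside [s] both sides vanish. *)
Lemma ddihedral_dS_dual (R : realType) (V : finType) (L : {set V} -> R)
    (x : V -> 'rV[R]_4) (s i a : {set V}) :
  realizes L x s -> area_jacobian L s \in unitmx -> i \in ksubsets 3 s ->
  \sum_(j in ksubsets 3 s) dS_dL L j a * ddihedral_dS L s j i =
  ddihedral L s i (unit_dir R a).
Proof.
move=> Hs uJ iK; have [s5 _ _] := Hs.
have [aK|aK] := boolP (a \in ksubsets 2 s); last first.
  rewrite ddihedral_notin //; last by move: iK; rewrite inE => /andP[].
  apply: big1 => j jK; rewrite dS_dLE darea_notin ?mul0r //.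
  apply: contra aK; apply/subsetP/ksubsetsS.
  by move: jK; rewrite inE => /andP[].
have c3 : #|ksubsets 3 s| = 10%N by rewrite card_ksubsets s5.
have c2 : #|ksubsets 2 s| = 10%N by rewrite card_ksubsets s5.
pose face (k : 'I_10) := nth finset.set0 (enum (ksubsets 3 s)) k.
pose edge (k : 'I_10) := nth finset.set0 (enum (ksubsets 2 s)) k.
have faceK k : face k \in ksubsets 3 s by rewrite -mem_enum mem_nth // -cardE c3.
pose J := area_jacobian L s.
pose Th : 'M[R]_10 := \matrix_(k, l) ddihedral L s (face k) (unit_dir R (edge l)).
have JE k l : J k l = darea L (face k) (unit_dir R (edge l)) by rewrite mxE dS_dLE.
have sym : J^T *m Th = Th^T *m J.
  apply/matrixP=> l l'; rewrite !mxE.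
  transitivity (\sum_(j in ksubsets 3 s)
      darea L j (unit_dir R (edge l)) * ddihedral L s j (unit_dir R (edge l'))).
    rewrite (sum_enum_nth finset.set0 _ c3); apply: eq_bigr => k _.
    by rewrite !mxE -/(face k) -/(edge _) dS_dLE.
  rewrite (simplex_symmetry Hs) (sum_enum_nth finset.set0 _ c3); apply: eq_bigr => k _.
  by rewrite !mxE -/(face k) -/(edge _) dS_dLE mulrC.
have idx2 : (index a (enum (ksubsets 2 s)) < 10)%N by rewrite -c2 cardE index_mem mem_enum.
have idx3 : (index i (enum (ksubsets 3 s)) < 10)%N by rewrite -c3 cardE index_mem mem_enum.
pose la : 'I_10 := inord (index a (enum (ksubsets 2 s))).
pose ki : 'I_10 := inord (index i (enum (ksubsets 3 s))).
have edge_la : edge la = a by rewrite /edge inordK // nth_index // mem_enum.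
have face_ki : face ki = i by rewrite /face inordK // nth_index // mem_enum.
transitivity ((J^T *m (Th *m invmx J)) la ki); last first.
  by rewrite mulmxA sym mulmxK // !mxE face_ki edge_la.
rewrite [RHS]mxE (sum_enum_nth finset.set0 _ c3); apply: eq_bigr => k _.
rewrite -/(face k) [J^T _ _]mxE JE edge_la dS_dLE; congr (_ * _).
rewrite /ddihedral_dS -/J -/ki mxE [RHS]mxE; apply: eq_bigr => l _.
by rewrite !mxE -/(edge l) dlen_dihedral.
Qed.

(** * Lifts to the universal cover *)

(** The path runs back to [b] and forth again. Its innermost part contracts by induction, and the
    last step is undone by a degenerate triangle followed by a stutter. *)
Lemma homotopic_backtrack (V : finType) (K : {set {set V}}) (b : V) (q r t : seq V) :
  path (edge_rel K) b q ->
  homotopic K (r ++ rev (b :: q) ++ q ++ t) (r ++ last b q :: t).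
Proof.
elim/last_ind: q r t => [|q w IHq] r t; first by move=> _; exact: homotopic_refl.
rewrite rcons_path => /andP[pq qw].
have -> : r ++ rev (b :: rcons q w) ++ rcons q w ++ t =
    (r ++ [:: w]) ++ rev (b :: q) ++ q ++ (w :: t).
  by rewrite -rcons_cons rev_rcons cat_rcons -!catA.
apply: (homotopic_trans (IHq _ _ pq)); rewrite -catA last_rcons /=.
apply: homotopic_trans (homotopic_stutter _ _ _ _).
apply: homotopic_triangle.
by rewrite setUAC setUid setUC.
Qed.

Section Lifts.
Context {R : realType} {V : finType} {K : {set {set V}}} {b : V}.
Context {phi : seq V -> 'rV[R]_4 -> 'rV[R]_4} {f : seq V -> 'rV[R]_4}.
Hypotheses (cK : is_complex K) (bK : [set b] \in K).
Hypotheses (Hphi : pi1_hom K b phi) (Hf : equivariant_map K b phi f).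

Lemma edge_of_triple u v w : [set u; v; w] \in K ->
  [/\ edge_rel K u v, edge_rel K v w & edge_rel K u w].
Proof.
have [_ Kd] := cK => H.
have n0 (y z : V) : [set y; z] != set0 by apply/set0Pn; exists y; rewrite !inE eqxx.
by split; apply: (Kd _ _ H) => //; apply/subsetP=> z; rewrite !inE => /orP[]->; rewrite ?orbT.
Qed.

(** The two lifts differ by the deck transformation of the loop that follows [p], passes through
    [u0] and returns along [p']. The triangles at [u0] provide the homotopies for the other vertices
    of [X]. *)
Lemma lifts_congruent (p p' : seq V) (u0 : V) (X : {set V}) :
  epath K b p -> epath K b p' ->
  (forall u, u \in X -> [set last b p; u0; u] \in K /\ [set last b p'; u0; u] \in K) ->
  u0 \in X ->
  exists m, motion m /\ forall u, u \in X -> f (rcons p u) = m (f (rcons p' u)).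
Proof.
move=> pp pp' HX u0X; have [f_hom f_eq] := Hf; have [mot _ _] := Hphi.
pose g := rcons p u0 ++ rev (b :: p').
have [[e1 _ _] [e1' _ _]] := (edge_of_triple (HX _ u0X).1, edge_of_triple (HX _ u0X).2).
have esym y z : edge_rel K y z = edge_rel K z y by rewrite /edge_rel setUC.
have gl : eloop K b g.
  split; last by rewrite last_cat last_rcons rev_cons last_rcons.
  rewrite /epath cat_path rcons_path last_rcons -/(epath K b p) pp e1 /=.
  have := rev_path (edge_rel K) b (rcons p' u0); rewrite last_rcons belast_rcons.
  rewrite (eq_path (e' := edge_rel K)) => [->|y z]; last by rewrite esym.
  by rewrite rcons_path -/(epath K b p') pp' e1'.
exists (phi g); split=> [|u uX]; first exact: mot.
have [[h1 h2 h3] [h1' h2' h3']] := (edge_of_triple (HX _ uX).1, edge_of_triple (HX _ uX).2).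
have pu' : epath K b (rcons p' u) by rewrite /epath rcons_path -/(epath K b p') pp' h3'.
rewrite -(f_eq _ _ gl pu'); apply: f_hom.
- by rewrite /epath rcons_path -/(epath K b p) pp h3.
- by case: gl => gp gb; rewrite /epath cat_path gb -/(epath K b g) gp pu'.
apply: homotopic_sym; rewrite /g -cats1 -cats1.
have -> : b :: ((p ++ [:: u0]) ++ rev (b :: p')) ++ p' ++ [:: u] =
    (b :: p ++ [:: u0]) ++ rev (b :: p') ++ p' ++ [:: u] by rewrite /= -!catA.
apply: (homotopic_trans (homotopic_backtrack _ _ pp')).
have -> : (b :: p ++ [:: u0]) ++ last b p' :: [:: u] = (b :: p) ++ [:: u0; last b p'; u].
  by rewrite -cat_cons -catA.
apply: (homotopic_trans (q := (b :: p) ++ [:: u0; u])).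
  by apply: homotopic_triangle; have := (HX _ uX).2; rewrite (setUC [set _] [set u0]).
have E : b :: p = belast b p ++ [:: last b p] by rewrite cats1 -lastI.
rewrite -(cats1 p u) -[X in homotopic _ _ X]/((b :: p) ++ [:: u]) E -!catA.
by apply: homotopic_triangle; exact: (HX _ uX).1.
Qed.

Lemma path_to_vertex (s : {set V}) v : connected_complex K -> v \in s -> [set v] \in K ->
  epath K b (path_to K b s) /\ last b (path_to K b s) \in s.
Proof.
move=> conn vs vK; have /connectP[p pp Ev] := conn b v bK vK.
have H : exists q, [set p0 | epath K b p0 /\ last b p0 \in s]%classic q.
  by exists p; rewrite /= -Ev.
exact: (xgetPex [::] H).
Qed.

Lemma path_toP (s : {set V}) : connected_complex K -> s \in K ->
  epath K b (path_to K b s) /\ last b (path_to K b s) \in s.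
Proof.
move=> conn sK; have [K0 Kd] := cK.
have [v vs] : exists v, v \in s.
  by apply/set0Pn; apply: contraNneq K0 => <-.
apply: (path_to_vertex conn vs); apply: (Kd _ _ sK); first by rewrite sub1set.
by apply/set0Pn; exists v; rewrite inE.
Qed.

Lemma motion_dist (m : 'rV[R]_4 -> 'rV[R]_4) : motion m ->
  forall y z, dot (m y - m z) (m y - m z) = dot (y - z) (y - z).
Proof.
move=> [Q [t [QQ _ mE]]] y z.
have -> : m y - m z = (y - z) *m Q.
  by rewrite !mE mulmxBl opprD addrACA subrr addr0.
by rewrite /dot trmx_mul mulmxA -(mulmxA _ Q) QQ mulmx1.
Qed.

Lemma len2_lift (p : seq V) (u v : V) : connected_complex K ->
  epath K b p -> u != v -> [set last b p; u; v] \in K ->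
  len2 K b f [set u; v] =
    dot (f (rcons p u) - f (rcons p v)) (f (rcons p u) - f (rcons p v)).
Proof.
move=> conn pp uv H; have [_ uvE _] := edge_of_triple H.
have [qq lq] := path_toP conn uvE.
set q := path_to K b [set u; v] in qq lq.
have uX : u \in [set u; v] by rewrite !inE eqxx.
have [|m [mot Hm]] := lifts_congruent (u0 := u) (X := [set u; v]) qq pp _ uX.
  move=> z; rewrite !inE => /orP[]/eqP-> {z}; rewrite -?setUA ?setUid.
    split; last by have [] := edge_of_triple H.
    move: lq; rewrite !inE => /orP[]/eqP->; first by rewrite setUid; apply: (cK.2 _ _ uvE);
      [rewrite sub1set !inE eqxx|apply/set0Pn; exists u; rewrite inE].
    by rewrite setUC.
  split; last by rewrite setUA.
  by move: lq; rewrite !inE => /orP[]/eqP->; rewrite ?setUA ?setUid // (setUC [set v]) -setUA setUid.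
have vi z : z \in [set u; v] -> vertex_image K b f [set u; v] z = m (f (rcons p z)).
  by move=> zX; rewrite /vertex_image Hm.
have : perm_eq (enum [set u; v]) [:: u; v].
  by apply: uniq_perm; rewrite ?enum_uniq //= ?inE ?uv // => z; rewrite mem_enum !inE.
have c2 : #|[set u; v]| = 2%N by rewrite cards2 uv.
have [y [z E]] := enum2P c2; rewrite /len2 E => Hp.
have yX : y \in [set u; v] by rewrite -mem_enum E inE eqxx.
have zX : z \in [set u; v] by rewrite -mem_enum E !inE eqxx orbT.
rewrite !vi // motion_dist //.
have yz : y != z by have := enum_uniq [set u; v]; rewrite E /= inE andbT.
move: yX zX; rewrite !inE => /orP[]/eqP Ey /orP[]/eqP Ez; rewrite Ey Ez ?eqxx // in yz *.
by rewrite -[_ - f (rcons p u)]opprB /dot mulNmx linearN mulmxN opprK.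
Qed.

End Lifts.

Lemma motion_aff_det (R : realType) (V : finType) (m : 'rV[R]_4 -> 'rV[R]_4)
    (x y : V -> 'rV[R]_4) (o a : V) (t : seq V) :
  motion m -> size t = 4%N -> (forall v, v \in a :: t -> y v = m (x v)) ->
  aff_det y o (a :: t) = aff_det x o (a :: t).
Proof.
move=> [Q [c [_ Q1 mE]]] t4 yE; rewrite !aff_det_diff.
rewrite -[RHS]mulr1 -Q1 -det_mulmx; congr (\det _); apply/row_matrixP=> i.
rewrite row_mul !rowK !yE ?mem_head // ?inE ?mem_nth ?t4 ?orbT // !mE.
by rewrite mulmxBl opprD addrACA subrr addr0.
Qed.

(** A reordering changes [orn] and the determinant by the same sign, and a motion has determinant 1;
    so any ordering and any congruent copy of the vertices may be used. *)
Lemma ovolE (R : realType) (V : finType) (K : {set {set V}}) (b : V)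
    (orn : seq V -> bool) (f : seq V -> 'rV[R]_4) (x : V -> 'rV[R]_4) (m : 'rV[R]_4 -> 'rV[R]_4)
    (o : V) (t : seq V) (s : {set V}) :
  orientation K orn -> motion m -> s \in K ->
  (forall v, v \in s -> vertex_image K b f s v = m (x v)) ->
  uniq t -> size t = 5%N -> s = [set v in t] ->
  ovol K b orn f s = (-1) ^+ (~~ orn t) * aff_det x o t / 24%:R.
Proof.
move=> [Horn _] mot sK vi Ut t5 Es.
have pt : perm_eq (enum s) t.
  by apply: uniq_perm; rewrite ?enum_uniq // => v; rewrite mem_enum Es inE.
have e5 : size (enum s) = 5%N by rewrite (perm_size pt).
have /eqP t5' := t5.
have [p Ep] := @tuple_permP _ 5 (enum s) (Tuple t5') pt.
have oE : orn (enum s) = orn t (+) odd_perm p.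
  rewrite Ep; apply: (Horn (Tuple t5') p) => //.
  by have -> : [set v in Tuple t5'] = s by rewrite Es; apply/setP=> v; rewrite !inE.
have -> : ovol K b orn f s = (-1) ^+ (~~ orn (enum s)) * aff_det x o (enum s) / 24%:R.
  rewrite /ovol; case E: (enum s) => [|a r]; first by rewrite E in e5.
  have mE v : v \in a :: r -> vertex_image K b f s v = m (x v).
    by rewrite -E mem_enum; apply: vi.
  rewrite (aff_det_default _ o a) -?E // E.
  rewrite -(motion_aff_det _ mot _ mE); last by rewrite E in e5; case: e5.
  by rewrite aff_det_diff.
have -> : aff_det x o (enum s) = (-1) ^+ p * aff_det x o t.
  rewrite -aff_det_perm Ep; congr (aff_det x o _).
  by apply: eq_map => i; rewrite (tnth_nth o).
by rewrite mulrA -signr_addb oE; congr ((-1) ^+ _ * _ / _); case: (orn t); case: (odd_perm p).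
Qed.

(** * Deficit angles of the whole complex *)

Lemma has_der_sum (R : realType) (I : Type) (r : seq I) (P : pred I) (g : I -> R -> R) (v : I -> R) :
  (forall i, P i -> has_der (g i) (v i)) ->
  has_der (fun t => \sum_(i <- r | P i) g i t) (\sum_(i <- r | P i) v i).
Proof.
move=> H; elim: r => [|i r IHr].
  rewrite big_nil (_ : (fun t => _) = fun=> 0); first exact: is_derive_cst.
  by apply/funext=> t; rewrite big_nil.
rewrite big_cons; case: ifP => Pi; last first.
  by rewrite (_ : (fun t => _) = fun t => \sum_(j <- r | P j) g j t) //;
     apply/funext=> t; rewrite big_cons Pi.
rewrite (_ : (fun t => _) = fun t => g i t + \sum_(j <- r | P j) g j t).
  by apply: has_derD => //; apply: H.
by apply/funext=> t; rewrite big_cons Pi.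
Qed.

Lemma simplexP (V : finType) (K : {set {set V}}) s :
  is_complex K -> s \in simplices4 K -> [/\ s \in K, #|s| = 5%N &
    forall j, (j \in faces K) && (j \subset s) = (j \in ksubsets 3 s)].
Proof.
move=> [_ Kd]; rewrite inE => /andP[sK /eqP s5]; split=> // j.
rewrite !inE -andbA andbC -andbA.
apply/and3P/andP => [[j3 jK js]|[js j3]]; split=> //.
by apply: (Kd _ _ sK) => //; rewrite -card_gt0 (eqP j3).
Qed.

Section Global.
Context {R : realType} {V : finType} {K : {set {set V}}} {vol L : {set V} -> R}.
Hypothesis cK : is_complex K.
Hypothesis real : forall s, s \in simplices4 K -> exists x, realizes L x s.

Lemma domega_dLE i a : i \in faces K ->
  domega_dL K vol L i a =
  - \sum_(s in simplices4 K | i \subset s) Num.sg (vol s) * ddihedral L s i (unit_dir R a).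
Proof.
move=> iF; rewrite /domega_dL dlenE /omega; apply: has_der_val.
apply: (has_der_eq (a := 0 - \sum_(s in simplices4 K | i \subset s) Num.sg (vol s) * ddihedral L s i (unit_dir R a))); last exact: sub0r.
rewrite (_ : (fun t => _) = fun t => 0 - \sum_(s in simplices4 K | i \subset s)
    Num.sg (vol s) * dihedral (along L (unit_dir R a) t) s i); last first.
  by apply/funext=> t; rewrite sub0r.
apply: has_derB; first exact: is_derive_cst.
apply: has_der_sum => s /andP[sK iS]; have [x Hx] := real sK.
have [_ _ fE] := simplexP cK sK.
have iK : i \in ksubsets 3 s by rewrite -fE iF.
have [_ dd] := simplex_has_der Hx (unit_dir R a) iK.
have c0 : has_der (fun=> Num.sg (vol s)) 0 by exact: is_derive_cst.
by apply: (has_der_eq (has_derM c0 dd)); rewrite mul0r add0r.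
Qed.

(** Exchanging the sums over faces and over 4-simplices reduces the claim to [ddihedral_dS_dual] in
    each 4-simplex, where the sign is a common factor. *)
Lemma dOmega_dSE i a : regular_areas K L -> i \in faces K ->
  dOmega_dS K vol L a i = domega_dL K vol L i a.
Proof.
move=> reg iF; rewrite domega_dLE // /dOmega_dS /domega_dS.
under eq_bigr do rewrite mulrN mulr_sumr.
rewrite sumrN; congr (- _).
rewrite (exchange_big_dep (fun s => (s \in simplices4 K) && (i \subset s))) /=; last first.
  by move=> j s _ /andP[-> /andP[_ ->]].
apply: eq_bigr => s /andP[sK iS]; have [x Hx] := real sK.
have [_ _ fE] := simplexP cK sK.
have iK : i \in ksubsets 3 s by rewrite -fE iF.
rewrite -(ddihedral_dS_dual a Hx (reg s sK) iK) mulr_sumr.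
apply: eq_big => [j|j _]; last by rewrite mulrCA.
by rewrite sK iS andbT /= fE.
Qed.

End Global.

(** * Exterior products and the choice of rows and columns *)

Lemma wedge_coord (R : realType) (V : finType) (A : {set {set V}}) m
    (u : nat -> {set V} -> R) : #|A| = m ->
  wedge (coord_forms R A) u = \det (\matrix_(j < m, k < m) u k (nth finset.set0 (enum A) j)).
Proof.
move=> Am; rewrite /wedge.
have sm : size (coord_forms R A) = m by rewrite size_map -cardE.
case: _ / (esym sm); congr (\det _); apply/matrixP=> j k; rewrite !mxE.
by rewrite (nth_map finset.set0) // -cardE (leq_trans (ltn_ord j)) // Am.
Qed.

(** Exterior products of coordinates are minors of the matrix of the vectors [u k], complementary to
    those of [X]. The sign depends on the enumerations only, hence is fixed before [X] and [u]. *)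
Lemma wedge_ratio (R : realType) (V : finType) (F D D' : {set {set V}}) (r : nat) :
  D \subset F -> D' \subset F -> #|D| = r -> #|D'| = r ->
  exists eps : bool, forall (X : {set V} -> 'I_r -> R) (u : nat -> {set V} -> R),
    (forall k l, \sum_(x in F) u k x * X x l = 0) ->
    \det (\matrix_(i < r, j < r) X (nth finset.set0 (enum D) i) j) *
      wedge (coord_forms R (F :\: D')) u =
    (-1) ^+ eps * (\det (\matrix_(i < r, j < r) X (nth finset.set0 (enum D') i) j) *
      wedge (coord_forms R (F :\: D)) u).
Proof.
move=> DF DF' Dr Dr'; pose m := (#|F| - r)%N.
have Dm : #|F :\: D| = m by rewrite cardsD (setIidPr DF) Dr.
have Dm' : #|F :\: D'| = m by rewrite cardsD (setIidPr DF') Dr'.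
have pF (A : {set {set V}}) : A \subset F -> perm_eq (enum A ++ enum (F :\: A)) (enum F).
  move=> AF; apply: uniq_perm => [||x]; rewrite ?enum_uniq //.
    rewrite cat_uniq !enum_uniq andbT /=; apply/hasPn=> v.
    by rewrite !mem_enum inE => /andP[].
  rewrite mem_cat !mem_enum inE; have := subsetP AF x.
  by case: (x \in A) => // ->.
have pe : perm_eq (enum D ++ enum (F :\: D)) (enum D' ++ enum (F :\: D')).
  by rewrite (perm_trans (pF _ DF)) // perm_sym pF.
have [eps H] := @complementary_minors R _ finset.set0 r m (enum D) (enum (F :\: D)) (enum D')
  (enum (F :\: D')) (etrans (esym (cardE _)) Dr) (etrans (esym (cardE _)) Dm)
  (etrans (esym (cardE _)) Dr') (etrans (esym (cardE _)) Dm') pe.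
exists eps => X u uX; rewrite !(wedge_coord _ Dm) !(wedge_coord _ Dm').
apply: (H X (fun k => u k)) => k l; rewrite -[RHS](uX k l) -[in RHS]big_enum.
exact: perm_big (pF _ DF).
Qed.

Lemma square_minorE (R : realType) (V : finType) (K : {set {set V}}) (vol L : {set V} -> R)
    (C D : {set {set V}}) r : #|C| = r ->
  square_minor K vol L C D =
  minor finset.set0 finset.set0 r (domega_dL K vol L) (enum D) (enum C).
Proof. by move=> <-. Qed.

(* A row (column) of the large minor can be repeated, in which case it vanishes anyway. *)
Lemma larger_minor_eq0 (R : realType) (V : finType) (K : {set {set V}}) (vol L : {set V} -> R)
    (C D : {set {set V}}) i a :
  largest_minor K vol L C D -> i \in faces K -> a \in edges K ->
  minor finset.set0 finset.set0 #|C|.+1 (domega_dL K vol L) (i :: enum D) (a :: enum C) = 0.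
Proof.
move=> [[CE DF CD nz] lrg] iF aE.
have dup (T T' : eqType) (x0 : T) (y0 : T') (A : T -> T' -> R) (d : seq T) c j n :
    size d = n -> j \in d -> minor x0 y0 n.+1 A (j :: d) c = 0.
  move=> dn jd; have ji : (index j d < n)%N by rewrite -dn index_mem.
  apply: (determinant_alternate (i1 := ord0) (i2 := lift ord0 (Ordinal ji))) => // k.
  by rewrite !mxE /= nth_index.
have [iD|iD] := boolP (i \in D).
  by apply: dup; rewrite -?cardE // mem_enum.
have [aC|aC] := boolP (a \in C).
  by rewrite minor_tr; apply: dup; rewrite -?cardE // mem_enum.
apply/eqP/negPn/negP=> nz'.
have Ca : #|a |: C| = #|C|.+1 by rewrite cardsU1 aC.
have Di : #|i |: D| = #|C|.+1 by rewrite cardsU1 iD CD.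
have pC (z : {set V}) (Z : {set {set V}}) : z \notin Z -> perm_eq (z :: enum Z) (enum (z |: Z)).
  move=> zZ; apply: uniq_perm; rewrite ?enum_uniq //= ?mem_enum ?zZ ?enum_uniq // => v.
  by rewrite inE !mem_enum !inE.
have [eps E] := @minor_perm R _ _ finset.set0 finset.set0 #|C|.+1 _ _ _ _
  (etrans (esym (cardE _)) Di) (etrans (esym (cardE _)) Ca) (pC _ _ iD) (pC _ _ aC).
suff /lrg : nonzero_minor K vol L (a |: C) (i |: D) by rewrite Ca ltnn.
split.
- by rewrite subUset sub1set aE CE.
- by rewrite subUset sub1set iF DF.
- by rewrite Ca Di.
by move: nz'; rewrite E mulf_eq0 negb_or (square_minorE _ _ _ _ Ca) => /andP[].
Qed.

Lemma value_ratio (F : fieldType) (e1 e2 : bool) (P W dX dY dX' dY' wu wu' ww ww' : F) :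
  dX != 0 -> dY != 0 -> dX' != 0 -> dY' != 0 ->
  dX * wu' = (-1) ^+ e1 * (dX' * wu) -> dY * ww' = (-1) ^+ e2 * (dY' * ww) ->
  P / (dX * dY * W) * wu * ww =
  (-1) ^+ (e1 (+) e2) * (P / (dX' * dY' * W) * wu' * ww').
Proof.
move=> nX nY nX' nY' Eu Ew.
have -> : wu' = (-1) ^+ e1 * (dX' * wu) / dX by rewrite -Eu mulrC mulKf.
have -> : ww' = (-1) ^+ e2 * (dY' * ww) / dY by rewrite -Ew mulrC mulKf.
have sq (e : bool) : (-1) ^+ e * (-1) ^+ e = 1 :> F by rewrite -signr_addb addbb.
rewrite signr_addb !invfM.
transitivity (((-1) ^+ e1 * (-1) ^+ e1) * ((-1) ^+ e2 * (-1) ^+ e2) *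
   (P * (dX^-1 * dY^-1 * W^-1) * wu * ww)); first by rewrite !sq !mul1r.
move: ((-1) ^+ e1) ((-1) ^+ e2) (W^-1) => s1 s2 w.
by field; rewrite nX nY nX' nY'.
Qed.

Section Choice.
Context {R : realType} {V : finType} {K : {set {set V}}} {vol L : {set V} -> R}.

Lemma rank_factorization (C D : {set {set V}}) : largest_minor K vol L C D ->
  exists X : {set V} -> 'I_#|C| -> R, forall i a, i \in faces K -> a \in edges K ->
    domega_dL K vol L i a =
    \sum_k X i k * domega_dL K vol L (nth finset.set0 (enum D) k) a.
Proof.
move=> lCD; have [[_ _ _ nz] _] := lCD; rewrite (square_minorE _ _ _ _ erefl) in nz.
have [X HX] := minor_factor nz; exists X => i a iF aE; apply: HX.
exact: larger_minor_eq0.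
Qed.

Lemma mem_nth_enum (A F : {set {set V}}) k : A \subset F -> (k < #|A|)%N ->
  nth finset.set0 (enum A) k \in F.
Proof. by move=> AF kA; apply: (subsetP AF); rewrite -mem_enum mem_nth // -cardE. Qed.

(** A matrix of rank [r] factors as [X Y], so each of its minors of size [r] is a factor of [D]
    times a factor of [C]. The change of [D] is then absorbed by the area form and that of [C] by
    the length form, by two independent applications of [wedge_ratio]. *)
Lemma value_independent (C D C' D' : {set {set V}}) :
  (forall i a, i \in faces K -> dOmega_dS K vol L a i = domega_dL K vol L i a) ->
  largest_minor K vol L C D -> largest_minor K vol L C' D' ->
  exists eps : bool, forall u w : nat -> {set V} -> R,
    (forall k, area_deformations K vol L (u k)) ->
    (forall k, length_deformations K vol L (w k)) ->
    value K vol L C D u w = (-1) ^+ eps * value K vol L C' D' u w.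
Proof.
move=> dual lCD lCD'; have [[CE DF CD nz] lrg] := lCD; have [[CE' DF' CD' nz'] lrg'] := lCD'.
have CC : #|C'| = #|C|.
  by apply/eqP; rewrite eqn_leq (lrg C' D') ?(lrg' C D).
have [X HX] := rank_factorization lCD.
set r := #|C| in X HX CC CD; pose Y (k : 'I_r) a := domega_dL K vol L (nth finset.set0 (enum D) k) a.
have [e1 H1] := wedge_ratio R (r := r) DF DF' (esym CD) (etrans (esym CD') CC).
have [e2 H2] := wedge_ratio R (r := r) CE CE' erefl CC.
exists (e1 (+) e2) => u w Hu Hw.
pose dX (Z : {set {set V}}) := \det (\matrix_(i < r, j < r) X (nth finset.set0 (enum Z) i) j).
pose dY (Z : {set {set V}}) := \det (\matrix_(i < r, j < r) Y j (nth finset.set0 (enum Z) i)).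
have sqE (c d : {set {set V}}) : c \subset edges K -> d \subset faces K -> #|c| = r -> #|d| = r ->
    square_minor K vol L c d = dX d * dY c.
  move=> cE dF cr dr; rewrite (square_minorE _ _ _ _ cr).
  rewrite (minor_mul (X := X) (Y := fun k a => Y k a)); last first.
    by move=> i j; apply: HX; apply: mem_nth_enum; rewrite ?cr ?dr.
  rewrite /dY -[in RHS]det_tr; congr (_ * \det _).
  by apply/matrixP=> i j; rewrite mxE [RHS]mxE mxE.
have Ew : dY C * wedge (coord_forms R (edges K :\: C')) w =
    (-1) ^+ e2 * (dY C' * wedge (coord_forms R (edges K :\: C)) w).
  apply: (H2 (fun a k => Y k a)) => k l.
  have [_ /(_ (nth finset.set0 (enum D) l))] := Hw k.
  have lD : (l < #|D|)%N by rewrite -CD.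
  move=> /(_ (mem_nth_enum DF lD)) E; rewrite -[RHS]E.
  by apply: eq_bigr => a _; rewrite mulrC.
have Eu : dX D * wedge (coord_forms R (faces K :\: D')) u =
    (-1) ^+ e1 * (dX D' * wedge (coord_forms R (faces K :\: D)) u).
  apply: H1 => k l.
  (* Area deformations annihilate the product [X Y]. To conclude that they annihilate [X], it is
     enough to look at the columns in [C], where [Y] is the invertible matrix [M]. *)
  pose M : 'M[R]_r := \matrix_(i < r, j < r) Y i (nth finset.set0 (enum C) j).
  have uM : M \in unitmx.
    rewrite unitmxE unitfE; apply: contraNneq nz => M0.
    rewrite (sqE C D) // /dY -det_tr (_ : _^T = M) ?M0 ?mulr0 //.
    by apply/matrixP=> i j; rewrite mxE [LHS]mxE [RHS]mxE.
  pose z : 'rV[R]_r := \row_l' \sum_(x in faces K) u k x * X x l'.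
  suff z0 : z = 0 by have := congr1 (fun h : 'rV_r => h 0 l) z0; rewrite !mxE.
  apply: (can_inj (mulmxK uM)); rewrite mul0mx; apply/rowP=> j; rewrite !mxE.
  have jE := mem_nth_enum CE (ltn_ord j).
  have [_ /(_ _ jE) E] := Hu k.
  rewrite -[RHS]E; under eq_bigr do rewrite mxE mulr_suml.
  rewrite exchange_big /=; apply: eq_bigr => i iF.
  rewrite dual // HX // mulr_suml; apply: eq_bigr => l' _.
  by rewrite mxE /Y; ring.
have sq := sqE C D CE DF erefl (esym CD).
have sq' := sqE C' D' CE' DF' CC (etrans (esym CD') CC).
rewrite /value /coefficient sq sq'.
have [dXn dYn] : dX D != 0 /\ dY C != 0.
  by apply/andP; rewrite -negb_or -mulf_eq0 -sq.
have [dXn' dYn'] : dX D' != 0 /\ dY C' != 0.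
  by apply/andP; rewrite -negb_or -mulf_eq0 -sq'.
exact: (value_ratio _ _ dXn dYn dXn' dYn' Eu Ew).
Qed.
End Choice.

(** * Six points in four dimensions *)

(** The numbers [P] and [g] are the Gram entries of three vectors of a plane with combination of
    weights [au], [av], [aw] equal to zero. As in the law of cosines, the mixed products follow from
    the squares; substituting them turns the sum of angle derivatives into the varied form at that
    combination. *)
Lemma angle_sum_identity (R : realFieldType) (S au av aw Pu Pv Pw guv guw gvw
    euu evv eww euv euw evw : R) :
  au != 0 -> av != 0 -> aw != 0 -> Pu != 0 -> Pv != 0 -> Pw != 0 ->
  av * guv + aw * guw = - (au * Pu) -> au * guv + aw * gvw = - (av * Pv) ->
  au * guw + av * gvw = - (aw * Pw) ->
  - (evw - gvw / 2 * (evv / Pv + eww / Pw)) * (S / (12 * au)) +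
  - (euw - guw / 2 * (euu / Pu + eww / Pw)) * (S / (12 * av)) +
  - (euv - guv / 2 * (euu / Pu + evv / Pv)) * (S / (12 * aw)) =
  - (S / (au * av * aw)) / 24 * (au ^+ 2 * euu + av ^+ 2 * evv + aw ^+ 2 * eww +
     2 * (au * av * euv + au * aw * euw + av * aw * evw)).
Proof.
move=> au0 av0 aw0 Pu0 Pv0 Pw0 E1 E2 E3.
have -> : guv = (aw ^+ 2 * Pw - au ^+ 2 * Pu - av ^+ 2 * Pv) / (2 * au * av).
  have : 2 * au * av * guv = aw ^+ 2 * Pw - au ^+ 2 * Pu - av ^+ 2 * Pv.
    transitivity (au * (av * guv + aw * guw) + av * (au * guv + aw * gvw) - aw * (au * guw + av * gvw)).
      by ring.
    by rewrite E1 E2 E3; ring.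
  by move=> <-; field; rewrite au0 av0.
have -> : guw = (av ^+ 2 * Pv - au ^+ 2 * Pu - aw ^+ 2 * Pw) / (2 * au * aw).
  have : 2 * au * aw * guw = av ^+ 2 * Pv - au ^+ 2 * Pu - aw ^+ 2 * Pw.
    transitivity (au * (av * guv + aw * guw) + aw * (au * guw + av * gvw) - av * (au * guv + aw * gvw)).
      by ring.
    by rewrite E1 E2 E3; ring.
  by move=> <-; field; rewrite au0 aw0.
have -> : gvw = (au ^+ 2 * Pu - av ^+ 2 * Pv - aw ^+ 2 * Pw) / (2 * av * aw).
  have : 2 * av * aw * gvw = au ^+ 2 * Pu - av ^+ 2 * Pv - aw ^+ 2 * Pw.
    transitivity (av * (au * guv + aw * gvw) + aw * (au * guw + av * gvw) - au * (av * guv + aw * guw)).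
      by ring.
    by rewrite E1 E2 E3; ring.
  by move=> <-; field; rewrite av0 aw0.
by field; rewrite au0 av0 aw0 Pu0 Pv0 Pw0.
Qed.

Lemma dangleC (R : realType) (P Q g dP dQ dg : R) :
  dangle P Q g dP dQ dg = dangle Q P g dQ dP dg.
Proof. by rewrite /dangle (mulrC P) (addrC (dP / P)). Qed.

Lemma dperpC (R : realType) (V : finType) (d : {set V} -> R) a b c p q (xb xc yb yc : R) :
  dperp d a b c p q xb xc yb yc = dperp d a b c q p yb yc xb xc.
Proof.
rewrite /dperp !(gramC d a b) !(gramC d a c) !(gramC d a p) ?(gramC d a q b) ?(gramC d a q c).
rewrite ?(gramC d a p b) ?(gramC d a p c) ?(gramC d a c b); ring.
Qed.

(* A quadratic form in a zero-sum combination of points only depends on their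
   mutual squared distances. *)
Lemma dperp_dependency (R : realType) (V : finType) (d : {set V} -> R) (a b c u v w : V)
    (ub uc vb vc wb wc aa ab ac au av aw : R) :
  ab = - (au * ub + av * vb + aw * wb) -> ac = - (au * uc + av * vc + aw * wc) ->
  aa = - (ab + ac + au + av + aw) ->
  au ^+ 2 * dperp d a b c u u ub uc ub uc + av ^+ 2 * dperp d a b c v v vb vc vb vc +
  aw ^+ 2 * dperp d a b c w w wb wc wb wc +
  2 * (au * av * dperp d a b c u v ub uc vb vc + au * aw * dperp d a b c u w ub uc wb wc +
       av * aw * dperp d a b c v w vb vc wb wc) =
  - (aa * ab * dist2 d a b + aa * ac * dist2 d a c + aa * au * dist2 d a u +
     aa * av * dist2 d a v + aa * aw * dist2 d a w + ab * ac * dist2 d b c +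
     ab * au * dist2 d b u + ab * av * dist2 d b v + ab * aw * dist2 d b w +
     ac * au * dist2 d c u + ac * av * dist2 d c v + ac * aw * dist2 d c w +
     au * av * dist2 d u v + au * aw * dist2 d u w + av * aw * dist2 d v w).
Proof.
move=> Eb Ec Ea.
have G (y z : V) : gram d a z y = gram d a y z by rewrite gramC.
rewrite /dperp !(G b u) !(G b v) !(G b w) !(G c u) !(G c v) !(G c w).
transitivity (ab ^+ 2 * gram d a b b + ac ^+ 2 * gram d a c c + au ^+ 2 * gram d a u u +
   av ^+ 2 * gram d a v v + aw ^+ 2 * gram d a w w +
   2 * (ab * ac * gram d a b c + ab * au * gram d a b u + ab * av * gram d a b v +
        ab * aw * gram d a b w + ac * au * gram d a c u + ac * av * gram d a c v +
        ac * aw * gram d a c w + au * av * gram d a u v + au * aw * gram d a u w +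
        av * aw * gram d a v w)).
  rewrite Eb Ec; move: (gram d a b b) (gram d a b c) (gram d a c c) (gram d a b u) => g1 g2 g3 g4.
  move: (gram d a b v) (gram d a b w) (gram d a c u) (gram d a c v) => g5 g6 g7 g8.
  move: (gram d a c w) (gram d a u u) (gram d a u v) (gram d a u w) => g9 g10 g11 g12.
  by move: (gram d a v v) (gram d a v w) (gram d a w w) => g13 g14 g15; ring.
have D0 y : dist2 d y y = 0 by rewrite /dist2 eqxx.
rewrite /gram !D0 Ea; by field.
Qed.

Section SixPoints.
Context {R : realType} {V : finType} {L d : {set V} -> R} {x : V -> 'rV[R]_4} {al : V -> R}.

(** Up to the factor -1/24, the varied quadratic form at the vector [sum al y x y]; ordered pairs
    are summed, whence 48. *)
Definition cluster_form (Q : {set V}) : R :=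
  (\sum_(y in Q) \sum_(z in Q) al y * al z * dist2 d y z) / 48%:R.

Lemma cluster_formE a b c u v w : uniq [:: a; b; c; u; v; w] ->
  cluster_form [set y in [:: a; b; c; u; v; w]] =
    (al a * al b * dist2 d a b + al a * al c * dist2 d a c + al a * al u * dist2 d a u +
     al a * al v * dist2 d a v + al a * al w * dist2 d a w + al b * al c * dist2 d b c +
     al b * al u * dist2 d b u + al b * al v * dist2 d b v + al b * al w * dist2 d b w +
     al c * al u * dist2 d c u + al c * al v * dist2 d c v + al c * al w * dist2 d c w +
     al u * al v * dist2 d u v + al u * al w * dist2 d u w + al v * al w * dist2 d v w) / 24%:R.
Proof.
move=> U6; have S6 (F : V -> R) : \sum_(y in [set y in [:: a; b; c; u; v; w]]) F y =
    F a + F b + F c + F u + F v + F w.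
  rewrite (eq_bigl (mem [:: a; b; c; u; v; w])) => [|y]; last by rewrite inE.
  by rewrite -big_uniq // !big_cons big_nil /= addr0 !addrA.
have D0 y : dist2 d y y = 0 by rewrite /dist2 eqxx.
have C y z : dist2 d z y = dist2 d y z by rewrite dist2C.
rewrite /cluster_form S6 !S6 !D0 (C a b) (C a c) (C a u) (C a v) (C a w) (C b c) (C b u) (C b v) (C b w) (C c u) (C c v) (C c w) (C u v) (C u w) (C v w).
by field.
Qed.

(** The square root in an angle derivative yields the absolute value of a volume; the sign of the
    4-simplex restores the volume itself, which makes the sum of angles rational. *)
Lemma sg_div_norm (k S N : R) : k != 0 -> S != 0 ->
  Num.sg k * (- N / (12%:R * `|k| / S)) = - N * (S / (12%:R * k)).
Proof.
move=> k0 S0; have [kp|kn|kz] := ltrgtP k 0; last by rewrite kz eqxx in k0.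
  by rewrite ltr0_sg // ltr0_norm //; field; rewrite S0 k0.
by rewrite gtr0_sg // gtr0_norm //; field; rewrite S0 k0.
Qed.

(** The two vertices off the face may be enumerated in either order; the formula is symmetric in
    them, so a prescribed order can be used. *)
Lemma simplex_face_angle (s i : {set V}) (a b c p q o : V) (xb xc yb yc : R) mp mq :
  realizes L x s -> enum i = [:: a; b; c] -> uniq [:: a; b; c; p; q] ->
  s = [set v in [:: a; b; c; p; q]] ->
  affine_foot x a b c p xb xc mp -> affine_foot x a b c q yb yc mq ->
  [/\ 0 < dot mp mp, 0 < dot mq mq, 0 < area L i,
    (2 * area L i) ^+ 2 * (dot mp mp * dot mq mq - dot mp mq ^+ 2) =
      aff_det x o (enum s) ^+ 2
  & ddihedral L s i d = dangle (dot mp mp) (dot mq mq) (dot mp mq)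
       (dperp d a b c p p xb xc xb xc)
       (dperp d a b c q q yb yc yb yc) (dperp d a b c p q xb xc yb yc)].
Proof.
move=> Hs Ei Hu Es fp fq; have [n Hf] := simplex_frame Hs; have [s5 HL _] := Hs.
have D0 := face_gram_gt0 Hu Es HL Hf.
have S0 : 0 < area L i.
  by rewrite /area Ei -/(gram2 L a b c) divr_gt0 // sqrtr_gt0.
have S2 : (2 * area L i) ^+ 2 = gram2 L a b c.
  rewrite /area Ei -/(gram2 L a b c); have -> (r : R) : 2 * (r / 2) = r by field.
  by rewrite sqr_sqrtr // ltW.
have pE v : v \in s :\: i = (v \in [:: p; q]).
  rewrite inE -mem_enum Ei Es inE -[X in _ && (_ \in X)]/([:: a; b; c] ++ [:: p; q]) mem_cat.
  have [vabc|//] := boolP (v \in [:: a; b; c]); apply/esym.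
  move: Hu; rewrite -[X in uniq X]/([:: a; b; c] ++ [:: p; q]) cat_uniq => /and3P[_ /hasPn H _].
  by apply/negbTE; apply: contraL vabc; apply: H.
have Upq : uniq [:: p; q] by case/and4P: Hu.
have pm : perm_eq (enum (s :\: i)) [:: p; q].
  by apply: uniq_perm; rewrite ?enum_uniq // => v; rewrite mem_enum pE.
have sz := perm_size pm.
have [p' [q' Epq]] : exists p' q', enum (s :\: i) = [:: p'; q'].
  by case: (enum _) sz => [|p' [|q' []]] // _; exists p', q'.
have := perm_mem pm p'; have := perm_mem pm q'; rewrite Epq !inE !eqxx orbT /=.
have Upq' : p' != q' by have := enum_uniq (s :\: i); rewrite Epq /= inE andbT.
move=> /esym/orP[]/eqP Eq /esym/orP[]/eqP Ep; rewrite Eq Ep ?eqxx // in Epq Upq'.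
- have pp : perm_eq [:: a; b; c; q; p] [:: a; b; c; p; q].
    rewrite -[X in perm_eq X _]/([:: a; b; c] ++ ([:: q] ++ [:: p])).
    by rewrite -[X in perm_eq _ X]/([:: a; b; c] ++ ([:: p] ++ [:: q])) perm_cat2l perm_catC.
  have Hu' : uniq [:: a; b; c; q; p] by rewrite (perm_uniq pp).
  have Es' : s = [set v in [:: a; b; c; q; p]].
    by rewrite Es; apply/setP=> v; rewrite inE [RHS]inE (perm_mem pp).
  have [Q0 P0 _ K hd] := face_angle (d := d) Hu' Es' HL Hf Ei Epq fq fp.
  split=> //.
    by rewrite S2 -(aff_det_sq Hs o Hu' Es') (aff_det_default _ _ a) // -K (dotC mp mq) (mulrC (dot mp mp)).
  by rewrite /ddihedral (has_der_val hd) dangleC (dperpC _ _ _ _ q p) (dotC mq mp).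
have [P0 Q0 _ K hd] := face_angle (d := d) Hu Es HL Hf Ei Epq fp fq.
split=> //; last by rewrite /ddihedral (has_der_val hd).
by rewrite S2 -(aff_det_sq Hs o Hu Es) (aff_det_default _ _ a).
Qed.

Lemma simplex_feet (s : {set V}) (a b c p q : V) :
  realizes L x s -> uniq [:: a; b; c; p; q] -> s = [set v in [:: a; b; c; p; q]] ->
  [/\ exists xb xc m, affine_foot x a b c p xb xc m,
      exists xb xc m, affine_foot x a b c q xb xc m
    & dot (x b - x a) (x b - x a) * dot (x c - x a) (x c - x a)
        - dot (x b - x a) (x c - x a) ^+ 2 != 0].
Proof.
move=> Hs Hu Es; have [n Hf] := simplex_frame Hs; have [_ HL _] := Hs.
have [[xb [xc fp]] [yb [yc fq]]] := affine_foot_dual Hu Es Hf.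
have D0 := face_gram_gt0 Hu Es HL Hf.
split; [by do 3 eexists; exact: fp|by do 3 eexists; exact: fq|].
move: D0; rewrite /gram2 !(gram_realized HL) ?Es ?inE ?eqxx ?orbT //.
by move=> D0; rewrite gt_eqF.
Qed.

(** The component of the affine relation normal to the face says that the perpendiculars from [u],
    [v], [w] satisfy it with weights [al u], [al v], [al w], as [angle_sum_identity] requires. Its
    tangential component expresses [al b] and [al c] by the feet, which turns the result into a form
    symmetric in all six points. *)
Lemma six_point_angles a b c u v w (i : {set V}) :
  enum i = [:: a; b; c] -> uniq [:: a; b; c; u; v; w] ->
  let Q := [set y in [:: a; b; c; u; v; w]] in
  (forall z, z \in Q -> al z != 0) ->
  \sum_(y in Q) al y = 0 -> \sum_(y in Q) al y *: x y = 0 ->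
  (forall z, z \in [:: u; v; w] -> realizes L x (Q :\ z) /\
     aff_det x z (enum (Q :\ z)) ^+ 2 = (24%:R * al z) ^+ 2) ->
  0 < area L i /\
  Num.sg (al u) * ddihedral L (Q :\ u) i d + Num.sg (al v) * ddihedral L (Q :\ v) i d +
  Num.sg (al w) * ddihedral L (Q :\ w) i d =
  area L i / (al u * al v * al w) * cluster_form Q.
Proof.
move=> Ei U6 Q al0 sum1 sumx Hsimp.
have S6 (M : zmodType) (F : V -> M) : \sum_(y in Q) F y = F a + F b + F c + F u + F v + F w.
  rewrite (eq_bigl (mem [:: a; b; c; u; v; w])) => [|y]; last by rewrite inE.
  by rewrite -big_uniq // !big_cons big_nil /= addr0 !addrA.
have inQ z : z \in [:: a; b; c; u; v; w] -> z \in Q by move=> zl; rewrite /Q inE.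
have au0 : al u != 0 by apply/al0/inQ; rewrite !inE eqxx ?orbT.
have av0 : al v != 0 by apply/al0/inQ; rewrite !inE eqxx ?orbT.
have aw0 : al w != 0 by apply/al0/inQ; rewrite !inE eqxx ?orbT.
have sub3 (r : seq V) z : perm_eq [:: a; b; c; u; v; w] (z :: r) ->
    uniq r /\ Q :\ z = [set y in r].
  move=> pm; have := perm_uniq pm; rewrite U6 /= => /esym/andP[zr Ur]; split=> //.
  apply/setP=> y; rewrite /Q !inE [(y == a) || _](_ : _ = (y \in z :: r)); last first.
    by rewrite -(perm_mem pm) !inE.
  by rewrite inE; have [->|] := eqVneq y z; rewrite //= (negPf zr).
have [U3 E3] : uniq [:: a; b; c; u; v] /\ Q :\ w = [set y in [:: a; b; c; u; v]].
  by apply: sub3; rewrite -[X in perm_eq X _]/([:: a; b; c; u; v] ++ [:: w]) perm_catC.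
have [U2 E2] : uniq [:: a; b; c; u; w] /\ Q :\ v = [set y in [:: a; b; c; u; w]].
  apply: sub3; rewrite -[X in perm_eq X _]/(([:: a; b; c; u] ++ [:: v]) ++ [:: w]).
  by rewrite -[X in perm_eq _ X]/(([:: v] ++ [:: a; b; c; u]) ++ [:: w]) perm_cat2r perm_catC.
have [U1 E1] : uniq [:: a; b; c; v; w] /\ Q :\ u = [set y in [:: a; b; c; v; w]].
  apply: sub3; rewrite -[X in perm_eq X _]/(([:: a; b; c] ++ [:: u]) ++ [:: v; w]).
  by rewrite -[X in perm_eq _ X]/(([:: u] ++ [:: a; b; c]) ++ [:: v; w]) perm_cat2r perm_catC.
have [Ru Vu] := Hsimp u (mem_head _ _).
have [Rv Vv] : realizes L x (Q :\ v) /\ aff_det x v (enum (Q :\ v)) ^+ 2 = (24%:R * al v) ^+ 2.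
  by apply: Hsimp; rewrite !inE eqxx orbT.
have [Rw Vw] : realizes L x (Q :\ w) /\ aff_det x w (enum (Q :\ w)) ^+ 2 = (24%:R * al w) ^+ 2.
  by apply: Hsimp; rewrite !inE eqxx !orbT.
have [[ub [uc [mu fu]]] [vb [vc [mv fv]]] Gn] := simplex_feet Rw U3 E3.
have [_ [wb [wc [mw fw]]] _] := simplex_feet Ru U1 E1.
have [Pv _ S0 Ku Hu] := simplex_face_angle u Ru Ei U1 E1 fv fw.
have [Pu Pw _ Kv Hv] := simplex_face_angle v Rv Ei U2 E2 fu fw.
have [_ _ _ Kw Hw] := simplex_face_angle w Rw Ei U3 E3 fu fv.
split=> //.
have Sn : area L i != 0 by rewrite gt_eqF.
(* The constant 12 is 24, relating the determinant to the volume, divided by the 2 of twice the area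
   of the face. *)
have root P g k : (2 * area L i) ^+ 2 * (P - g ^+ 2) = (24%:R * k) ^+ 2 ->
    Num.sqrt (P - g ^+ 2) = 12%:R * `|k| / area L i.
  move=> E; have -> : P - g ^+ 2 = (12%:R * `|k| / area L i) ^+ 2.
    have : (2 * area L i) ^+ 2 * (P - g ^+ 2) = (2 * area L i) ^+ 2 * (12%:R * `|k| / area L i) ^+ 2.
      rewrite E -(real_normK (num_real (24%:R * k))) normrM (ger0_norm (ler0n _ _)).
      by move: `|k| => k'; field.
    by apply: mulfI; rewrite expf_neq0 // mulf_neq0 // pnatr_eq0.
  by rewrite sqrtr_sqr ger0_norm // divr_ge0 ?mulr_ge0 // ltW.
rewrite Vu in Ku; rewrite Vv in Kv; rewrite Vw in Kw.
rewrite Hu Hv Hw /dangle (root _ _ _ Ku) (root _ _ _ Kv) (root _ _ _ Kw) !sg_div_norm //.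
rewrite S6 in sum1; rewrite S6 in sumx.
have [Ep pb pc] := fu; have [Eq qb qc] := fv; have [Er rb rc] := fw.
set B := x b - x a in Gn Ep pb Eq qb Er rb *; set C := x c - x a in Gn Ep pc Eq qc Er rc *.
(* The relation is the sum of the normal vector [M] and of [be *: B + ga *: C] in the plane of the
   face, so both parts vanish; [be] and [ga] then vanish since the Gram determinant [Gn] of [B], [C]
   is nonzero. *)
pose be := al b + (al u * ub + al v * vb + al w * wb).
pose ga := al c + (al u * uc + al v * vc + al w * wc).
pose M := al u *: mu + al v *: mv + al w *: mw.
have aE : al a = - (al b + al c + al u + al v + al w).
  by apply/eqP; rewrite -addr_eq0 !addrA; apply/eqP.
have E0 : M + (be *: B + ga *: C) = 0.
  rewrite -[RHS]sumx aE.
  transitivity (al b *: B + al c *: C + al u *: (x u - x a) + al v *: (x v - x a) + al w *: (x w - x a)).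
    rewrite Ep Eq Er /M /be /ga; apply/rowP=> k; rewrite !mxE; ring.
  by rewrite /B /C; apply/rowP=> k; rewrite !mxE; ring.
have MB : dot M B = 0 by rewrite /M !(dotDl, dotZl) pb qb rb !mulr0 !addr0.
have MC : dot M C = 0 by rewrite /M !(dotDl, dotZl) pc qc rc !mulr0 !addr0.
have eB : be * dot B B + ga * dot B C = 0.
  by have := congr1 (fun y : 'rV_4 => dot y B) E0; rewrite dot_foot MB add0r dot0l (dotC C B).
have eC : be * dot B C + ga * dot C C = 0.
  by have := congr1 (fun y : 'rV_4 => dot y C) E0; rewrite dot_foot MC add0r dot0l.
have be0 : be = 0.
  apply: (mulIf Gn); rewrite mul0r.
  transitivity (dot C C * (be * dot B B + ga * dot B C) - dot B C * (be * dot B C + ga * dot C C)).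
    by ring.
  by rewrite eB eC !mulr0 subr0.
have ga0 : ga = 0.
  apply: (mulIf Gn); rewrite mul0r.
  transitivity (dot B B * (be * dot B C + ga * dot C C) - dot B C * (be * dot B B + ga * dot B C)).
    by ring.
  by rewrite eB eC !mulr0 subr0.
have M0 : M = 0 by rewrite -[RHS]E0 be0 ga0 !scale0r !addr0.
have Mm m : al u * dot mu m + al v * dot mv m + al w * dot mw m = 0.
  by rewrite -!dotZl -!dotDl -/M M0 dot0l.
have [Pu0 Pv0 Pw0] : [/\ dot mu mu != 0, dot mv mv != 0 & dot mw mw != 0].
  by rewrite !gt_eqF.
rewrite angle_sum_identity //; first last.
- by have := Mm mw; rewrite addrC => /eqP; rewrite addr_eq0 => /eqP ->; rewrite !opprK.
- have := Mm mv; rewrite (dotC mw mv) addrAC addrC => /eqP; rewrite addr_eq0 => /eqP ->.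
  by rewrite opprK.
- have := Mm mu; rewrite (dotC mv mu) (dotC mw mu) -addrA addrC => /eqP; rewrite addr_eq0 => /eqP ->.
  by [].
have Eb : al b = - (al u * ub + al v * vb + al w * wb).
  by apply/eqP; rewrite -addr_eq0; apply/eqP; exact: be0.
have Ec : al c = - (al u * uc + al v * vc + al w * wc).
  by apply/eqP; rewrite -addr_eq0; apply/eqP; exact: ga0.
rewrite (dperp_dependency d a b c u v w Eb Ec aE) cluster_formE //.
by rewrite mulrN -mulNr -mulNr opprK mulrAC mulrA.
Qed.

End SixPoints.

(** * Moves 3 -> 3 *)

(** As a function of the first vertex the determinant is linear in homogeneous coordinates, on which
    the relation holds. The terms of the vertices in [w] have a repeated row. *)
Lemma aff_det_dependency (R : realType) (V : finType) (x : V -> 'rV[R]_4) (al : V -> R)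
    (o p q : V) (w : seq V) :
  uniq [:: p, q & w] -> size w = 4%N ->
  \sum_(y in [set y in [:: p, q & w]]) al y = 0 ->
  \sum_(y in [set y in [:: p, q & w]]) al y *: x y = 0 ->
  al p * aff_det x o (p :: w) + al q * aff_det x o (q :: w) = 0.
Proof.
move=> Hu w4 sum1 sumx.
pose mx v : 'M[R]_5 := \matrix_(i < 5) hrow (x (nth o (v :: w) i)).
pose cof j := cofactor (mx p) ord0 j.
have gE v : aff_det x o (v :: w) = \sum_j hrow (x v) 0 j * cof j.
  rewrite /aff_det -/(mx v) (expand_det_row _ ord0); apply: eq_bigr => j _.
  rewrite [mx v _ _]mxE; congr (_ * _); rewrite /cof /cofactor; congr (_ * \det _).
  by apply/matrixP=> k l; rewrite !mxE.
have g0 v : v \in w -> aff_det x o (v :: w) = 0.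
  move=> vw; have vi : (index v w < 4)%N by rewrite -w4 index_mem.
  apply: (determinant_alternate (i1 := ord0) (i2 := lift ord0 (Ordinal vi))) => // k.
  by rewrite [LHS]mxE [RHS]mxE /= nth_index.
have : \sum_(y in [set y in [:: p, q & w]]) al y * aff_det x o (y :: w) = 0.
  under eq_bigr do rewrite gE mulr_sumr.
  rewrite exchange_big /=; apply: big1 => j _.
  under eq_bigr do rewrite mulrA.
  rewrite -mulr_suml; apply/eqP; rewrite mulf_eq0; apply/orP; left; apply/eqP.
  have [k ->|k ->] := @split_ordP 1 4 j.
    rewrite -[RHS]sum1; apply: eq_bigr => y _.
    by rewrite [hrow _ _ _]row_mxEl mxE (ord1 k) mulr1.
  transitivity ((\sum_(y in [set y in [:: p, q & w]]) al y *: x y) 0 k); last by rewrite sumx mxE.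
  by rewrite summxE; apply: eq_bigr => y _; rewrite [hrow _ _ _]row_mxEr mxE.
rewrite (eq_bigl (mem [:: p, q & w])) => [|y]; last by rewrite inE.
rewrite -big_uniq // !big_cons /= [X in _ + (_ + X)]big1_seq ?addr0 // => y /andP[_ /g0 ->].
by rewrite mulr0.
Qed.

(** The point [x e] has weight [k], and each vertex of [s] has [- k] times the corresponding
    barycentric coordinate of [x e], computed from the reference vertex [z]. *)
Lemma dependency_exists (R : realType) (V : finType) (L : {set V} -> R)
    (x : V -> 'rV[R]_4) (s : {set V}) (e : V) (k : R) :
  realizes L x s -> e \notin s ->
  exists al : V -> R, [/\ al e = k, \sum_(y in e |: s) al y = 0 &
    \sum_(y in e |: s) al y *: x y = 0].
Proof.
move=> Hs es; have [n [n0 _ nexp]] := simplex_frame Hs; have [s5 _ _] := Hs.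
have [z sz] : exists z, z \in s by apply/set0Pn; rewrite -card_gt0 s5.
pose al y : R := if y == e then k else - k * (dot (n y) (x e - x z) + (y == z)%:R).
have alE y : y \in s -> al y = - k * (dot (n y) (x e - x z) + (y == z)%:R).
  by move=> sy; rewrite /al; case: eqP => // ye; rewrite ye (negPf es) in sy.
have ale : al e = k by rewrite /al eqxx.
exists al; split=> //.
  rewrite big_setU1 //= ale (eq_bigr _ alE) -mulr_sumr big_split /= -dot_suml n0 dot0l add0r.
  have -> : \sum_(y in s) (y == z)%:R = 1 :> R.
    by have := sum_delta (fun=> 1 : R) sz; under eq_bigr do rewrite mul1r.
  by rewrite mulr1 subrr.
rewrite big_setU1 //= ale; under eq_bigr => y sy do rewrite (alE _ sy) -scalerA scalerDl.
rewrite -scaler_sumr big_split /= -nexp.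
have -> : \sum_(y in s) (y == z)%:R *: x y = x z.
  rewrite (bigD1 z) //= eqxx scale1r big1 ?addr0 // => y /andP[_ /negPf->].
  by rewrite scale0r.
by rewrite subrK scaleNr subrr.
Qed.

Section Move.
Context {V : finType} {K : {set {set V}}} {T U : {set V}}.
Let Q := T :|: U.
Let K' := move33 K T U.
Hypotheses (cK : is_complex K) (T3 : #|T| = 3%N) (U3 : #|U| = 3%N) (TU : [disjoint T & U]).
Hypotheses (TK : T \in K) (UK : U \notin K).
Hypothesis HS : [set s in simplices4 K | T \subset s] = [set Q :\ z | z in U].

Let Q6 : #|Q| = 6%N.
Proof. by rewrite /Q cardsU disjoint_setI0 // cards0 T3 U3. Qed.

Let subQ z : z \in Q -> #|Q :\ z| = 5%N.
Proof. by move=> zQ; have := cardsD1 z Q; rewrite zQ Q6 add1n => -[]. Qed.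

Let TinQ z : z \in T -> z \in Q. Proof. by rewrite inE => ->. Qed.

Lemma old_simplex z : z \in U -> Q :\ z \in simplices4 K /\ T \subset Q :\ z.
Proof.
move=> zU; have : Q :\ z \in [set Q :\ z | z in U] by apply: imset_f.
by rewrite -HS inE => /andP[].
Qed.

(** A subset of the six vertices that misses a vertex [z] of [U] lies in the old 4-simplex without
    [z]. *)
Lemma cluster_sub (t : {set V}) : t != set0 -> t \subset Q -> ~~ (U \subset t) -> t \in K.
Proof.
move=> t0 tQ /subsetPn[z zU zt]; have [zS _] := old_simplex zU.
have [_ Kd] := cK; apply: (Kd (Q :\ z)) => //; first by move: zS; rewrite inE => /andP[].
apply/subsetP=> y yt; rewrite !inE (contraNneq _ zt) => [|<-//].
by have := subsetP tQ y yt; rewrite inE.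
Qed.

Lemma move33P (s : {set V}) : (s \in K') = (s \in K) && ~~ (T \subset s) ||
  [&& U \subset s, s \subset Q & ~~ (T \subset s)].
Proof. by rewrite /K' /move33 !inE. Qed.

Lemma move33_complex : is_complex K'.
Proof.
have [K0 Kd] := cK; split.
  by rewrite move33P (negPf K0) /= subset0 -cards_eq0 U3.
move=> s t; rewrite !move33P => /orP[/andP[sK Ts]|/and3P[Us sQ Ts]] ts t0.
  by rewrite (Kd s) //= (contra _ Ts) // => /subset_trans; apply.
have Tt : ~~ (T \subset t) by apply: contra Ts => /subset_trans; apply.
have tQ := subset_trans ts sQ.
by have [Ut|Ut] := boolP (U \subset t); rewrite Tt ?tQ ?orbT // (cluster_sub t0 tQ Ut).
Qed.

Lemma move33_small (t : {set V}) : (#|t| < 3)%N -> (t \in K') = (t \in K).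
Proof.
move=> t3; rewrite move33P.
have nsub (W : {set V}) : #|W| = 3%N -> (W \subset t) = false.
  by move=> W3; apply/negbTE; apply: contraL t3 => /subset_leq_card; rewrite W3 -leqNgt.
by rewrite !nsub // andbT orbF.
Qed.

Lemma move33_edge_rel : edge_rel K' = edge_rel K.
Proof.
apply/funext=> y; apply/funext=> z; rewrite /edge_rel move33_small //.
by rewrite cards2; case: (_ != _).
Qed.

Lemma move33_edges : edges K' = edges K.
Proof.
apply/setP=> e; rewrite !inE -!/(e \in K') -move33P.
by have [e2|] := eqVneq #|e| 2%N; rewrite ?andbF // !andbT move33_small // e2.
Qed.

Lemma faceU_notK (s : {set V}) : s \in K -> ~~ (U \subset s).
Proof.
move=> sK; apply: contra UK => Us; have [_ Kd] := cK.
by apply: (Kd s) => //; rewrite -card_gt0 U3.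
Qed.

Lemma T_notsub_U : ~~ (T \subset U).
Proof.
apply/negP=> TsU; have := disjoint_setI0 TU; rewrite (setIidPl TsU) => T0.
by move: T3; rewrite T0 cards0.
Qed.

Lemma move33_faces : faces K' = U |: (faces K :\ T).
Proof.
apply/setP=> s; rewrite inE move33P 4!inE [s \in faces K]inE.
have [/eqP s3|s3] := boolP (#|s| == 3%N); last first.
  rewrite !andbF orbF; apply/esym/negbTE; apply: contraNneq s3 => ->.
  by rewrite U3.
have eqsub (W : {set V}) : #|W| = 3%N -> (W \subset s) = (s == W).
  by move=> W3; rewrite eq_sym eqEcard s3 W3 leqnn andbT.
rewrite !andbT !eqsub //; have [sU|sU] := eqVneq s U; last by rewrite /= orbF andbC.
have UT : U != T by apply: contraNneq T_notsub_U => ->; exact: subxx.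
by rewrite sU UT (negPf UK) /= subsetUr.
Qed.

Lemma move33_simplices :
  simplices4 K' = [set s in simplices4 K | ~~ (T \subset s)] :|: [set Q :\ z | z in T].
Proof.
apply/setP=> s; rewrite inE move33P in_setU 2![in RHS]inE andb_orl andbAC; congr (_ || _).
apply/idP/imsetP => [/andP[/and3P[Us sQ Ts] /eqP s5]|[z zT ->]].
  have /subsetPn[z zT zs] := Ts; exists z => //.
  apply/eqP; rewrite eqEcard subQ ?TinQ // s5 leqnn andbT.
  apply/subsetP=> y ys; rewrite !inE (contraNneq _ zs) => [|<-//].
  by have := subsetP sQ y ys; rewrite inE.
rewrite subQ ?TinQ // eqxx andbT subsetDl /=; apply/andP; split.
  apply/subsetP=> y yU; rewrite !inE yU orbT andbT.
  by apply: contraTneq yU => ->; rewrite (disjointFr TU zT).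
by apply/subsetPn; exists z => //; rewrite !inE eqxx.
Qed.

Lemma new_simplex_notK z : z \in T -> Q :\ z \notin K.
Proof.
move=> zT; apply: contraL (subxx U) => /faceU_notK; apply: contra => _.
apply/subsetP=> y yU; rewrite !inE yU orbT andbT.
by apply: contraTneq yU => ->; rewrite (disjointFr TU zT).
Qed.

Let remove_inj (W : {set V}) : W \subset Q -> {in W &, injective (fun z => Q :\ z)}.
Proof.
move=> WQ y z yW zW E; apply/eqP; apply: contraT => yz.
have : y \in Q :\ z by rewrite !inE yz; have := subsetP WQ y yW; rewrite inE.
by rewrite -E !inE eqxx.
Qed.

Section Big.
Variables (M : Type) (idx : M) (op : Monoid.com_law idx).

Lemma big_old_simplices (F : {set V} -> M) :
  \big[op/idx]_(s in simplices4 K) F s =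
  op (\big[op/idx]_(s in [set s in simplices4 K | ~~ (T \subset s)]) F s)
     (\big[op/idx]_(z in U) F (Q :\ z)).
Proof.
rewrite (bigID (fun s : {set V} => ~~ (T \subset s))) /=; congr (op _ _).
  by apply: eq_bigl => s; rewrite [RHS]inE.
rewrite -(big_imset F (remove_inj (subsetUr T U))) -HS; apply: eq_bigl => s.
by rewrite [RHS]inE negbK.
Qed.

Lemma big_new_simplices (F : {set V} -> M) :
  \big[op/idx]_(s in simplices4 K') F s =
  op (\big[op/idx]_(s in [set s in simplices4 K | ~~ (T \subset s)]) F s)
     (\big[op/idx]_(z in T) F (Q :\ z)).
Proof.
rewrite move33_simplices; set X := [set s in _ | _]; set Y := imset _ _.
rewrite (eq_bigl [predU X & Y]) => [|s]; last by rewrite in_setU.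
rewrite bigU /=; last first.
  apply/pred0P=> s /=; apply/negbTE; rewrite negb_and.
  have [/imsetP[z zT ->]|] := boolP (s \in Y); last by rewrite orbT.
  by rewrite inE [_ \in simplices4 K]inE (negPf (new_simplex_notK zT)).
by rewrite (big_imset F (remove_inj (subsetUl T U))).
Qed.

End Big.

Lemma face_in_simplex (j : {set V}) z : j \subset Q -> (j \subset Q :\ z) = (z \notin j).
Proof. by move=> jQ; rewrite subsetD1 jQ. Qed.

End Move.

(** [X] and [Y] stand for the determinants of two 4-simplices over a common tetrahedron. Opposite
    values of [orn] absorb the minus sign of the relation, equal values leave it. *)
Lemma sign_transfer (R : realFieldType) (o1 o2 : bool) (ap aq X Y : R) :
  ap * X + aq * Y = 0 ->
  ap * ((-1) ^+ (~~ o1) * X / 24%:R) =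
  (-1) ^+ (o1 == o2) * (aq * ((-1) ^+ (~~ o2) * Y / 24%:R)).
Proof.
move/eqP; rewrite addr_eq0 => /eqP E.
have -> (s : R) : ap * (s * X / 24%:R) = s * (ap * X) / 24%:R by ring.
rewrite E.
by case: o1; case: o2; rewrite /= ?expr0 ?expr1; ring.
Qed.

Section MoveGeometry.
Context {R : realType} {V : finType} {K : {set {set V}}} {b : V} {orn orn' : seq V -> bool}.
Context {phi : seq V -> 'rV[R]_4 -> 'rV[R]_4} {f : seq V -> 'rV[R]_4} {T U : {set V}}.
Let Q := T :|: U.
Let K' := move33 K T U.
Let L := len2 K b f.
Let vol := ovol K b orn f.
Let vol' := ovol K' b orn' f.
Hypotheses (mK : closed_PL4_manifold R K) (conn : connected_complex K) (bK : [set b] \in K).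
Hypotheses (or : orientation K orn) (or' : orientation K' orn').
Hypothesis orr' : forall t : 5.-tuple V, uniq t ->
  [set v in t] \in K -> [set v in t] \in K' -> orn' t = orn t.
Hypotheses (Hphi : pi1_hom K b phi) (Hf : equivariant_map K b phi f).
Hypotheses (nd : nondegenerate K b orn f) (nd' : nondegenerate K' b orn' f).
Hypotheses (T3 : #|T| = 3%N) (U3 : #|U| = 3%N) (TU : [disjoint T & U]).
Hypotheses (TK : T \in K) (UK : U \notin K).
Hypothesis HS : [set s in simplices4 K | T \subset s] = [set Q :\ z | z in U].

Let cK : is_complex K. Proof. by case: mK. Qed.

Lemma move33_path_to s : path_to K' b s = path_to K b s.
Proof. by rewrite /path_to /epath move33_edge_rel. Qed.

Lemma move33_vertex_image s v : vertex_image K' b f s v = vertex_image K b f s v.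
Proof. by rewrite /vertex_image move33_path_to. Qed.

Lemma move33_len2 : len2 K' b f = L.
Proof.
apply/funext=> a; rewrite /L /len2; case: (enum a) => [|u [|v []]] //.
by rewrite !move33_vertex_image.
Qed.

Lemma cluster_triple u v w : u \in T -> v \in Q -> w \in Q -> [set u; v; w] \in K.
Proof.
move=> uT vQ wQ; apply: (cluster_sub cK HS).
- by apply/set0Pn; exists u; rewrite !inE eqxx.
- apply/subsetP=> y; rewrite in_setU in_set2 in_set1 => /orP[/orP[]|]/eqP-> //.
  by rewrite inE uT.
apply/negP=> sub; have : U \subset [set v; w].
  apply/subsetP=> y yU; have := subsetP sub y yU; rewrite !inE -orbA => /orP[/eqP yu|//].
  by rewrite yu (disjointFr TU uT) in yU.
by move=> /subset_leq_card; rewrite U3 cards2; case: (_ != _).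
Qed.

(** All six vertices are lifted along one path ending in [T]. Triples with a vertex in [T] are
    simplices, which makes lengths computable from these lifts and makes the lift chosen for each
    4-simplex congruent to them, also for the new ones. *)
Lemma cluster_lift : exists x : V -> 'rV[R]_4, realized L x Q /\
  forall z, exists m, motion m /\ forall v, v \in Q :\ z -> vertex_image K b f (Q :\ z) v = m (x v).
Proof.
have [a0 a0T] : exists a0, a0 \in T by apply/set0Pn; rewrite -card_gt0 T3.
have TQ y : y \in T -> y \in Q by rewrite inE => ->.
have aK y : y \in T -> [set y] \in K.
  move=> yT; have [_ Kd] := cK; apply: (Kd _ _ TK); first by rewrite sub1set.
  by apply/set0Pn; exists y; rewrite inE.
have [pp] := path_toP cK bK conn (aK _ a0T); rewrite inE => /eqP lp.
set p := path_to K b [set a0] in pp lp.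
exists (fun v => f (rcons p v)); split=> [u v uQ vQ uv|z].
  by apply: (len2_lift cK bK Hphi Hf conn pp uv); rewrite lp cluster_triple.
(* The comparison of lifts needs a vertex that belongs to the 4-simplex and to [T], hence one other
   than [z]. *)
have [u0] : exists u0, u0 \in T :\ z.
  apply/set0Pn; rewrite -card_gt0; have := cardsD1 z T; rewrite T3.
  by case: (z \in T); rewrite /= ?add1n ?add0n; [move=> [<-]|move=> <-].
rewrite !inE => /andP[u0z u0T].
have u0Qz : u0 \in Q :\ z by rewrite !inE u0z u0T.
have [qq lq] := path_to_vertex bK conn u0Qz (aK _ u0T).
have lqQ : last b (path_to K b (Q :\ z)) \in Q by move: lq; rewrite inE => /andP[].
have [|m [mot Hm]] := lifts_congruent cK Hphi Hf qq pp _ u0Qz.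
  move=> u; rewrite inE => /andP[_ uQ]; rewrite lp; split.
    by rewrite (setUC [set _] [set u0]) cluster_triple.
  by rewrite cluster_triple // TQ.
by exists m; split=> // v vz; rewrite /vertex_image Hm.
Qed.

(* The coefficients of the affine dependency of the six points, normalized so
   that they are the volumes of the 4-simplices around [T] and the opposite
   volumes of those around [U]. *)
Lemma cluster_dependency : exists (x : V -> 'rV[R]_4) (al : V -> R),
  [/\ forall z, z \in Q -> al z != 0, \sum_(y in Q) al y = 0, \sum_(y in Q) al y *: x y = 0,
    forall z, z \in Q -> realizes L x (Q :\ z) /\
      aff_det x z (enum (Q :\ z)) ^+ 2 = (24%:R * al z) ^+ 2
  & (forall z, z \in U -> vol (Q :\ z) = al z) /\ (forall z, z \in T -> vol' (Q :\ z) = - al z)].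
Proof.
have [x [HL Hm]] := cluster_lift.
have TQ y : y \in T -> y \in Q by rewrite inE => ->.
have UQ y : y \in U -> y \in Q by rewrite inE orbC => ->.
have Q6 : #|Q| = 6%N by rewrite /Q cardsU disjoint_setI0 // cards0 T3 U3.
have Qz5 z : z \in Q -> #|Q :\ z| = 5%N.
  by move=> zQ; have := cardsD1 z Q; rewrite zQ Q6 add1n => -[].
have sU z : z \in U -> Q :\ z \in simplices4 K by move=> zU; have [] := old_simplex HS zU.
have sT z : z \in T -> Q :\ z \in simplices4 K'.
  by move=> zT; rewrite move33_simplices // in_setU; apply/orP; right; exact: imset_f.
have K'S s : s \in simplices4 K' -> s \in K' by rewrite inE => /andP[].
have KS s : s \in simplices4 K -> s \in K by rewrite inE => /andP[].
have volU z o t : z \in U -> uniq t -> size t = 5%N -> Q :\ z = [set v in t] ->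
    vol (Q :\ z) = (-1) ^+ (~~ orn t) * aff_det x o t / 24%:R.
  move=> zU Ut t5 Et; have [m [mot mE]] := Hm z.
  exact: (ovolE o or mot (KS _ (sU z zU)) mE Ut t5 Et).
have volT z o t : z \in T -> uniq t -> size t = 5%N -> Q :\ z = [set v in t] ->
    vol' (Q :\ z) = (-1) ^+ (~~ orn' t) * aff_det x o t / 24%:R.
  move=> zT Ut t5 Et; have [m [mot mE]] := Hm z.
  have mE' v : v \in Q :\ z -> vertex_image K' b f (Q :\ z) v = m (x v).
    by move=> vz; rewrite move33_vertex_image mE.
  exact: (ovolE o or' mot (K'S _ (sT z zT)) mE' Ut t5 Et).
have enumE (s : {set V}) : s = [set v in enum s] by apply/setP=> v; rewrite inE mem_enum.
have affz z o : z \in Q -> aff_det x o (enum (Q :\ z)) != 0.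
  move=> zQ; have e5 : size (enum (Q :\ z)) = 5%N by rewrite -cardE Qz5.
  move: (zQ); rewrite inE => /orP[zT|zU].
    have := nd' (sT z zT); rewrite -/(vol' _) (volT z o _ zT (enum_uniq _) e5 (enumE _)).
    by apply: contraNneq => ->; rewrite mulr0 mul0r.
  have := nd (sU z zU); rewrite -/(vol _) (volU z o _ zU (enum_uniq _) e5 (enumE _)).
  by apply: contraNneq => ->; rewrite mulr0 mul0r.
have real z : z \in Q -> realizes L x (Q :\ z).
  move=> zQ; split=> [||o]; [exact: Qz5| |exact: affz].
  by apply: realizedS HL; rewrite subsetDl.
have [e0 e0U] : exists e0, e0 \in U by apply/set0Pn; rewrite -card_gt0 U3.
have e0Q := UQ _ e0U.
(* The factor of the relation is fixed by the volume of one old 4-simplex; the other volumes are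
   compared with it across the tetrahedron [w p q] common to the complements of [p] and [q]. *)
have [|al [ale sum1 sumx]] := dependency_exists (vol (Q :\ e0)) (real _ e0Q) (e := e0).
  by rewrite !inE eqxx.
rewrite setD1K // in sum1 sumx.
pose w p q := enum ((Q :\ p) :\ q).
have wE p q : p \in Q -> q \in Q -> p != q ->
    [/\ uniq [:: p, q & w p q], size (w p q) = 4%N, Q = [set y in [:: p, q & w p q]],
      Q :\ p = [set y in q :: w p q] & Q :\ q = [set y in p :: w p q]].
  move=> pQ qQ pq; have qQp : q \in Q :\ p by rewrite !inE eq_sym pq -in_setU.
  have E1 : Q :\ p = [set y in q :: w p q].
    by rewrite -(setD1K qQp); apply/setP=> y; rewrite !inE mem_enum !inE.
  split=> //.
  - by rewrite /= !inE !mem_enum !inE !eqxx /= ?andbF ?orbF pq enum_uniq.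
  - by rewrite -cardE; have := cardsD1 q (Q :\ p); rewrite qQp Qz5 // add1n => -[].
  - rewrite -[LHS](setD1K pQ) E1; apply/setP=> y; rewrite !inE //.
  apply/setP=> y; rewrite in_setD1 in_set in_cons mem_enum !in_setD1.
  have [->|yq] := eqVneq y q; first by rewrite eq_sym (negPf pq).
  by have [->|yp] := eqVneq y p; rewrite ?pQ.
have dep p q : p \in Q -> q \in Q -> p != q ->
    al p * aff_det x p (p :: w p q) + al q * aff_det x p (q :: w p q) = 0.
  move=> pQ qQ pq; have [Uw w4 EQ _ _] := wE p q pQ qQ pq.
  by apply: aff_det_dependency; rewrite // -EQ.
have e0n : al e0 != 0 by rewrite ale; apply: nd; apply: sU.
have wtuple p q : p \in Q -> q \in Q -> p != q -> exists2 t : 4.-tuple V, w p q = t &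
    [/\ uniq (p :: t), uniq (q :: t), Q :\ p = [set y in q :: t] & Q :\ q = [set y in p :: t]].
  move=> pQ qQ pq; have [Uw w4 EQ Ep Eq] := wE p q pQ qQ pq.
  have w4' : size (w p q) == 4%N by apply/eqP.
  exists (Tuple w4') => //; split=> //=; move: Uw => /= /and3P[]; rewrite inE negb_or.
    by move=> /andP[_ ->] _ ->.
  by move=> _ -> ->.
have ve0 : vol (Q :\ e0) != 0 by apply: nd; apply: sU.
have volU' z : z \in U -> vol (Q :\ z) = al z.
  move=> zU; have [->//|ze] := eqVneq z e0; have zQ := UQ _ zU.
  have [t Et [Uz Ue Ez Ee]] := wtuple z e0 zQ e0Q ze.
  have := dep z e0 zQ e0Q ze; rewrite Et => D.
  have t5 y : size (y :: t) = 5%N by rewrite /= size_tuple.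
  have no : orn (z :: t) != orn (e0 :: t).
    by apply: (proj2 or) => //; rewrite -?Ee -?Ez; apply/KS/sU.
  have := sign_transfer (orn (z :: t)) (orn (e0 :: t)) D.
  rewrite (negPf no) expr0 mul1r -(volU e0 z _ e0U Uz (t5 _) Ee) -(volU z z _ zU Ue (t5 _) Ez) ale.
  by move=> E; apply: (mulIf ve0); rewrite mulrC -E.
have volT' z : z \in T -> vol' (Q :\ z) = - al z.
  move=> zT; have zQ := TQ _ zT.
  have ze : z != e0 by apply: contraTneq e0U => <-; rewrite (disjointFr TU zT).
  have [t Et [Uz Ue Ez Ee]] := wtuple z e0 zQ e0Q ze.
  have := dep z e0 zQ e0Q ze; rewrite Et => D.
  have t5 y : size (y :: t) = 5%N by rewrite /= size_tuple.
  have ztK : [set y in z :: t] \in K by rewrite -Ee; apply/KS/sU.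
  have etK' : [set y in e0 :: t] \in K' by rewrite -Ez; apply/K'S/sT.
  have etK : [set y in e0 :: t] \notin K by rewrite -Ez; apply: new_simplex_notK.
  (* The new 4-simplex without [z] and the old one without [e0] share the tetrahedron [t], but
     belong to different complexes. A second old 4-simplex on [t], with vertex [r], misses [z] and
     so does not contain [T]: it survives the move. Both given ones are opposite to it across [t],
     so they have equal values of [orn] and [orn']. *)
  have [r [rz rt rK]] : exists r, [/\ r != z, r \notin t & [set y in r :: t] \in K].
    case: t Uz {Et Ue Ez Ee D t5 etK' etK} ztK => -[|y0 [|y1 [|y2 [|y3 []]]]] //= i4 Uz ztK.
    have [||r [rz rt rK]] := @no_free_tetrahedron R V K y0 y1 y2 y3 z mK.
    - by rewrite (perm_uniq (s2 := [:: z; y0; y1; y2; y3])) // -[X in perm_eq X _]/([:: y0; y1; y2; y3] ++ [:: z]) perm_catC.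
    - have -> // : [set y0; y1; y2; y3; z] = [set y in [:: z; y0; y1; y2; y3]].
      by apply/setP=> y; rewrite !inE orbC !orbA.
    exists r; split=> //; first by move: rt; rewrite !inE -!orbA.
    have -> // : [set y in [:: r; y0; y1; y2; y3]] = r |: [set y0; y1; y2; y3].
    by apply/setP=> y; rewrite !inE !orbA.
  have re0 : r != e0 by apply: contraNneq etK => <-.
  have Ur : uniq (r :: t) by rewrite /= rt; case/andP: Uz.
  have rK' : [set y in r :: t] \in K'.
    rewrite move33P rK /=; apply/orP; left; apply/subsetPn; exists z => //.
    by rewrite !inE negb_or eq_sym rz; case/andP: Uz.
  have n1 : orn (z :: t) != orn (r :: t) by apply: (proj2 or); rewrite // eq_sym.
  have n2 : orn' (e0 :: t) != orn' (r :: t) by apply: (proj2 or'); rewrite // eq_sym.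
  have Er : orn' (r :: t) = orn (r :: t) := orr' (t := [tuple of r :: t]) Ur rK rK'.
  have oE : (orn (z :: t) == orn' (e0 :: t)) = true.
    by move: n1 n2; rewrite Er; case: (orn (r :: t)); case: (orn _); case: (orn' _).
  have := sign_transfer (orn (z :: t)) (orn' (e0 :: t)) D.
  rewrite oE expr1 mulN1r -(volU e0 z _ e0U Uz (t5 _) Ee) -(volT z z _ zT Ue (t5 _) Ez) ale.
  by move=> E; apply: (mulIf ve0); rewrite mulNr E opprK mulrC.
have sq z : z \in Q -> aff_det x z (enum (Q :\ z)) ^+ 2 = (24%:R * al z) ^+ 2.
  move=> zQ; have e5 : size (enum (Q :\ z)) = 5%N by rewrite -cardE Qz5.
  move: (zQ); rewrite inE => /orP[zT|zU].
    rewrite -(sqrrN (_ * _)) -mulrN -(volT' z zT) (volT z z _ zT (enum_uniq _) e5 (enumE _)).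
    by rewrite mulrC mulfVK ?pnatr_eq0 // exprMn sqrr_sign mul1r.
  rewrite -(volU' z zU) (volU z z _ zU (enum_uniq _) e5 (enumE _)).
  by rewrite mulrC mulfVK ?pnatr_eq0 // exprMn sqrr_sign mul1r.
exists x, al; split=> // [z zQ|z zQ]; last by split; [exact: real|exact: sq].
move: (zQ); rewrite inE => /orP[zT|zU]; last by rewrite -(volU' z zU); apply/nd/sU.
by rewrite -oppr_eq0 -(volT' z zT); apply/nd'/sT.
Qed.

End MoveGeometry.

Lemma simplex_realizes (R : realType) (V : finType) (K : {set {set V}}) (b : V)
    (orn : seq V -> bool) (phi : seq V -> 'rV[R]_4 -> 'rV[R]_4) (f : seq V -> 'rV[R]_4) s :
  is_complex K -> connected_complex K -> orientation K orn -> [set b] \in K ->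
  pi1_hom K b phi -> equivariant_map K b phi f -> nondegenerate K b orn f ->
  s \in simplices4 K -> exists x, realizes (len2 K b f) x s.
Proof.
move=> cK conn or bK Hphi Hf nd sS; have [sK s5 _] := simplexP cK sS.
have [_ Kd] := cK; have [pp lp] := path_toP cK bK conn sK.
exists (vertex_image K b f s); split=> // [u v us vs uv|o].
  apply: (len2_lift cK bK Hphi Hf conn pp uv); apply: (Kd s) => //.
    by apply/subsetP=> y; rewrite in_setU in_set2 in_set1 => /orP[/orP[]|]/eqP->.
  by apply/set0Pn; exists v; rewrite !inE eqxx !orbT.
have mot : motion (fun y : 'rV[R]_4 => y).
  exists 1%:M, 0; split=> [||y]; [by rewrite mul1mx trmx1|exact: det1|].
  by rewrite mulmx1 addr0.
have e5 : size (enum s) = 5%N by rewrite -cardE.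
have Es : s = [set v in enum s] by apply/setP=> v; rewrite inE mem_enum.
have := nd s sS; rewrite (ovolE o or mot sK (fun v _ => erefl) (enum_uniq s) e5 Es).
by apply: contraNneq => ->; rewrite mulr0 mul0r.
Qed.

Section ClusterSum.
Context {R : realType} {V : finType} {L : {set V} -> R} {Q : {set V}}.
Context {x : V -> 'rV[R]_4} {al : V -> R}.
Hypotheses (Q6 : #|Q| = 6%N) (al0 : forall z, z \in Q -> al z != 0).
Hypotheses (sum1 : \sum_(y in Q) al y = 0) (sumx : \sum_(y in Q) al y *: x y = 0).
Hypothesis real : forall z, z \in Q -> realizes L x (Q :\ z) /\
  aff_det x z (enum (Q :\ z)) ^+ 2 = (24%:R * al z) ^+ 2.

Lemma cluster_angles (j : {set V}) (d : {set V} -> R) : j \subset Q -> #|j| = 3%N ->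
  0 < area L j /\
  \sum_(z in Q :\: j) Num.sg (al z) * ddihedral L (Q :\ z) j d =
  area L j / \prod_(z in Q :\: j) al z * @cluster_form _ _ d al Q.
Proof.
move=> jQ j3; have [a [b [c Ej]]] := enum3P j3.
have c3 : #|Q :\: j| = 3%N by rewrite cardsD (setIidPr jQ) Q6 j3.
have [u [v [w Ec]]] := enum3P c3.
have E : [:: a; b; c; u; v; w] = enum j ++ enum (Q :\: j) by rewrite Ej Ec.
have U6 : uniq [:: a; b; c; u; v; w].
  rewrite E cat_uniq !enum_uniq andbT /=; apply/hasPn=> y.
  by rewrite !mem_enum inE => /andP[].
have EQ : Q = [set y in [:: a; b; c; u; v; w]].
  apply/setP=> y; rewrite inE E mem_cat !mem_enum inE.
  by have := subsetP jQ y; case: (y \in j) => // ->.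
have big3 (M : Type) (idx : M) (op : Monoid.com_law idx) (F : V -> M) :
    \big[op/idx]_(z in Q :\: j) F z = op (op (F u) (F v)) (F w).
  by rewrite -big_enum Ec !big_cons big_nil Monoid.mulm1 Monoid.mulmA.
rewrite !big3 [X in @cluster_form _ _ _ _ X]EQ.
have [||||] := @six_point_angles R V L d x al a b c u v w j Ej U6; rewrite -?EQ //.
move=> z zl; apply: real; rewrite EQ inE -[X in _ \in X]/([:: a; b; c] ++ [:: u; v; w]).
by rewrite mem_cat zl orbT.
Qed.

End ClusterSum.

Section MoveRows.
Context {R : realType} {V : finType} {K : {set {set V}}} {b : V} {orn orn' : seq V -> bool}.
Context {phi : seq V -> 'rV[R]_4 -> 'rV[R]_4} {f : seq V -> 'rV[R]_4} {T U : {set V}}.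
Let Q := T :|: U.
Let K' := move33 K T U.
Let L := len2 K b f.
Let vol := ovol K b orn f.
Let vol' := ovol K' b orn' f.
Hypotheses (mK : closed_PL4_manifold R K) (conn : connected_complex K) (bK : [set b] \in K).
Hypotheses (or : orientation K orn) (or' : orientation K' orn').
Hypothesis orr' : forall t : 5.-tuple V, uniq t ->
  [set v in t] \in K -> [set v in t] \in K' -> orn' t = orn t.
Hypotheses (Hphi : pi1_hom K b phi) (Hf : equivariant_map K b phi f).
Hypotheses (nd : nondegenerate K b orn f) (nd' : nondegenerate K' b orn' f).
Hypotheses (T3 : #|T| = 3%N) (U3 : #|U| = 3%N) (TU : [disjoint T & U]).
Hypotheses (TK : T \in K) (UK : U \notin K).
Hypothesis HS : [set s in simplices4 K | T \subset s] = [set Q :\ z | z in U].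

Let cK : is_complex K. Proof. by case: mK. Qed.

Lemma vol_common s : s \in simplices4 K -> ~~ (T \subset s) -> vol' s = vol s.
Proof.
move=> sS Ts; have [sK s5 _] := simplexP cK sS.
have e5 : size (enum s) == 5%N by rewrite -cardE s5.
have Es : [set v in Tuple e5] = s by apply/setP=> v; rewrite inE mem_enum.
have oE : orn' (enum s) = orn (enum s).
  apply: (orr' (t := Tuple e5)); rewrite ?enum_uniq ?Es //.
  by rewrite move33P sK Ts.
rewrite /vol' /vol /ovol oE; case: (enum s) => [//|o t].
congr (_ * \det _ / _); apply/matrixP=> i k; rewrite !mxE.
by rewrite !(move33_vertex_image T3 U3).
Qed.

(** New 4-simplices have the sign opposite to that of [al], so removing the old angles and adding
    the new ones contribute alike: a row changes by the signed angles of all 4-simplices of the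
    cluster at its face. Around [T] only the old ones occur, around [U] only the new ones. *)
Lemma move_rows : exists (al : V -> R) (c lam : {set V} -> R),
  [/\ forall z, z \in Q -> al z != 0,
    (forall z, z \in U -> vol (Q :\ z) = al z) /\ (forall z, z \in T -> vol' (Q :\ z) = - al z),
    (0 < area L T /\ 0 < area L U) /\
    (c T = area L T / \prod_(z in U) al z /\ c U = area L U / \prod_(z in T) al z),
    (forall a, domega_dL K vol L T a = - (c T * lam a)) /\
    (forall a, domega_dL K' vol' L U a = c U * lam a)
  & forall j a, j \in faces K -> j != T ->
    domega_dL K' vol' L j a = domega_dL K vol L j a + c j * lam a].
Proof.
have [x [al [al0 sum1 sumx real [volU volT]]]] : exists (x : V -> 'rV[R]_4) (al : V -> R),
  [/\ forall z, z \in Q -> al z != 0, \sum_(y in Q) al y = 0, \sum_(y in Q) al y *: x y = 0,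
    forall z, z \in Q -> realizes L x (Q :\ z) /\
      aff_det x z (enum (Q :\ z)) ^+ 2 = (24%:R * al z) ^+ 2
  & (forall z, z \in U -> vol (Q :\ z) = al z) /\ (forall z, z \in T -> vol' (Q :\ z) = - al z)]
  := cluster_dependency mK conn bK or or' orr' Hphi Hf nd nd' T3 U3 TU TK UK HS.
have TsQ : T \subset Q by exact: subsetUl.
have UsQ : U \subset Q by exact: subsetUr.
have Q6 : #|Q| = 6%N by rewrite /Q cardsU disjoint_setI0 // cards0 T3 U3.
(* A face not contained in the six vertices belongs to none of the six 4-simplices, so its row must
   not change. *)
pose c (j : {set V}) := if j \subset Q then area L j / \prod_(z in Q :\: j) al z else 0.
pose lam a := @cluster_form _ _ (unit_dir R a) al Q.
have QT : Q :\: T = U.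
  by rewrite /Q setDUl setDv set0U; apply/setDidPl; rewrite disjoint_sym.
have QU : Q :\: U = T by rewrite /Q setDUl setDv setU0; apply/setDidPl.
have ang (j a : {set V}) : j \subset Q -> #|j| = 3%N -> 0 < area L j /\
    \sum_(z in Q :\: j) Num.sg (al z) * ddihedral L (Q :\ z) j (unit_dir R a) = c j * lam a.
  by move=> jQ j3; rewrite /c jQ; apply: (cluster_angles Q6 al0 sum1 sumx real).
have cK' : is_complex K' by exact: (move33_complex cK U3 HS).
have realK s : s \in simplices4 K -> exists x, realizes L x s.
  exact: (simplex_realizes cK conn or bK Hphi Hf nd).
have realK' s : s \in simplices4 K' -> exists x, realizes L x s.
  rewrite move33_simplices // in_setU => /orP[|/imsetP[z zT ->]].
    by rewrite inE => /andP[sS _]; apply: realK.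
  by exists x; apply: (real _ _).1; apply: (subsetP TsQ).
have TF : T \in faces K by rewrite inE TK T3.
have F'E : faces K' = U |: (faces K :\ T) := move33_faces T3 U3 TU UK.
exists al, c, lam; split=> //.
- split; last by rewrite /c TsQ UsQ QT QU.
  by split; [case: (ang T set0 TsQ T3)|case: (ang U set0 UsQ U3)].
- split=> a.
    rewrite (domega_dLE cK realK) // -(ang T a TsQ T3).2 QT; congr (- _).
    rewrite big_mkcondr (big_old_simplices HS) /= big1 ?add0r.
      by apply: eq_bigr => z zU; rewrite (old_simplex HS zU).2 volU.
    by move=> s; rewrite inE => /andP[_ /negPf->].
  rewrite (domega_dLE cK' realK'); last by rewrite F'E setU11.
  rewrite big_mkcondr (big_new_simplices cK T3 U3 TU UK) /= big1 ?add0r.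
    rewrite -(ang U a UsQ U3).2 QU -sumrN; apply: eq_bigr => z zT.
    rewrite (face_in_simplex z UsQ) (disjointFr TU zT) /= volT // sgrN mulNr opprK //.
  move=> s; rewrite inE => /andP[sS _]; have [sK _ _] := simplexP cK sS.
  by rewrite (negPf (faceU_notK cK U3 UK sK)).
move=> j a jF jT.
have jF' : j \in faces K' by rewrite F'E !inE jT; move: jF; rewrite inE => ->; rewrite orbT.
rewrite (domega_dLE cK realK) // (domega_dLE cK' realK') //.
rewrite !big_mkcondr (big_old_simplices HS) (big_new_simplices cK T3 U3 TU UK) /=.
rewrite (eq_bigr (fun s : {set V} => if j \subset s then Num.sg (vol s) * ddihedral L s j (unit_dir R a) else 0)) => [|s]; last first.
  by rewrite inE => /andP[sS Ts]; rewrite vol_common.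
set X := \sum_(s in _) _.
have -> : c j * lam a = \sum_(z in Q) if j \subset Q :\ z then
    Num.sg (al z) * ddihedral L (Q :\ z) j (unit_dir R a) else 0.
  have [jQ|jQ] := boolP (j \subset Q).
    have j3 : #|j| = 3%N by move: jF; rewrite inE => /andP[_ /eqP].
    rewrite -(ang j a jQ j3).2 -big_mkcondr; apply: eq_bigl => z.
    by rewrite face_in_simplex // inE andbC.
  rewrite /c (negPf jQ) mul0r big1 // => z _; case: ifP => // jz.
  by rewrite (subset_trans jz) ?subsetDl in jQ.
rewrite [X in _ = _ + X](eq_bigl [predU T & U]) => [|z]; last by rewrite in_setU.
rewrite bigU //= !opprD -addrA; congr (_ + _).
rewrite (addrC (\sum_(z in T) _)) addrA [X in _ = X + _](_ : _ = 0) ?add0r.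
  rewrite -sumrN; apply: eq_bigr => z zT; case: ifP => _; last by rewrite oppr0.
  by rewrite volT // sgrN mulNr opprK.
rewrite -sumrN -big_split /= big1 // => z zU; case: ifP => _; last by rewrite addr0 oppr0.
by rewrite volU // addNr.
Qed.

End MoveRows.

(** * Effect of a move on minors and rank *)

Lemma minor_row_change (R : comPzRingType) (T T' : Type) (x0 : T) (y0 : T') (n : nat)
    (A A' : T -> T' -> R) (t u : T) (e : seq T) (c : seq T') (k : R) (v : T -> R) :
  (forall j : 'I_n.+1, A' u (nth y0 c j) = k * A t (nth y0 c j)) ->
  (forall (i : 'I_n) (j : 'I_n.+1), A' (nth x0 e i) (nth y0 c j) =
     A (nth x0 e i) (nth y0 c j) + v (nth x0 e i) * A t (nth y0 c j)) ->
  minor x0 y0 n.+1 A' (u :: e) c = k * minor x0 y0 n.+1 A (t :: e) c.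
Proof.
move=> Hu He; rewrite /minor -[n.+1]/(1 + n)%N.
pose row (B : T -> T' -> R) z : 'M[R]_(1, 1 + n) := \row_j B z (nth y0 c j).
pose rest (B : T -> T' -> R) : 'M[R]_(n, 1 + n) := \matrix_(i, j) B (nth x0 e i) (nth y0 c j).
have split_rows (B : T -> T' -> R) z :
    \matrix_(i < 1 + n, j < 1 + n) B (nth x0 (z :: e) i) (nth y0 c j) = col_mx (row B z) (rest B).
  apply/matrixP=> i j; rewrite mxE [RHS]mxE.
  by case: splitP => i' ->; rewrite mxE ?ord1.
pose cv : 'cV[R]_n := \col_i v (nth x0 e i).
rewrite !split_rows.
have -> : col_mx (row A' u) (rest A') = block_mx k%:M 0 cv 1%:M *m col_mx (row A t) (rest A).
  rewrite mul_block_col mul0mx addr0 mul1mx mul_scalar_mx; congr col_mx.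
    by apply/rowP=> j; rewrite !mxE Hu.
  by apply/matrixP=> i j; rewrite !mxE big_ord1 !mxE He addrC.
by rewrite det_mulmx det_lblock det1 mulr1 det_scalar expr1.
Qed.

Section MoveMinor.
Context {R : realType} {V : finType} {K K' : {set {set V}}} {vol vol' L : {set V} -> R}.
Context {T U : {set V}} {c lam : {set V} -> R}.
Hypotheses (edgesE : edges K' = edges K) (facesE : faces K' = U |: (faces K :\ T)).
Hypotheses (TF : T \in faces K) (UF : U \notin faces K) (cT : c T != 0) (cU : c U != 0).
Hypothesis rowT : forall a, domega_dL K vol L T a = - (c T * lam a).
Hypothesis rowU : forall a, domega_dL K' vol' L U a = c U * lam a.
Hypothesis row : forall j a, j \in faces K -> j != T ->
  domega_dL K' vol' L j a = domega_dL K vol L j a + c j * lam a.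

Lemma lam_rowT a : lam a = - (domega_dL K vol L T a / c T).
Proof. by rewrite rowT mulNr opprK mulrC mulKf. Qed.

Lemma move_minor (C D : {set {set V}}) : largest_minor K vol L C D -> T \in D ->
  exists eps : bool, square_minor K' vol' L C (U |: (D :\ T)) =
    (-1) ^+ eps * (- (c U / c T) * square_minor K vol L C D).
Proof.
move=> [[CE DF CD nz] _] TD.
have UD : U \notin D :\ T by rewrite inE negb_and; apply/orP; right; apply: contra UF => /(subsetP DF).
pose e := enum (D :\ T); pose n := size e.
have Cn : #|C| = n.+1 by rewrite CD (cardsD1 T) TD add1n /n /e -cardE.
have pe (z : {set V}) : z \notin D :\ T -> perm_eq (enum (z |: (D :\ T))) (z :: e).
  move=> zD; apply: uniq_perm; rewrite ?enum_uniq //= ?mem_enum ?zD ?enum_uniq // => y.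
  by rewrite mem_enum !inE mem_enum !inE.
have TD' : T \notin D :\ T by rewrite !inE eqxx.
have [e1 E1] := @minor_perm_rows R _ {set V} finset.set0 finset.set0 n.+1 _ (U :: e) erefl (pe _ UD).
have [e2 E2] := @minor_perm_rows R _ {set V} finset.set0 finset.set0 n.+1 _ (T :: e) erefl (pe _ TD').
exists (e1 (+) e2); rewrite !(square_minorE _ _ _ _ Cn) E1.
have -> : enum D = enum (T |: (D :\ T)) by rewrite setD1K.
rewrite E2 (@minor_row_change _ _ _ _ _ _ (domega_dL K vol L) _ T _ _ _ (- (c U / c T)) (fun j => - (c j / c T))).
- rewrite signr_addb; set m := minor _ _ _ _ _ _.
  have sq : (-1) ^+ e2 * (-1) ^+ e2 = 1 :> R by rewrite -signr_addb addbb.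
  rewrite -[RHS]mulrA; congr (_ * _).
  by rewrite [RHS]mulrCA [in RHS](mulrA ((-1) ^+ e2)) sq mul1r.
- by move=> j; rewrite rowU lam_rowT; field.
move=> i j; have ie : nth finset.set0 e i \in D :\ T by rewrite -mem_enum mem_nth.
move: ie; rewrite !inE => /andP[iT /(subsetP DF) iF].
by rewrite row // lam_rowT; field.
Qed.

(** The minor stays nonzero by [move_minor]. It stays largest because every new row is a combination
    of old rows, hence of those in [D]; the coefficients [X'] factor the new matrix through
    dimension [#|C|]. *)
Lemma move_largest (C D : {set {set V}}) : largest_minor K vol L C D -> T \in D ->
  largest_minor K' vol' L C (U |: (D :\ T)).
Proof.
move=> lCD TD; have [[CE DF CD nz] _] := lCD.
have UD : U \notin D :\ T by rewrite inE negb_and; apply/orP; right; apply: contra UF => /(subsetP DF).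
split.
  have [eps E] := move_minor lCD TD; split.
  - by rewrite edgesE.
  - by rewrite facesE setUS // setSD.
  - by rewrite cardsU1 UD CD (cardsD1 T D) TD.
  by rewrite E mulf_neq0 ?signr_eq0 // mulf_neq0 // oppr_eq0 mulf_neq0 ?invr_eq0.
move=> C' D' [C'E D'F CD' nz']; have [X HX] := rank_factorization lCD.
pose X' i k := if i == U then - (c U / c T) * X T k else X i k - c i / c T * X T k.
rewrite (square_minorE _ _ _ _ erefl) in nz'.
apply: (minor_rank_le (X := X')
  (Y := fun k a => domega_dL K vol L (nth finset.set0 (enum D) k) a)) nz' => i j.
have jE := mem_nth_enum C'E (ltn_ord j); rewrite edgesE in jE.
have iD : (i < #|D'|)%N by rewrite -CD'.
have := mem_nth_enum D'F iD; rewrite facesE.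
move: (nth _ (enum C') j) (nth _ (enum D') i) jE => a i' aE.
have ET := HX T a TF aE.
rewrite in_setU1 => /orP[/eqP->|].
  rewrite rowU lam_rowT ET /X' eqxx.
  transitivity (- (c U / c T) * \sum_k X T k * domega_dL K vol L (nth finset.set0 (enum D) k) a).
    by field.
  by rewrite mulr_sumr; apply: eq_bigr => k _; rewrite mulrA.
rewrite in_setD1 => /andP[iT iF].
have iU : (i' == U) = false by apply/negbTE; apply: contraNneq UF => <-.
rewrite row // lam_rowT ET (HX i' a iF aE) /X' iU.
transitivity (\sum_k X i' k * domega_dL K vol L (nth finset.set0 (enum D) k) a -
   c i' / c T * \sum_k X T k * domega_dL K vol L (nth finset.set0 (enum D) k) a).
  by field.
by rewrite mulr_sumr -sumrB; apply: eq_bigr => k _; rewrite mulrBl mulrA.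
Qed.

End MoveMinor.

Lemma move33_simplices_around (V : finType) (K : {set {set V}}) (a b c d e f : V) :
  move33_applicable K a b c d e f ->
  [/\ #|[set a; b; c]| = 3%N, #|[set d; e; f]| = 3%N, [disjoint [set a; b; c] & [set d; e; f]] &
    [set s in simplices4 K | [set a; b; c] \subset s] =
    [set ([set a; b; c] :|: [set d; e; f]) :\ z | z in [set d; e; f]]].
Proof.
move=> [U6 _ HS _]; move: U6.
rewrite -[X in uniq X]/([:: a; b; c] ++ [:: d; e; f]) cat_uniq => /and3P[U1 /hasPn dj U2].
have E (x y z : V) : [set x; y; z] = [set v in [:: x; y; z]].
  by apply/setP=> v; rewrite !inE orbA.
have card3 (x y z : V) : uniq [:: x; y; z] -> #|[set x; y; z]| = 3%N.
  by move=> Ux; rewrite E cardsE; apply/card_uniqP.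
split; [exact: card3|exact: card3| |].
  apply/pred0P=> v; apply/negbTE/negP=> /andP[]; rewrite /= !E inE [v \in [set _ in _]]inE.
  by move=> vT /dj/negP.
rewrite HS.
have nv v : v \in [:: d; e; f] -> (v \in [:: a; b; c]) = false by move/dj/negbTE.
have rm z p q : z \in [:: d; e; f] -> uniq [:: z; p; q] -> [set d; e; f] = [set z; p; q] ->
    ([set a; b; c] :|: [set d; e; f]) :\ z = [set a; b; c; p; q].
  move=> zd; rewrite /= !inE negb_or => /andP[/andP[zp zq] _] ->.
  have zabc : z \notin [set a; b; c] by rewrite E inE (nv _ zd).
  apply/setP=> v; rewrite in_setD1 !in_setU !in_set1 -!orbA.
  have [->|vz] := eqVneq v z; last by rewrite !orbA.
  move: zabc; rewrite !inE !negb_or => /andP[/andP[/negPf-> /negPf->] /negPf->].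
  by rewrite (negPf zp) (negPf zq).
have roll (x y z : V) : [set x; y; z] = [set y; z; x] by rewrite -setUA setUC.
move: U2; rewrite /= !inE !negb_or => /and3P[/andP[nde ndf] nef _].
have -> : [set a; b; c; d; e] = ([set a; b; c] :|: [set d; e; f]) :\ f.
  apply/esym/rm; first by rewrite !inE eqxx !orbT.
    by rewrite /= !inE !negb_or !(eq_sym f) ndf nef nde.
  by rewrite (roll d) (roll e).
have -> : [set a; b; c; e; f] = ([set a; b; c] :|: [set d; e; f]) :\ d.
  apply/esym/rm => //; first by rewrite !inE eqxx.
  by rewrite /= !inE !negb_or nde ndf nef.
have -> : [set a; b; c; f; d] = ([set a; b; c] :|: [set d; e; f]) :\ e.
  apply/esym/rm; first by rewrite !inE eqxx !orbT.
    by rewrite /= !inE !negb_or (eq_sym e d) nef nde eq_sym ndf.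
  exact: roll.
by rewrite !imsetU !imset_set1 [RHS]setUC [RHS]setUA.
Qed.

Theorem theorem5 (R : realType) (V : finType) (K : {set {set V}}) (b : V)
    (orn : seq V -> bool)
    (phi : seq V -> 'rV[R]_4 -> 'rV[R]_4) (f : seq V -> 'rV[R]_4) :
  let L := len2 K b f in
  let vol := ovol K b orn f in
  closed_PL4_manifold R K -> connected_complex K -> orientation K orn ->
  [set b] \in K ->
  pi1_hom K b phi -> equivariant_map K b phi f ->
  nondegenerate K b orn f -> regular_areas K L -> flat K vol L ->
  (forall C D C' D' : {set {set V}},
     largest_minor K vol L C D -> largest_minor K vol L C' D' ->
     exists eps : bool, forall u w : nat -> {set V} -> R,
       (forall k, area_deformations K vol L (u k)) ->
       (forall k, length_deformations K vol L (w k)) ->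
       value K vol L C D u w = (-1) ^+ eps * value K vol L C' D' u w) /\
  (forall (A B C D E F : V) (orn' : seq V -> bool),
     let ABC := [set A; B; C]%SET in
     let DEF := [set D; E; F]%SET in
     let K' := move33 K ABC DEF in
     let L' := len2 K' b f in
     let vol' := ovol K' b orn' f in
     move33_applicable K A B C D E F ->
     orientation K' orn' ->
     (forall t : 5.-tuple V, uniq t ->
        [set x in t]%SET \in K -> [set x in t]%SET \in K' -> orn' t = orn t) ->
     nondegenerate K' b orn' f -> regular_areas K' L' ->
     forall CC DD : {set {set V}},
       largest_minor K vol L CC DD -> ABC \in DD ->
       let DD' := DEF |: (DD :\ ABC) in
       largest_minor K' vol' L' CC DD' /\
       (exists eps : bool,
          coefficient K' vol' L' CC DD' =
          (-1) ^+ eps * coefficient K vol L CC DD)).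
Proof.
move=> L vol mK conn or bK Hphi Hf nd reg _; have [cK _] := mK; split.
  move=> C D C' D'; apply: value_independent => i a iF.
  apply: (dOmega_dSE cK) => // s sS.
  exact: (simplex_realizes cK conn or bK Hphi Hf nd sS).
move=> A B C D E F orn' T U K' L' vol' Happ or' orr' nd' _ CC DD lCD TDD DD'.
have [T3 U3 TU HS] := move33_simplices_around Happ.
have [_ TF _ UK] := Happ; rewrite -/T -/U in T3 U3 TU HS TF UK.
have TK : T \in K by move: TF; rewrite inE => /andP[].
have UF : U \notin faces K by rewrite inE (negPf UK).
have edgesE : edges K' = edges K := move33_edges T3 U3.
have facesE : faces K' = U |: (faces K :\ T) := move33_faces T3 U3 TU UK.
have L'E : L' = L := move33_len2 T3 U3.
have [al [c [lam [al0 [volU volT] [[ST SU] [cTE cUE]] [rowT rowU] row]]]] :=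
  move_rows mK conn bK or or' orr' Hphi Hf nd nd' T3 U3 TU TK UK HS.
rewrite -/L -/vol -/K' -/vol' in volU volT ST SU cTE cUE rowT rowU row.
set PT := \prod_(z in T) al z in cUE; set PU := \prod_(z in U) al z in cTE.
have PT0 : PT != 0 by apply/prodf_neq0 => z zT; apply: al0; rewrite inE zT.
have PU0 : PU != 0 by apply/prodf_neq0 => z zU; apply: al0; rewrite inE zU orbT.
have cT0 : c T != 0 by rewrite cTE mulf_neq0 ?invr_eq0 // gt_eqF.
have cU0 : c U != 0 by rewrite cUE mulf_neq0 ?invr_eq0 // gt_eqF.
rewrite L'E; split.
  exact: (move_largest edgesE facesE TF UF cT0 cU0 rowT rowU row lCD TDD).
have [eps Em] := move_minor UF cT0 rowT rowU row lCD TDD.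
(* The ratio [c U / c T] equals [area L U * PU / (area L T * PT)]: it compensates the replacement of
   [area L T] by [area L U] in the numerator and of [PU] by [PT] in the denominator. *)
exists eps; rewrite /coefficient Em.
have -> : \prod_(i in faces K') area L i = area L U * \prod_(i in faces K :\ T) area L i.
  by rewrite facesE big_setU1 // inE (negPf UF) andbF.
have -> : \prod_(i in faces K) area L i = area L T * \prod_(i in faces K :\ T) area L i.
  by rewrite -(setD1K TF) big_setU1 ?setD1K // !inE eqxx.
set W := \prod_(s in [set s in simplices4 K | ~~ (T \subset s)]) vol s.
have -> : \prod_(s in simplices4 K) vol s = W * PU.
  rewrite (big_old_simplices HS); congr (_ * _).
  by apply: eq_bigr => z zU; rewrite volU.
have -> : \prod_(s in simplices4 K') vol' s = - (W * PT).
  rewrite (big_new_simplices cK T3 U3 TU UK) -mulrN; congr (_ * _).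
    apply: eq_bigr => s; rewrite inE => /andP[sS Ts].
    exact: (vol_common mK orr' T3 U3 sS Ts).
  (* Three new 4-simplices give three minus signs; the remaining one cancels that of
     [- (c U / c T)]. *)
  transitivity (\prod_(z in T) - al z); first by apply: eq_bigr => z zT; rewrite volT.
  by rewrite prodrN T3 -signr_odd mulN1r.
rewrite cTE cUE.
have [[_ _ _ m0] _] := lCD.
have W0 : W != 0.
  by apply/prodf_neq0 => s; rewrite inE => /andP[sS _]; apply: nd.
have ST0 : area L T != 0 by rewrite gt_eqF.
have SU0 : area L U != 0 by rewrite gt_eqF.
move: (square_minor _ _ _ _ _) (\prod_(i in _) _) m0 => m P m0.
have : (-1) ^+ eps * (-1) ^+ eps = 1 :> R by rewrite -signr_addb addbb.
have : (-1) ^+ eps != 0 :> R by rewrite signr_eq0.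
move: ((-1) ^+ eps) => s s0 ss.
have -> : s * (area L T * P / (m * (W * PU))) = s^-1 * (area L T * P / (m * (W * PU))).
  by rewrite -[s in LHS](mulfK s0) ss mul1r.
by field; rewrite ?s0 ?m0 ?W0 ?PU0 ?PT0 ?ST0 ?SU0.
Qed.
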